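(* Let $C$ be a pointed computable $K$-coalgebra with a fixed decomposition $\mathrm{soc}\,{}_CC=\bigoplus_{j\in I_C}S(j)$, and let $\mathfrak c_C=[\mathbf c_{ij}]_{i,j\in I_C}\in\mathbb M_{I_C}(\mathbb Z)$ be the left Cartan matrix of $C$. (a) If $C$ is a left sharp Euler coalgebra, then the matrix $\mathfrak c_C^{\leftarrow}=[\mathbf c^-_{ij}]_{i,j\in I_C}\in\mathbb M_{I_C}(\mathbb Z)$ with $\mathbf c^-_{jp}=\sum_{m=0}^\infty(-1)^md^{(j)}_{mp}\in\mathbb Z$ is row-finite and is a left inverse of $\mathfrak c_C$ in $\mathbb M_{I_C}(\mathbb Z)$. Moreover, for each $j\in I_C$, $\mathbf{dim}\,\widehat E(j)\cdot(\mathfrak c_C^{\leftarrow})^{tr}=\mathbf{dim}\,S(j)=e_j$, where $\mathbf{dim}\,\widehat E(j)$ is the $j$-th column of $\mathfrak c_C$ (written as a row vector). (b) If $C$ is a right sharp Euler coalgebra, then the matrix $\mathfrak c_C^{\rightarrow}=[\widehat{\mathbf c}^-_{ij}]_{i,j\in I_C}\in\mathbb M_{I_C}(\mathbb Z)$ with $\widehat{\mathbf c}^-_{jp}=\sum_{m=0}^\infty(-1)^m\widehat d^{(p)}_{mj}\in\mathbb Z$ is column-finite and is a right inverse of $\mathfrak c_C$ in $\mathbb M_{I_C}(\mathbb Z)$. Moreover, for each $j\in I_C$, $\mathbf{dim}\,E(j)\cdot\mathfrak c_C^{\rightarrow}=\mathbf{dim}\,S(j)=e_j$. (c) If $C$ is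 a sharp Euler coalgebra, then $\mathfrak c_C^{\leftarrow}=\mathfrak c_C^{\rightarrow}$, and the matrix $$\mathfrak c_C^{-1}:=\mathfrak c_C^{\leftarrow}=\mathfrak c_C^{\rightarrow}=[\mathbf c^-_{ij}]_{i,j\in I_C},\qquad \mathbf c^-_{ij}=\widehat{\mathbf c}^-_{ij}=\sum_{m=0}^\infty(-1)^md^{(i)}_{mj}=\sum_{m=0}^\infty(-1)^m\widehat d^{(j)}_{mi},$$ is both row-finite and column-finite, and $\mathfrak c_C^{-1}$ is a left inverse and a right inverse of $\mathfrak c_C$.
   Context: $K$ is an arbitrary field, $D(-)=\mathrm{Hom}_K(-,K)$, $C$ a $K$-coalgebra, $C^*=\mathrm{Hom}_K(C,K)$ the convolution algebra; left (right) $C$-comodules are viewed as rational right (left) $C^*$-modules. Right $C$-comodules are also called $C^{op}$-comodules. $C$ is pointed if all simple comodules are one-dimensional. Then $\mathrm{soc}\,{}_CC=\bigoplus_{j\in I_C}S(j)$ with $\{S(j)\}_{j\in I_C}$ a set of representatives of the simple left $C$-comodules; $E(j)$ is the injective envelope of $S(j)$; $\widehat S(j)=DS(j)$ are the simple right $C$-comodules, with injective envelopes $\widehat E(j)$. Primitive idempotents $e_j\in C^*$ are fixed with $E(j)\cong e_jC$ and $\widehat E(j)\cong Ce_j$. A comodule is socle-finite if its socle is finite-dimensional. The dimension vector of a left comodule $M$ is $\mathbf{dim}\,M=[\dim_KMe_j]_{j\in I_C}$, where $\dim_KMe_j=\dim_K\mathrm{Hom}_C(M,E(j))$ is the multiplicity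 of $S(j)$ as a composition factor of $M$; for a right comodule $X$, $\mathbf{dim}\,X=[\dim_K\mathrm{Hom}_C(X,\widehat E(j))]_{j\in I_C}$. In $\mathbb Z^{I_C}$, $e_j$ also denotes the $j$-th standard basis vector, so $\mathbf{dim}\,S(j)=e_j$. Vectors are row vectors. $C$ is computable if $\dim_K\mathrm{Hom}_C(E',E'')<\infty$ for all indecomposable injective left comodules $E',E''$. The left Cartan matrix is $\mathfrak c_C=[\mathbf c_{ij}]$, $\mathbf c_{ij}=\dim_Ke_iCe_j$, whose $i$-th row is $\mathbf{dim}\,E(i)$. $\mathbb M_{I_C}(\mathbb Z)$ is the set of $I_C\times I_C$ integer matrices; a product is formed when all the entry sums have only finitely many non-zero terms. A matrix is row-finite (column-finite) if each row (column) has finitely many non-zero entries. $(-)^{tr}$ is transpose. $C$ is a left (resp. right) sharp Euler coalgebra if it is computable and every simple left (resp. right) comodule $S$ has a finite injective resolution $0\to S\to E_0\to\cdots\to E_n\to0$ with all $E_m$ socle-finite. $C$ is a sharp Euler coalgebra if it is both left and right sharp Euler and $\dim_K\mathrm{Ext}^m_C(S,S')=\dim_K\mathrm{Ext}^m_{C^{op}}(DS',DS)$ for all $m\ge0$ and all simple left comodules $S,S'$. For $C$ left sharp Euler, $d^{(j)}_{mp}$ is the multiplicity of $E(p)$ as a direct summand of the $m$-th term $E^{(j)}_m\cong\bigoplus_{p\in I_C}E(p)^{d^{(j)}_{mp}}$ of a finite minimal injective resolution $0\to S(j)\to E^{(j)}_0\to E^{(j)}_1\to\cdots\to E^{(j)}_n\to0$.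 For $C$ right sharp Euler, $\widehat d^{(j)}_{mp}$ is the multiplicity of $\widehat E(p)$ in the $m$-th term $\widehat E^{(j)}_m\cong\bigoplus_{p\in I_C}\widehat E(p)^{\widehat d^{(j)}_{mp}}$ of a finite minimal injective resolution of $\widehat S(j)$. Multiplicities are $0$ beyond the length of the resolution. *)

(* Defs.v *)
From HB Require Import structures.
From mathcomp Require Import all_boot all_order all_algebra.
From mathcomp Require Import boolp classical_sets functions cardinality fsbigop.

Set Implicit Arguments.
Unset Strict Implicit.
Unset Printing Implicit Defensive.
Import GRing.Theory.
Local Open Scope ring_scope.
Local Open Scope classical_set_scope.
Local Open Scope quotient_scope.

Notation bilinear_map f := (bilinear_for *:%R *:%R f).

Section Tensor.
Variables (K : fieldType) (V W : lmodType K).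

(* A sequence [:: (v_1, w_1); ...; (v_n, w_n)] stands for the tensor
   v_1 (x) w_1 + ... + v_n (x) w_n; two sequences stand for the same tensor
   when no bilinear map separates them. *)
Definition bilin_sum (U : lmodType K) (f : V -> W -> U) (s : seq (V * W)) : U :=
  \sum_(p <- s) f p.1 p.2.

Definition tens_eq : rel (seq (V * W)) := fun s t =>
  `[< forall (U : lmodType K) (f : V -> W -> U),
        bilinear_map f -> bilin_sum f s = bilin_sum f t >].

Lemma tens_eq_refl : reflexive tens_eq.
Proof. by move=> s; apply/asboolP. Qed.

Lemma tens_eq_sym : symmetric tens_eq.
Proof.
by move=> s t; apply/asboolP/asboolP => h U f bf; rewrite (h U f bf).
Qed.

Lemma tens_eq_trans : transitive tens_eq.
Proof.
move=> t s u /asboolP h1 /asboolP h2; apply/asboolP => U f bf.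
by rewrite (h1 U f bf) (h2 U f bf).
Qed.

Canonical tens_equiv := EquivRel tens_eq tens_eq_refl tens_eq_sym tens_eq_trans.

Definition tensor := {eq_quot tens_equiv}.
HB.instance Definition _ := Choice.on tensor.

Definition tens_of (s : seq (V * W)) : tensor := \pi_({eq_quot tens_equiv}) s.
Definition tens_repr (t : tensor) : seq (V * W) := repr (t : {eq_quot tens_equiv}).

Lemma tens_reprK t : tens_of (tens_repr t) = t.
Proof. exact: reprK. Qed.

Lemma tens_ofP s t :
  (forall (U : lmodType K) (f : V -> W -> U),
     bilinear_map f -> bilin_sum f s = bilin_sum f t) <-> tens_of s = tens_of t.
Proof.
split=> [h|h]; first by apply/eqmodP/asboolP.
by have /eqmodP/asboolP := h.
Qed.

(* The linear map induced by f; meaningful when f is bilinear. *)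
Definition tlift (U : lmodType K) (f : V -> W -> U) (t : tensor) : U :=
  bilin_sum f (tens_repr t).

Lemma tlift_of (U : lmodType K) (f : V -> W -> U) s :
  bilinear_map f -> tlift f (tens_of s) = bilin_sum f s.
Proof.
move=> bf; have /tens_ofP h : tens_of (tens_repr (tens_of s)) = tens_of s.
  exact: tens_reprK.
exact: h.
Qed.

Lemma tens_ext (t u : tensor) :
  (forall (U : lmodType K) (f : V -> W -> U),
     bilinear_map f -> tlift f t = tlift f u) -> t = u.
Proof.
by move=> h; rewrite -(tens_reprK t) -(tens_reprK u); apply/tens_ofP.
Qed.

Lemma bilin_sum_cat (U : lmodType K) (f : V -> W -> U) s t :
  bilin_sum f (s ++ t) = bilin_sum f s + bilin_sum f t.
Proof. exact: big_cat. Qed.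

Lemma bilin_sum_scale (U : lmodType K) (f : V -> W -> U) (a : K) s :
  bilinear_map f ->
  bilin_sum f [seq (a *: p.1, p.2) | p <- s] = a *: bilin_sum f s.
Proof.
move=> bf; rewrite /bilin_sum big_map scaler_sumr; apply: eq_bigr => p _ /=.
exact: (scalable_linear (bf.1 p.2) a p.1).
Qed.

Definition tens_zero : tensor := tens_of [::].
Definition tens_add (t u : tensor) : tensor :=
  tens_of (tens_repr t ++ tens_repr u).
Definition tens_scale (a : K) (t : tensor) : tensor :=
  tens_of [seq (a *: p.1, p.2) | p <- tens_repr t].
Definition tens_opp (t : tensor) : tensor := tens_scale (-1) t.

Section Lift.
Variables (U : lmodType K) (f : V -> W -> U).
Hypothesis bf : bilinear_map f.

Lemma tlift_zero : tlift f tens_zero = 0.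
Proof. by rewrite tlift_of // /bilin_sum big_nil. Qed.

Lemma tlift_add t u : tlift f (tens_add t u) = tlift f t + tlift f u.
Proof. by rewrite tlift_of // bilin_sum_cat. Qed.

Lemma tlift_scale a t : tlift f (tens_scale a t) = a *: tlift f t.
Proof. by rewrite tlift_of // bilin_sum_scale. Qed.

Lemma tlift_opp t : tlift f (tens_opp t) = - tlift f t.
Proof. by rewrite tlift_scale scaleN1r. Qed.

End Lift.

Lemma tens_addA : associative tens_add.
Proof. by move=> t u v; apply: tens_ext => U f bf; rewrite !tlift_add // addrA. Qed.
Lemma tens_addC : commutative tens_add.
Proof. by move=> t u; apply: tens_ext => U f bf; rewrite !tlift_add // addrC. Qed.
Lemma tens_add0 : left_id tens_zero tens_add.
Proof.
by move=> t; apply: tens_ext => U f bf; rewrite tlift_add // tlift_zero // add0r.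
Qed.
Lemma tens_addN : left_inverse tens_zero tens_opp tens_add.
Proof.
move=> t; apply: tens_ext => U f bf.
by rewrite tlift_add // tlift_opp // tlift_zero // addNr.
Qed.

HB.instance Definition _ :=
  GRing.isZmodule.Build tensor tens_addA tens_addC tens_add0 tens_addN.

Lemma tens_scaleA a b t : tens_scale a (tens_scale b t) = tens_scale (a * b) t.
Proof. by apply: tens_ext => U f bf; rewrite !tlift_scale // scalerA. Qed.
Lemma tens_scale1 : left_id 1 tens_scale.
Proof. by move=> t; apply: tens_ext => U f bf; rewrite tlift_scale // scale1r. Qed.
Lemma tens_scaleDr : right_distributive tens_scale +%R.
Proof.
move=> a t u; apply: tens_ext => U f bf.
by rewrite tlift_scale // !tlift_add // !tlift_scale // scalerDr.
Qed.
Lemma tens_scaleDl t : {morph tens_scale^~ t : a b / a + b}.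
Proof.
move=> a b; apply: tens_ext => U f bf.
by rewrite tlift_scale // tlift_add // !tlift_scale // scalerDl.
Qed.

HB.instance Definition _ := GRing.Zmodule_isLmodule.Build K tensor
  tens_scaleA tens_scale1 tens_scaleDr tens_scaleDl.

Definition tens (v : V) (w : W) : tensor := tens_of [:: (v, w)].

(* The universal property of (tensor, tens). *)
Lemma tlift_tens (U : lmodType K) (f : V -> W -> U) v w :
  bilinear_map f -> tlift f (tens v w) = f v w.
Proof. by move=> bf; rewrite tlift_of // /bilin_sum big_seq1. Qed.

Lemma tlift_linear (U : lmodType K) (f : V -> W -> U) :
  bilinear_map f -> linear (tlift f).
Proof.
move=> bf a t u.
by rewrite -[a *: t + u]/(tens_add (tens_scale a t) u) tlift_add // tlift_scale.
Qed.

Lemma tens_bilinear : bilinear_map tens.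
Proof.
split=> [w a v v' | v a w w']; apply: tens_ext => U f bf.
  rewrite (tlift_linear bf) !tlift_tens //; exact: bf.1.
by rewrite (tlift_linear bf) !tlift_tens //; exact: bf.2.
Qed.

Lemma tens_sum (t : tensor) : exists s : seq (V * W), t = \sum_(p <- s) tens p.1 p.2.
Proof.
exists (tens_repr t); rewrite -{1}(tens_reprK t).
elim: (tens_repr t) => [|p s ih]; first by rewrite big_nil.
rewrite big_cons -ih; apply: tens_ext => U f bf.
rewrite -[_ + _]/(tens_add _ _) tlift_add // tlift_tens // !tlift_of //.
by rewrite /bilin_sum big_cons.
Qed.

Lemma tens_ind (P : tensor -> Prop) :
  P 0 -> (forall t u, P t -> P u -> P (t + u)) -> (forall v w, P (tens v w)) ->
  forall t, P t.
Proof.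
move=> P0 PD Pt t; have [s ->] := tens_sum t.
by elim: s => [|p s ih]; [rewrite big_nil | rewrite big_cons; apply: PD].
Qed.

End Tensor.

Section TensorMaps.
Variable K : fieldType.

Definition tmap (V W V' W' : lmodType K) (f : V -> V') (g : W -> W')
    : tensor V W -> tensor V' W' :=
  tlift (fun v w => tens (f v) (g w)).

Definition tswap (V W : lmodType K) : tensor V W -> tensor W V :=
  tlift (fun v w => tens w v).

Definition tassoc (U V W : lmodType K)
    : tensor U (tensor V W) -> tensor (tensor U V) W :=
  tlift (fun u => tlift (fun v w => tens (tens u v) w)).

Lemma tmap_bilinear (V W V' W' : lmodType K) (f : V -> V') (g : W -> W') :
  linear f -> linear g -> bilinear_map (fun v w => tens (f v) (g w)).
Proof.
move=> lf lg; split=> [w a v v' | v a w w'].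
  by rewrite lf; exact: (tens_bilinear _ _).1.
by rewrite lg; exact: (tens_bilinear _ _).2.
Qed.

Lemma tswap_bilinear (V W : lmodType K) :
  bilinear_map (fun (v : V) (w : W) => tens w v).
Proof.
split=> [w | v]; first exact: (tens_bilinear _ _).2.
exact: (tens_bilinear _ _).1.
Qed.

Lemma tassoc_bilinear2 (U V W : lmodType K) (u : U) :
  bilinear_map (fun (v : V) (w : W) => tens (tens u v) w).
Proof.
split=> [w a v v' | v a w w'].
  by rewrite (tens_bilinear _ _).2; exact: (tens_bilinear _ _).1.
exact: (tens_bilinear _ _).2.
Qed.

Lemma tassoc_bilinear (U V W : lmodType K) :
  bilinear_map (fun u : U => tlift (fun (v : V) (w : W) => tens (tens u v) w)).
Proof.
split=> [t a u u' | u]; last exact: tlift_linear (tassoc_bilinear2 _ _ _).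
elim/tens_ind: t => [|t t' ih ih'|v w].
- have z (u0 : U) : tlift (fun (v : V) (w : W) => tens (tens u0 v) w) 0 = 0.
    exact: tlift_zero (tassoc_bilinear2 V W u0).
  by rewrite /= !z /= scaler0 addr0.
- have D (u0 : U) x y : tlift (fun (v : V) (w : W) => tens (tens u0 v) w) (x + y) =
      tlift (fun v w => tens (tens u0 v) w) x + tlift (fun v w => tens (tens u0 v) w) y.
    exact: tlift_add (tassoc_bilinear2 V W u0) x y.
  by rewrite /= !D ih ih' /= scalerDr addrACA.
rewrite !tlift_tens; do ?exact: tassoc_bilinear2.
by rewrite (tens_bilinear _ _).1; exact: (tens_bilinear _ _).1.
Qed.

End TensorMaps.

Section TensorMapsTheory.
Variable K : fieldType.

Lemma linear_comp (U V W : lmodType K) (f : U -> V) (g : V -> W) :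
  linear f -> linear g -> linear (fun u => g (f u)).
Proof. by move=> lf lg a u v; rewrite lf lg. Qed.

Lemma tens_linear_ext (V W U : lmodType K) (f g : tensor V W -> U) :
  linear f -> linear g -> (forall v w, f (tens v w) = g (tens v w)) -> f =1 g.
Proof.
move=> lf lg fg t; elim/tens_ind: t => [|t u ft fu|//].
  have /= f0 := scalable_linear lf 0 0; have /= g0 := scalable_linear lg 0 0.
  by move: f0 g0; rewrite !scale0r => -> ->.
have := lf 1 t u; have := lg 1 t u; rewrite !scale1r => -> ->.
by rewrite ft fu.
Qed.

Lemma tmap_linear (V W V' W' : lmodType K) (f : V -> V') (g : W -> W') :
  linear f -> linear g -> linear (tmap f g).
Proof. by move=> lf lg; apply: tlift_linear; exact: tmap_bilinear. Qed.

Lemma tswap_linear (V W : lmodType K) : linear (@tswap K V W).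
Proof. by apply: tlift_linear; exact: tswap_bilinear. Qed.

Lemma tassoc_linear (U V W : lmodType K) : linear (@tassoc K U V W).
Proof. by apply: tlift_linear; exact: tassoc_bilinear. Qed.

Lemma tmapE (V W V' W' : lmodType K) (f : V -> V') (g : W -> W') v w :
  linear f -> linear g -> tmap f g (tens v w) = tens (f v) (g w).
Proof. by move=> lf lg; rewrite /tmap tlift_tens //; exact: tmap_bilinear. Qed.

Lemma tswapE (V W : lmodType K) (v : V) (w : W) : tswap (tens v w) = tens w v.
Proof. by rewrite /tswap tlift_tens //; exact: tswap_bilinear. Qed.

Lemma tassocE (U V W : lmodType K) (u : U) (v : V) (w : W) :
  tassoc (tens u (tens v w)) = tens (tens u v) w.
Proof.
rewrite /tassoc tlift_tens; last exact: tassoc_bilinear.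
by rewrite tlift_tens //; exact: tassoc_bilinear2.
Qed.

End TensorMapsTheory.

Record coalgebra (K : fieldType) := Coalgebra {
  coalg_sort :> lmodType K;
  comul : {linear coalg_sort -> tensor coalg_sort coalg_sort};
  counit : {scalar coalg_sort};
  comul_assoc : forall c,
    tassoc (tmap idfun comul (comul c)) = tmap comul idfun (comul c);
  counit_left : forall c, tlift (fun x y => counit x *: y) (comul c) = c;
  counit_right : forall c, tlift (fun x y => counit y *: x) (comul c) = c
}.

Section Opposite.
Variables (K : fieldType) (C : coalgebra K).

Definition op_comul (c : C) : tensor C C := tswap (comul C c).

Lemma op_comul_linear : linear op_comul.
Proof. apply: linear_comp; [exact: linearP | exact: tswap_linear]. Qed.

HB.instance Definition _ :=
  GRing.isLinear.Build K C (tensor C C) *:%R op_comul op_comul_linear.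

Lemma op_comul_assoc c :
  tassoc (tmap idfun op_comul (op_comul c)) = tmap op_comul idfun (op_comul c).
Proof.
have lid (V : lmodType K) : linear (@idfun V) by [].
have lD : linear (comul C) by exact: linearP.
have ls : linear (@tswap K C C) by exact: tswap_linear.
have lo := op_comul_linear.
pose phi t := tassoc (tswap (tmap (@tswap K C C) (@idfun C) t)).
have lphi : linear phi.
  apply: (linear_comp (f := fun t => tswap (tmap (@tswap K C C) (@idfun C) t)));
    last exact: tassoc_linear.
  by apply: linear_comp; [exact: tmap_linear | exact: tswap_linear].
have step1 : tassoc (tmap idfun op_comul (op_comul c)) =
    phi (tmap (comul C) idfun (comul C c)).
  rewrite [op_comul c]/op_comul; move: (comul C c) => t.
  refine (tens_linear_ext (f := fun t => tassoc (tmap idfun op_comul (tswap t)))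
    (g := fun t => phi (tmap (comul C) idfun t)) _ _ _ t).
  - apply: (linear_comp (f := fun t => tmap idfun op_comul (tswap t)));
      last exact: tassoc_linear.
    by apply: linear_comp; [exact: tswap_linear | exact: tmap_linear].
  - by apply: linear_comp => //; exact: tmap_linear.
  by move=> x y; rewrite /phi tswapE !tmapE // tswapE.
have step2 : tmap op_comul idfun (op_comul c) =
    tswap (tmap idfun (@tswap K C C) (tmap idfun (comul C) (comul C c))).
  rewrite [op_comul c]/op_comul; move: (comul C c) => t.
  refine (tens_linear_ext (f := fun t => tmap op_comul idfun (tswap t))
    (g := fun t => tswap (tmap idfun (@tswap K C C) (tmap idfun (comul C) t)))
    _ _ _ t).
  - by apply: linear_comp; [exact: tswap_linear | exact: tmap_linear].
  - apply: (linear_comp (f := fun t => tmap idfun (@tswap K C C) (tmap idfun (comul C) t)));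
      last exact: tswap_linear.
    by apply: linear_comp; exact: tmap_linear.
  by move=> x y; rewrite tswapE !tmapE // tswapE.
rewrite step1 step2 -comul_assoc; move: (tmap _ _ _) => t {step1 step2}.
refine (tens_linear_ext (f := fun t => phi (tassoc t))
  (g := fun t => tswap (tmap idfun (@tswap K C C) t)) _ _ _ t).
- exact: (linear_comp (f := @tassoc K C C C) (@tassoc_linear K C C C) lphi).
- by apply: linear_comp; [exact: tmap_linear | exact: tswap_linear].
move=> x s /=; rewrite tmapE // tswapE.
have lx (V W : lmodType K) (v : V) : linear (@tens K V W v).
  by move=> a w w'; exact: (tens_bilinear _ _).2.
have lx' (V W : lmodType K) (w : W) : linear (fun v => @tens K V W v w).
  by move=> a v v'; exact: (tens_bilinear _ _).1.
refine (tens_linear_ext (f := fun s => phi (tassoc (tens x s)))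
  (g := fun s => tens (tswap s) (idfun x)) _ _ _ s).
- apply: (linear_comp (f := fun s => tassoc (tens x s))); last exact: lphi.
  by apply: linear_comp; [exact: lx | exact: tassoc_linear].
- exact: (linear_comp (f := @tswap K C C) ls (lx' _ _ x)).
by move=> y z; rewrite tassocE /phi tmapE // !tswapE tassocE.
Qed.

Lemma op_comul_tlift (f : C -> C -> C) c : bilinear_map f ->
  tlift f (op_comul c) = tlift (fun x y => f y x) (comul C c).
Proof.
move=> bf; have bf' : bilinear_map (fun x y => f y x) by split; [exact: bf.2 | exact: bf.1].
rewrite /op_comul; move: (comul C c) => t.
refine (tens_linear_ext (f := fun t => tlift f (tswap t)) _ _ _ t).
- by apply: linear_comp; [exact: tswap_linear | exact: tlift_linear].
- exact: tlift_linear.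
by move=> x y; rewrite tswapE !tlift_tens.
Qed.

Lemma counit_bilinear_left : bilinear_map (fun x y : C => counit C x *: y).
Proof.
split=> [y a x x' | x a y y'].
  by rewrite linearP /= scalerDl scalerA.
by rewrite /= scalerDr !scalerA [_ * a]mulrC.
Qed.

Lemma counit_bilinear_right : bilinear_map (fun x y : C => counit C y *: x).
Proof. by split; [exact: counit_bilinear_left.2 | exact: counit_bilinear_left.1]. Qed.

Lemma op_counit_left c : tlift (fun x y => counit C x *: y) (op_comul c) = c.
Proof.
by rewrite op_comul_tlift ?counit_right //; exact: counit_bilinear_left.
Qed.

Lemma op_counit_right c : tlift (fun x y => counit C y *: x) (op_comul c) = c.
Proof.
by rewrite op_comul_tlift ?counit_left //; exact: counit_bilinear_right.
Qed.

Definition op_coalgebra : coalgebra K :=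
  Coalgebra op_comul_assoc op_counit_left op_counit_right.

End Opposite.

(* A left C-comodule: coact m is the sum of the m_(-1) (x) m_(0). *)
Record lcomodule (K : fieldType) (C : coalgebra K) := LComodule {
  comod_sort :> lmodType K;
  coact : {linear comod_sort -> tensor C comod_sort};
  coact_assoc : forall m,
    tassoc (tmap idfun coact (coact m)) = tmap (comul C) idfun (coact m);
  coact_counit : forall m, tlift (fun c y => counit C c *: y) (coact m) = m
}.

(* A coaction X -> X (x) C is stored with its two factors swapped. *)
Notation rcomodule C := (lcomodule (op_coalgebra C)).

(* C as a left C-comodule; the right C-comodule C is regular (op_coalgebra C). *)
Definition regular (K : fieldType) (C : coalgebra K) : lcomodule C :=
  LComodule (@comul_assoc K C) (@counit_left K C).

Section Dimension.
Variables (K : fieldType) (V : lmodType K).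

Definition subspace (P : set V) : Prop :=
  P 0 /\ forall (a : K) u v, P u -> P v -> P (a *: u + v).

(* For subspaces B `<=` A of V: the quotient A / B has dimension n. *)
Definition has_dim_mod (A B : set V) (n : nat) : Prop :=
  exists b : 'I_n -> V, [/\
    forall i, A (b i),
    forall v, A v -> exists a : 'I_n -> K, B (v - \sum_i a i *: b i) &
    forall a : 'I_n -> K, B (\sum_i a i *: b i) -> forall i, a i = 0].

Definition has_dim (A : set V) (n : nat) : Prop := has_dim_mod A [set 0] n.

Definition fin_dim (A : set V) : Prop := exists n, has_dim A n.

(* Equal to 0 on infinite-dimensional subspaces. *)
Definition dimK (A : set V) : nat := xget 0%N [set n | has_dim A n].

End Dimension.

Section Comodules.
Variables (K : fieldType) (C : coalgebra K).
Implicit Types M N E : lcomodule C.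

Definition colinear M N (f : M -> N) : Prop :=
  linear f /\ forall m, coact N (f m) = tmap idfun f (coact M m).

Definition hom M N : set (M -> N) := [set f | colinear f].

Arguments hom : clear implicits.

Definition comod_iso M N : Prop := exists f : M -> N, colinear f /\ bijective f.

Definition subcomodule M (P : set M) : Prop :=
  subspace P /\
  forall m, P m -> exists s : seq (C * M),
    (forall p, p \in s -> P p.2) /\ coact M m = \sum_(p <- s) tens p.1 p.2.

Definition zero_set M (P : set M) : Prop := P `<=` [set 0].

Definition simple_sub M (P : set M) : Prop :=
  [/\ subcomodule P, ~ zero_set P &
      forall Q : set M, subcomodule Q -> Q `<=` P -> zero_set Q \/ Q = P].

Definition simple_comodule M : Prop := simple_sub [set: M].

Definition socle M : set M :=
  [set x | exists s : seq M,
    (forall y, y \in s -> exists P : set M, simple_sub P /\ P y) /\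
    x = \sum_(y <- s) y].

Arguments socle : clear implicits.

Definition socle_finite M : Prop := fin_dim (socle M).

Definition injective_comodule E : Prop :=
  forall (M N : lcomodule C) (i : M -> N) (f : M -> E),
    colinear i -> injective i -> colinear f ->
    exists g : N -> E, colinear g /\ forall m, g (i m) = f m.

Definition indecomposable M : Prop :=
  ~ zero_set [set: M] /\
  forall P Q : set M, subcomodule P -> subcomodule Q ->
    zero_set (P `&` Q) -> (forall x, exists2 p, P p & Q (x - p)) ->
    zero_set P \/ zero_set Q.

Definition essential M (P : set M) : Prop :=
  forall Q : set M, subcomodule Q -> ~ zero_set Q -> ~ zero_set (P `&` Q).

Definition injective_envelope M E : Prop :=
  injective_comodule E /\
  exists i : M -> E, [/\ colinear i, injective i & essential (range i)].

(* The subspace P of N is the internal direct sum of the injective images of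
   the maps iota j. *)
Definition direct_sum_decomp (J : choiceType) (F : J -> lcomodule C) N
    (iota : forall j, F j -> N) (P : set N) : Prop :=
  [/\ forall j, colinear (iota j),
      forall x, P x <-> exists (s : seq J) (y : forall j, F j),
        uniq s /\ x = \sum_(j <- s) iota j (y j) &
      forall (s : seq J) (y : forall j, F j), uniq s ->
        \sum_(j <- s) iota j (y j) = 0 -> forall j, j \in s -> y j = 0].

Record inj_resolution N := InjResolution {
  rterm :> nat -> lcomodule C;
  raug : N -> rterm 0;
  rdiff : forall m, rterm m -> rterm m.+1;
  raug_colinear : colinear raug;
  rdiff_colinear : forall m, colinear (@rdiff m);
  rterm_injective : forall m, injective_comodule (rterm m);
  raug_inj : injective raug;
  raug_exact : range raug = [set x | rdiff x = 0];
  rdiff_exact : forall m, range (@rdiff m) = [set x | rdiff x = 0]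
}.

Definition finite_resolution N (R : inj_resolution N) : Prop :=
  exists n, forall m, (n < m)%N -> zero_set [set: R m].

Definition minimal_resolution N (R : inj_resolution N) : Prop :=
  essential (range (raug R)) /\
  forall m, essential (range (@rdiff N R m)).

Definition cocycles M N (R : inj_resolution N) m : set (M -> R m) :=
  [set f | colinear f /\ forall x, rdiff (f x) = 0].

Definition coboundaries M N (R : inj_resolution N) m : set (M -> R m) :=
  match m with
  | 0 => [set 0]
  | k.+1 => [set f | exists2 g : M -> R k, colinear g & f = fun x => rdiff (g x)]
  end.

Arguments cocycles M {N} R m.
Arguments coboundaries M {N} R m.

(* Ext^m_C(M, N), computed from an injective resolution of N, has dimension n. *)
Definition Ext_has_dim (m : nat) M N (n : nat) : Prop :=
  exists R : inj_resolution N, has_dim_mod (cocycles M R m) (coboundaries M R m) n.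

(* d m p is the multiplicity of E p in the m-th term of a finite minimal
   injective resolution of N. *)
Definition resolution_multiplicities (I : choiceType) (E : I -> lcomodule C) N
    (d : nat -> I -> nat) : Prop :=
  exists R : inj_resolution N,
    [/\ minimal_resolution R, finite_resolution R &
      forall m, exists iota : forall t : {p : I & 'I_(d m p)}, E (tag t) -> R m,
        direct_sum_decomp iota [set: R m]].

(* A choice of such a d, and 0 when N has no such resolution. *)
Definition res_mult (I : choiceType) (E : I -> lcomodule C) N : nat -> I -> nat :=
  xget (fun _ _ => 0%N) [set d | resolution_multiplicities E N d].

Definition conv (f g : C -> K) (c : C) : K :=
  tlift (fun x y => f x * g y : K^o) (comul C c).

Definition primitive_idempotent (e : {scalar C}) : Prop :=
  [/\ conv e e =1 e, ~ (e =1 fun=> 0) &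
      forall f g : {scalar C},
        conv f f =1 f -> conv g g =1 g ->
        conv f g =1 (fun=> 0) -> conv g f =1 (fun=> 0) ->
        (forall c, e c = f c + g c) ->
        f =1 (fun=> 0) \/ g =1 (fun=> 0)].

(* M as a right C^*-module: m f is the sum of the f(m_(-1)) m_(0). *)
Definition ract M (m : M) (f : C -> K) : M :=
  tlift (fun c y => f c *: y) (coact M m).

End Comodules.

Arguments socle {K C} M.
Arguments hom {K C} M N.
Arguments res_mult {K C I} E N.

(* The left action of C^* on C: f c is the sum of the c_(1) f(c_(2)). *)
Definition lact (K : fieldType) (C : coalgebra K) (f : C -> K) (c : C) : C :=
  @ract K (op_coalgebra C) (regular (op_coalgebra C)) c f.

Section EulerCoalgebras.
Variables (K : fieldType) (C : coalgebra K).

(* X is the right comodule DM = Hom_K(M, K), for M finite-dimensional. *)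
Definition is_dual (M : lcomodule C) (X : rcomodule C) : Prop :=
  exists b : {bilinear X -> M -> K^o},
    (forall f : {scalar M}, exists! x : X, forall m, b x m = f m) /\
    forall (x : X) (m : M),
      tlift (fun (c : C) (y : X) => b y m *: c) (coact X x) =
      tlift (fun (c : C) (y : M) => b x y *: c) (coact M m).

Definition pointed : Prop :=
  (forall M : lcomodule C, simple_comodule M -> has_dim [set: M] 1) /\
  (forall X : rcomodule C, simple_comodule X -> has_dim [set: X] 1).

Definition computable : Prop :=
  forall E1 E2 : lcomodule C,
    injective_comodule E1 -> indecomposable E1 ->
    injective_comodule E2 -> indecomposable E2 -> fin_dim (hom E1 E2).

Definition finite_socle_finite_resolution (C' : coalgebra K) (S : lcomodule C') : Prop :=
  exists R : inj_resolution S, finite_resolution R /\ forall m, socle_finite (R m).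

Definition left_sharp_Euler : Prop :=
  computable /\
  forall S : lcomodule C, simple_comodule S -> finite_socle_finite_resolution S.

Definition right_sharp_Euler : Prop :=
  computable /\
  forall S : rcomodule C, simple_comodule S -> finite_socle_finite_resolution S.

(* The first two conditions make all the Ext spaces finite-dimensional. *)
Definition sharp_Euler : Prop :=
  [/\ left_sharp_Euler, right_sharp_Euler &
    forall (S S' : lcomodule C) (DS DS' : rcomodule C) (m n : nat),
      simple_comodule S -> simple_comodule S' ->
      is_dual S DS -> is_dual S' DS' ->
      (Ext_has_dim m S S' n <-> Ext_has_dim m DS' DS n)].

End EulerCoalgebras.

(* Sl j is S(j), inside the left comodule C via Sl_incl j; El j is E(j);
   Sr j is DS(j) and Er j its envelope, with a hat on paper; idem j is the
   idempotent e_j, with El j isomorphic to e_j C and Er j to C e_j. *)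
Record injective_data (K : fieldType) (C : coalgebra K) (I : choiceType) :=
  InjectiveData {
  Sl : I -> lcomodule C;
  Sl_incl : forall j, Sl j -> regular C;
  El : I -> lcomodule C;
  Sr : I -> rcomodule C;
  Er : I -> rcomodule C;
  idem : I -> {scalar C};
  Sl_simple : forall j, simple_comodule (Sl j);
  Sl_repr : forall M : lcomodule C, simple_comodule M ->
    exists! j, comod_iso M (Sl j);
  Sl_socle : direct_sum_decomp Sl_incl (socle (regular C));
  El_envelope : forall j, injective_envelope (Sl j) (El j);
  Sr_dual : forall j, is_dual (Sl j) (Sr j);
  Er_envelope : forall j, injective_envelope (Sr j) (Er j);
  idem_primitive : forall j, primitive_idempotent (idem j);
  El_idem : forall j, exists f : El j -> regular C,
    [/\ colinear f, injective f & range f = [set lact (idem j) c | c in [set: C]]];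
  Er_idem : forall j, exists f : Er j -> regular (op_coalgebra C),
    [/\ colinear f, injective f &
        range f = [set @ract K C (regular C) c (idem j) | c in [set: C]]]
}.

Section Matrices.
Variable I : choiceType.
Implicit Types (A B D : I -> I -> int) (v w : I -> int).

Definition row_finite A : Prop := forall i, finite_set [set j | A i j != 0].
Definition column_finite A : Prop := forall j, finite_set [set i | A i j != 0].
Definition transpose A : I -> I -> int := fun i j => A j i.
Definition unit_vec (j : I) : I -> int := fun p => (j == p)%:R.

(* The product v A of a row vector and a matrix is formed and equals w. *)
Definition vec_mul_is v A w : Prop :=
  forall p, finite_set [set i | v i * A i p != 0] /\
    \sum_(i \in [set: I]) v i * A i p = w p.

(* The product A B is formed and equals D. *)
Definition mx_mul_is A B D : Prop := forall i, vec_mul_is (A i) B (D i).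

Definition left_inverse_mx A B : Prop := mx_mul_is A B unit_vec.
Definition right_inverse_mx A B : Prop := mx_mul_is B A unit_vec.

End Matrices.

Section CartanMatrix.
Variables (K : fieldType) (C : coalgebra K) (I : choiceType).
Variable D : injective_data C I.

Definition dimvec (M : lcomodule C) : I -> int :=
  fun j => (dimK [set ract m (idem D j) | m in [set: M]])%:Z.

Definition dimvec_r (X : rcomodule C) : I -> int :=
  fun j => (dimK (hom X (Er D j)))%:Z.

(* c_ij = dim e_i C e_j *)
Definition cartan : I -> I -> int := fun i j =>
  (dimK [set lact (idem D i) (@ract K C (regular C) c (idem D j)) | c in [set: C]])%:Z.

(* The sums over m have finite support: the resolutions are finite. *)
Definition cartan_left : I -> I -> int := fun j p =>
  \sum_(m \in [set: nat]) (-1) ^+ m * (res_mult (El D) (Sl D j) m p)%:Z.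

Definition cartan_right : I -> I -> int := fun j p =>
  \sum_(m \in [set: nat]) (-1) ^+ m * (res_mult (Er D) (Sr D p) m j)%:Z.

End CartanMatrix.

Arguments dimvec {K C I} D M.
Arguments dimvec_r {K C I} D X.
Arguments cartan {K C I} D.
Arguments cartan_left {K C I} D.
Arguments cartan_right {K C I} D.

(* Main.v *)
Require Import Defs.
From HB Require Import structures.
From mathcomp Require Import all_boot all_order all_algebra.
From mathcomp Require Import boolp classical_sets functions cardinality fsbigop.
Import GRing.Theory.
Local Open Scope ring_scope.
Local Open Scope classical_set_scope.

(* For an injective comodule E(p) = e_p C, colinear maps M -> E(p) are the
   functionals on M e_p, so M |-> M e_p is exact and counts the composition
   factor S(p). Applied to a finite minimal injective resolution of S(j), it
   gives an exact complex of spaces of dimensions sum_p d_mp c_pq, and its Euler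
   characteristic is row j of the left inverse identity. The terms of the
   resolution are built as finite sums of the E(p) from the given socle-finite
   resolution, of which the minimal one stays a retract up to automorphism, so
   that it stops as soon as the given one does. By minimality d_mp is the
   dimension of Ext^m(S(p), S(j)); hence it does not depend on the resolution,
   and the symmetry of Ext identifies the two inverses in (c). Part (b) is part
   (a) for the opposite coalgebra, whose simples are given by the same
   group-like elements. *)

Set Implicit Arguments.
Unset Strict Implicit.
Unset Printing Implicit Defensive.

(** * Linear algebra *)

(** Comodules may be infinite-dimensional and [dimK] is 0 on infinite-dimensional spaces, so
    dimensions are carried as the relation [has_dim], and finiteness usually comes from a bound on
    the size of independent families. Tensors are handled by one device: over a field the first
    factors can be made independent, and dual functionals then recover the second factors. A
    coaction is thereby replaced by the action [act] of all functionals, and colinearity and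
    subcomodules become ordinary module notions. Pointedness turns simple comodules into lines
    spanned by weight vectors, those [x] with coaction h (x) x, and socles are handled through such
    vectors. Two obstacles shape the rest. [res_mult] is an arbitrary choice, and [Ext_has_dim]
    speaks of some unspecified resolution, so both must be shown independent of that choice before
    they can be compared. Computability is stated for left comodules only; the right side gets its
    finite dimensions because the corners of the left and of the right envelopes are both copies of
    e_i C e_j. One-sided arguments are made for the record [pointed_side], so that each is used
    twice. *)

Lemma choice_dep (X : Type) (Y : X -> Type) (P : forall x, Y x -> Prop) :
  (forall x, exists y, P x y) -> exists f : forall x, Y x, forall x, P x (f x).
Proof. by move=> h; exists (fun x => sval (cid (h x))) => x; case: cid. Qed.

Section LinearAlgebra.
Variables (K : fieldType) (V : lmodType K).

Definition indep n (b : 'I_n -> V) : Prop :=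
  forall a : 'I_n -> K, \sum_i a i *: b i = 0 -> forall i, a i = 0.

Definition in_span n (b : 'I_n -> V) (v : V) : Prop :=
  exists a : 'I_n -> K, v = \sum_i a i *: b i.

Lemma has_dimP (W : set V) n : has_dim W n <->
  exists b : 'I_n -> V,
    [/\ forall i, W (b i), forall v, W v -> in_span b v & indep b].
Proof.
split=> -[b [Wb sb ib]]; exists b; split=> // v Wv; have [a av] := sb v Wv.
  by exists a; apply/eqP; rewrite -subr_eq0; apply/eqP.
by exists a; rewrite /set1 /= -av subrr.
Qed.

Lemma subspace_sum (W : set V) (T : Type) (s : seq T) (P : pred T) (F : T -> V) :
  subspace W -> (forall t, P t -> W (F t)) -> W (\sum_(t <- s | P t) F t).
Proof.
move=> [W0 WD] WF; elim/big_rec: _ => // t x Pt Wx.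
by rewrite -[F t]scale1r; apply: WD => //; exact: WF.
Qed.

Lemma subspaceZ (W : set V) a v : subspace W -> W v -> W (a *: v).
Proof. by move=> [W0 WD] Wv; rewrite -[_ *: _]addr0; exact: WD. Qed.

Lemma subspaceD (W : set V) u v : subspace W -> W u -> W v -> W (u + v).
Proof. by move=> [W0 WD] Wu Wv; rewrite -[u]scale1r; exact: WD. Qed.

Lemma subspaceB (W : set V) u v : subspace W -> W u -> W v -> W (u - v).
Proof.
by move=> sW Wu Wv; rewrite -scaleN1r; apply: subspaceD => //; exact: subspaceZ.
Qed.

Lemma span_in (W : set V) n (b : 'I_n -> V) v :
  subspace W -> (forall i, W (b i)) -> in_span b v -> W v.
Proof.
by move=> sW Wb [a ->]; apply: subspace_sum => // i _; exact: subspaceZ.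
Qed.

Lemma span_subspace n (b : 'I_n -> V) : subspace (in_span b).
Proof.
split=> [|k _ _ [a ->] [c ->]].
  by exists (fun=> 0); rewrite big1 // => i _; rewrite scale0r.
exists (fun i => k * a i + c i); rewrite scaler_sumr -big_split /=.
by apply: eq_bigr => i _; rewrite scalerDl scalerA.
Qed.

Lemma span_mem n (b : 'I_n -> V) i : in_span b (b i).
Proof.
exists (fun j => (j == i)%:R); rewrite (bigD1 i) //= eqxx scale1r big1 ?addr0 //.
by move=> j /negPf ->; rewrite scale0r.
Qed.

(** The matrix of coordinates of [b] over [c] would have more rows than columns; a nonzero vector in
    its left kernel is a relation among the [b i]. *)
Lemma indep_le n m (b : 'I_n -> V) (c : 'I_m -> V) :
  indep b -> (forall i, in_span c (b i)) -> (n <= m)%N.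
Proof.
move=> ib /choice[a ab]; rewrite leqNgt; apply/negP => mn.
pose A := \matrix_(i < n, j < m) a i j.
have : kermx A != 0.
  by rewrite -mxrank_eq0 mxrank_ker subn_eq0 -ltnNge (leq_ltn_trans _ mn) // rank_leq_col.
case/rowV0Pn=> u /sub_kermxP uA u0; case/eqP: u0; apply/rowP => i; rewrite mxE.
apply: (ib (u 0)); under eq_bigr do rewrite ab scaler_sumr.
rewrite exchange_big /= big1 // => j _.
under eq_bigr do rewrite scalerA.
rewrite -scaler_suml; have /rowP/(_ j) := uA.
rewrite !mxE => uAj; rewrite -[RHS](scale0r (c j)); congr (_ *: _).
by rewrite -[RHS]uAj; apply: eq_bigr => k _; rewrite mxE.
Qed.

Lemma has_dim_unique (W : set V) n m : has_dim W n -> has_dim W m -> n = m.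
Proof.
move=> /has_dimP[b [Wb sb ib]] /has_dimP[c [Wc sc ic]]; apply/eqP.
rewrite eqn_leq; apply/andP; split.
  by apply: (indep_le ib (c := c)) => i; exact: sc.
by apply: (indep_le ic (c := b)) => i; exact: sb.
Qed.

Lemma dimK_eq (W : set V) n : has_dim W n -> dimK W = n.
Proof.
move=> Wn; rewrite /dimK; apply: (@has_dim_unique W) => //.
by apply: (@xgetPex _ 0%N [set k | has_dim W k]); exists n.
Qed.

Definition fcons n (v : V) (b : 'I_n -> V) (i : 'I_n.+1) : V :=
  if unlift ord0 i is Some j then b j else v.

Lemma fcons0 n v (b : 'I_n -> V) : fcons v b ord0 = v.
Proof. by rewrite /fcons unlift_none. Qed.

Lemma fconsS n v (b : 'I_n -> V) i : fcons v b (lift ord0 i) = b i.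
Proof. by rewrite /fcons liftK. Qed.

Lemma fcons_indep n v (b : 'I_n -> V) :
  indep b -> ~ in_span b v -> indep (fcons v b).
Proof.
move=> ib nv a; rewrite big_ord_recl fcons0.
under eq_bigr do rewrite fconsS.
move=> a0; have av : a ord0 = 0.
  apply: contrapT => /eqP an0; apply: nv.
  exists (fun i => - (a ord0)^-1 * a (lift ord0 i)).
  under eq_bigr do rewrite -scalerA; rewrite -scaler_sumr.
  move/eqP: a0; rewrite addrC addr_eq0 => /eqP ->.
  by rewrite scalerN scaleNr opprK scalerA mulVf // scale1r.
move=> i; case: (unliftP ord0 i) => [j|] -> //.
by move: a0; rewrite av scale0r add0r => /ib.
Qed.

(** A longest independent family in [W] spans it, since a vector outside its span could be added.
    This is the source of dimensions for spaces not yet known to be finite-dimensional. *)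
Lemma bounded_has_dim (W : set V) N : subspace W ->
  (forall n (b : 'I_n -> V), (forall i, W (b i)) -> indep b -> (n <= N)%N) ->
  exists2 n, (n <= N)%N & has_dim W n.
Proof.
move=> sW bd.
pose P n := `[< exists b : 'I_n -> V, (forall i, W (b i)) /\ indep b >].
have P0 : exists n, P n.
  exists 0%N; apply/asboolP; exists (fun=> 0); split=> [i|a _ []//].
  exact: sW.1.
have PN n : P n -> (n <= N)%N by move=> /asboolP[b [Wb ib]]; exact: bd ib.
case: (ex_maxnP P0 PN) => n Pn nmax; exists n; first exact: PN.
case/asboolP: Pn => b [Wb ib]; apply/has_dimP; exists b; split=> // v Wv.
apply: contrapT => nv; suff : (n.+1 <= n)%N by rewrite ltnn.
apply: nmax; apply/asboolP; exists (fcons v b); split; last exact: fcons_indep.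
by move=> i; case: (unliftP ord0 i) => [j|] ->; rewrite ?fconsS ?fcons0.
Qed.

Lemma has_dim_sub (W W' : set V) n : subspace W' -> W' `<=` W -> has_dim W n ->
  exists2 m, (m <= n)%N & has_dim W' m.
Proof.
move=> sW' W'W /has_dimP[b [Wb sb ib]]; apply: bounded_has_dim => // m c W'c ic.
by apply: (indep_le ic) => i; apply/sb/W'W.
Qed.

Lemma has_dim_sub_eq (W W' : set V) n : subspace W' -> W' `<=` W ->
  has_dim W n -> has_dim W' n -> W' = W.
Proof.
move=> sW' W'W /has_dimP[b [Wb sb ib]] /has_dimP[c [W'c sc ic]].
rewrite eqEsubset; split=> // v Wv; apply: (span_in sW' W'c).
apply: contrapT => /(fcons_indep ic) ivc.
suff : (n.+1 <= n)%N by rewrite ltnn.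
apply: (indep_le ivc (c := b)) => i.
by apply: sb; case: (unliftP ord0 i) => [j|] ->; rewrite ?fconsS ?fcons0 //; exact: W'W.
Qed.

Lemma span_has_dim n (b : 'I_n -> V) : exists m, has_dim (in_span b) m.
Proof.
have [|m _ ?] := @bounded_has_dim (in_span b) n (span_subspace b); last by exists m.
by move=> m c bc ic; exact: indep_le ic bc.
Qed.

Lemma has_dim_fin (T : finType) (W : set V) (b : T -> V) :
  (forall t, W (b t)) ->
  (forall v, W v -> exists a : T -> K, v = \sum_t a t *: b t) ->
  (forall a : T -> K, \sum_t a t *: b t = 0 -> forall t, a t = 0) ->
  has_dim W #|T|.
Proof.
move=> Wb sb ib; apply/has_dimP; exists (b \o enum_val); split=> [i|v Wv|a a0 i].
- exact: Wb.
- have [a ->] := sb v Wv; exists (a \o enum_val).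
  by rewrite (reindex (@enum_val T predT)) //; apply: onW_bij; exact: enum_val_bij.
- rewrite -[i]enum_valK; apply: (ib (a \o enum_rank)).
  rewrite (reindex (@enum_val T predT)) /=; last first.
    by apply: onW_bij; exact: enum_val_bij.
  by rewrite -[RHS]a0; apply: eq_bigr => k _; rewrite enum_valK.
Qed.

Definition scalar_of (f : V -> K) (lf : scalar f) : {scalar V} :=
  HB.pack_for {scalar V} f (GRing.isLinear.Build K V K *%R f lf).

(* A maximal subspace meeting the span of b trivially is a complement of it. *)
Lemma dual_family n (b : 'I_n -> V) : indep b ->
  exists f : 'I_n -> {scalar V}, forall i j, f i (b j) = (i == j)%:R.
Proof.
move=> ib.
(* Membership of 0 is left out of [P] because the empty chain has an empty union; it is recovered
   afterwards by comparing an empty maximal element with [[set 0]]. *)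
pose P (Q : set V) := (forall a u v, Q u -> Q v -> Q (a *: u + v)) /\
  (forall v, Q v -> in_span b v -> v = 0).
have [F FP Ftot|Q [[QD Qb] Qmax]] := @Zorn_bigcup V P.
  split=> [a u v [A FA Au] [B FB Bv]|v [A FA Av]]; last exact: (FP A FA).2.
  have [AB|BA] := Ftot A B FA FB.
    by exists B => //; apply: (FP B FB).1 => //; exact: AB.
  by exists A => //; apply: (FP A FA).1 => //; exact: BA.
have Q0 : Q 0.
  apply: contrapT => nQ0; have QE x : ~ Q x.
    by move=> Qx; apply: nQ0; rewrite -[0](subrr x) addrC -scaleN1r; exact: QD.
  apply: (Qmax [set 0]).
    by split=> [x /QE //|/(_ 0 erefl)].
  by split=> [a u v -> ->|v ->] //; rewrite scaler0 addr0.
have sQ : subspace Q by split=> // a u v; exact: QD.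
(* If [v] were outside the sum of [Q] and the span, adjoining [v] to [Q] would contradict
   maximality. *)
have ex v : exists a : 'I_n -> K, Q (v - \sum_i a i *: b i).
  apply: contrapT => nv.
  pose Q' := [set x | exists k, Q (x - k *: v)].
  apply: (Qmax Q').
    split=> [x Qx|/(_ v)]; first by exists 0; rewrite scale0r subr0.
    move=> Q'v; have {Q'v} Qv : Q v by apply: Q'v; exists 1; rewrite scale1r subrr.
    by apply: nv; exists (fun=> 0); rewrite big1 ?subr0 // => i _; rewrite scale0r.
  split=> [a x y [k Qk] [l Ql]|x [k Qk] [a xa]].
    exists (a * k + l); rewrite scalerDl opprD addrACA -scalerA -scalerBr.
    exact: QD.
  have [k0|k0] := eqVneq k 0.
    by apply: Qb; [move: Qk; rewrite k0 scale0r subr0 | exists a].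
  case: nv; exists (fun i => k^-1 * a i).
  under eq_bigr do rewrite -scalerA; rewrite -scaler_sumr -xa.
  rewrite (_ : v - _ = (- k^-1) *: (x - k *: v)); first exact: subspaceZ.
  by rewrite scalerBr scalerA mulNr mulVf // scaleN1r opprK scaleNr addrC.
have uniq v a a' : Q (v - \sum_i a i *: b i) -> Q (v - \sum_i a' i *: b i) -> a = a'.
  move=> Qa Qa'; have Qd := subspaceB sQ Qa' Qa.
  have E : v - \sum_i a' i *: b i - (v - \sum_i a i *: b i) =
      \sum_i (a i - a' i) *: b i.
    rewrite opprB addrC addrA subrK -sumrB.
    by apply: eq_bigr => i _; rewrite scalerBl.
  have /ib h : \sum_i (a i - a' i) *: b i = 0.
    by rewrite -E; apply: Qb => //; rewrite E; exists (fun i => a i - a' i).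
  by apply/funext => i; apply/eqP; rewrite -subr_eq0; apply/eqP; exact: h.
have [c Qc] := choice ex.
have lc i : scalar (fun v => c v i).
  move=> k u v /=; suff -> : c (k *: u + v) = fun i => k * c u i + c v i by [].
  apply: (uniq (k *: u + v)) => //.
  rewrite (_ : _ - _ = k *: (u - \sum_i c u i *: b i) + (v - \sum_i c v i *: b i)).
    exact: QD.
  rewrite scalerBr addrACA -opprD scaler_sumr -big_split /=; congr (_ - _).
  by apply: eq_bigr => j _; rewrite scalerDl scalerA.
exists (fun i => scalar_of (lc i)).
move=> i j /=; rewrite (_ : c (b j) = fun i => (i == j)%:R) //.
apply: (uniq (b j)) => //.
rewrite (bigD1 j) //= eqxx scale1r big1 ?addr0 ?subrr // => k /negPf ->.
by rewrite scale0r.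
Qed.

End LinearAlgebra.

(** * Images, kernels and rank-nullity *)

Section LinearMaps.
Variables (K : fieldType) (V U : lmodType K).

Lemma linear_fun0 (f : V -> U) : linear f -> f 0 = 0.
Proof. by move=> lf; have := scalable_linear lf 0 0; rewrite /= !scale0r. Qed.

Lemma linear_funD (f : V -> U) : linear f -> forall u v, f (u + v) = f u + f v.
Proof. by move=> lf u v; have := lf 1 u v; rewrite !scale1r. Qed.

Lemma linear_funZ (f : V -> U) : linear f -> forall a v, f (a *: v) = a *: f v.
Proof. by move=> lf a v; exact: (scalable_linear lf a v). Qed.

Lemma linear_funB (f : V -> U) : linear f -> forall u v, f (u - v) = f u - f v.
Proof. by move=> lf u v; rewrite -!scaleN1r linear_funD // linear_funZ. Qed.

Lemma linear_fun_sum (f : V -> U) (T : Type) (s : seq T) (P : pred T) (F : T -> V) :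
  linear f -> f (\sum_(t <- s | P t) F t) = \sum_(t <- s | P t) f (F t).
Proof.
by move=> lf; apply: big_morph; [exact: linear_funD | exact: linear_fun0].
Qed.

Lemma linear_inj (f : V -> U) : linear f -> (forall v, f v = 0 -> v = 0) ->
  injective f.
Proof.
move=> lf kf u v uv; apply/eqP; rewrite -subr_eq0; apply/eqP/kf.
by rewrite linear_funB // uv subrr.
Qed.

Lemma image_subspace (f : V -> U) (W : set V) :
  linear f -> subspace W -> subspace (f @` W).
Proof.
move=> lf [W0 WD]; split=> [|a _ _ [u Wu <-] [v Wv <-]].
  by exists 0 => //; exact: linear_fun0.
by exists (a *: u + v); [exact: WD | exact: lf].
Qed.

Lemma kernel_subspace (f : V -> U) (W : set V) :
  linear f -> subspace W -> subspace (W `&` [set x | f x = 0]).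
Proof.
move=> lf [W0 WD]; split=> [|a u v [Wu /= fu] [Wv /= fv]].
  by split=> //; exact: linear_fun0.
by split; [exact: WD | rewrite /= lf fu fv scaler0 addr0].
Qed.

Lemma indep_image (f : V -> U) n (b : 'I_n -> V) :
  linear f -> injective f -> indep b -> indep (f \o b).
Proof.
move=> lf injf ib a a0; apply: ib; apply: injf; rewrite linear_fun0 // -[RHS]a0.
by rewrite linear_fun_sum //; apply: eq_bigr => i _; rewrite linear_funZ.
Qed.

Lemma has_dim_image (f : V -> U) (W : set V) n :
  linear f -> (forall v, W v -> f v = 0 -> v = 0) -> subspace W ->
  has_dim W n -> has_dim (f @` W) n.
Proof.
move=> lf injf sW /has_dimP[b [Wb sb ib]]; apply/has_dimP; exists (f \o b).
have fsum a : \sum_i a i *: (f \o b) i = f (\sum_i a i *: b i).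
  by rewrite linear_fun_sum //; apply: eq_bigr => i _; rewrite linear_funZ.
split=> [i|_ [v Wv <-]|a].
- by exists (b i).
- by have [a ->] := sb v Wv; exists a; rewrite fsum.
- rewrite fsum => /injf h; apply: ib; apply: h.
  by apply: subspace_sum => // i _; exact: subspaceZ.
Qed.

(** Finite dimensionality of [W] is part of the conclusion: independent families in [W] stay
    independent in the image, whose dimension bounds their size. *)
Lemma has_dim_image_inv (f : V -> U) (W : set V) n :
  linear f -> (forall v, W v -> f v = 0 -> v = 0) -> subspace W ->
  has_dim (f @` W) n -> has_dim W n.
Proof.
move=> lf injf sW Wn; have [c [fWc sc ic]] := (has_dimP _ _).1 Wn.
have [|m _ Wm] := @bounded_has_dim K V W n sW; last first.
  by rewrite -(has_dim_unique (has_dim_image lf injf sW Wm) Wn).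
move=> m b Wb ib; apply: (@indep_le _ _ m n (f \o b) c) => [a a0|i].
  apply: ib; apply: injf.
    by apply: subspace_sum => // i _; exact: subspaceZ.
  rewrite linear_fun_sum // -[RHS]a0.
  by apply: eq_bigr => i _; rewrite linear_funZ.
by apply: sc; exists (b i).
Qed.

Lemma rank_nullity (f : V -> U) (W : set V) a b : linear f ->
  has_dim (W `&` [set x | f x = 0]) a -> has_dim (f @` W) b -> subspace W ->
  has_dim W (a + b).
Proof.
move=> lf /has_dimP[c [Wc sc ic]] /has_dimP[d [fWd sd id]] sW.
have /choice[e eP] : forall i, exists x, W x /\ f x = d i.
  by move=> i; have [x Wx fx] := fWd i; exists x.
rewrite -[a]card_ord -[b]card_ord -card_sum.
apply: (@has_dim_fin _ _ _ _ (fun t => match t with inl i => c i | inr j => e j end)).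
- by case=> i; [exact: (Wc i).1 | exact: (eP i).1].
- move=> v Wv; have [|h hv] := sd (f v); first by exists v.
  have [|k kv] := sc (v - \sum_j h j *: e j).
    split=> /=.
      apply: subspaceB => //; apply: subspace_sum => // j _.
      by apply: subspaceZ => //; exact: (eP j).1.
    rewrite linear_funB // linear_fun_sum // hv; apply/eqP; rewrite subr_eq0; apply/eqP.
    by apply: eq_bigr => j _; rewrite linear_funZ // (eP j).2.
  exists (fun t => match t with inl i => k i | inr j => h j end).
  by rewrite big_sumType /= -kv subrK.
- move=> h; rewrite big_sumType /= => h0.
  have hr : forall j, h (inr j) = 0.
    apply: id; rewrite -[RHS](linear_fun0 lf) -h0 linear_funD // !linear_fun_sum //.
    rewrite [X in X + _]big1 ?add0r => [|i _]; last first.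
      by rewrite linear_funZ // (Wc i).2 scaler0.
    by apply: eq_bigr => j _; rewrite linear_funZ // (eP j).2.
  case=> // i; apply: (ic (fun i => h (inl i))); rewrite -[RHS]h0.
  by rewrite [X in _ + X]big1 ?addr0 // => j _; rewrite hr scale0r.
Qed.

End LinearMaps.

(** * Tensors *)

Section TensorTheory.
Variable K : fieldType.
Implicit Types V W U : lmodType K.

Lemma tens_linearl V W (w : W) : linear (fun v : V => tens v w).
Proof. exact: (tens_bilinear V W).1. Qed.

Lemma tens_linearr V W (v : V) : linear (@tens K V W v).
Proof. exact: (tens_bilinear V W).2. Qed.

Lemma contract_bilinear V W (f : {scalar V}) :
  bilinear_map (fun (v : V) (w : W) => f v *: w).
Proof.
split=> [w a u v|v a w w'].
  by rewrite linearP /= scalerDl scalerA.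
by rewrite /= scalerDr !scalerA [_ * a]mulrC.
Qed.

Definition contract V W (f : {scalar V}) (t : tensor V W) : W :=
  tlift (fun v w => f v *: w) t.

Lemma contract_linear V W (f : {scalar V}) : linear (@contract V W f).
Proof. by apply: tlift_linear; exact: contract_bilinear. Qed.

Lemma contractE V W (f : {scalar V}) v (w : W) : contract f (tens v w) = f v *: w.
Proof. by rewrite /contract tlift_tens //; exact: contract_bilinear. Qed.

(** Expand the first factors over a basis of their span. Together with [dual_family] and
    [contract_dual] this reads the second factors off the tensor. *)
Lemma tens_indep V W (t : tensor V W) : exists n (c : 'I_n -> V) (m : 'I_n -> W),
  indep c /\ t = \sum_i tens (c i) (m i).
Proof.
have [s ->] := tens_sum t.
pose v (i : 'I_(size s)) := (tnth (in_tuple s) i).1.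
have [n /has_dimP[c [_ sc ic]]] := span_has_dim v.
have /choice[a av] : forall i, in_span c (v i) by move=> i; apply: sc; exact: span_mem.
exists n, c, (fun l => \sum_i a i l *: (tnth (in_tuple s) i).2); split=> //.
rewrite -[s in LHS]/(val (in_tuple s)) big_tuple.
under [RHS]eq_bigr do rewrite (linear_fun_sum _ _ _ (tens_linearr _)).
rewrite exchange_big /=; apply: eq_bigr => i _.
rewrite -/(v i) av (linear_fun_sum _ _ _ (tens_linearl _)).
by apply: eq_bigr => l _; rewrite (linear_funZ (tens_linearl _)) (linear_funZ (tens_linearr _)).
Qed.

Lemma contract_dual V W n (c : 'I_n -> V) (m : 'I_n -> W)
    (f : 'I_n -> {scalar V}) : (forall i j, f i (c j) = (i == j)%:R) ->
  forall k, contract (f k) (\sum_i tens (c i) (m i)) = m k.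
Proof.
move=> fc k; rewrite (linear_fun_sum _ _ _ (contract_linear _)) (bigD1 k) //=.
rewrite contractE fc eqxx scale1r big1 ?addr0 // => i ik.
by rewrite contractE fc eq_sym (negPf ik) scale0r.
Qed.

(** In a tensor with independent first factors, contracting with the dual functionals gives the
    second factors; if all contractions vanish, so does the tensor. Identities between coactions
    thus reduce to identities for [act]. *)
Lemma contract_sep V W (t u : tensor V W) :
  (forall f, contract f t = contract f u) -> t = u.
Proof.
move=> h; apply/eqP; rewrite -subr_eq0; apply/eqP.
have {h} : forall f, contract f (t - u) = 0.
  by move=> f; rewrite (linear_funB (contract_linear f)) h subrr.
have [n [c [m [ic ->]]]] := tens_indep (t - u) => h.
have [f fc] := dual_family ic; rewrite big1 // => i _.
by rewrite -(contract_dual m fc i) h (linear_fun0 (tens_linearr _)).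
Qed.

Lemma contract_tmap V W U (g : W -> U) (f : {scalar V}) t : linear g ->
  contract f (tmap idfun g t) = g (contract f t).
Proof.
move=> lg; move: t.
apply: (tens_linear_ext (f := fun t => contract f (tmap idfun g t))).
- by apply: linear_comp; [exact: tmap_linear | exact: contract_linear].
- by apply: linear_comp => //; exact: contract_linear.
- by move=> v w; rewrite tmapE // !contractE linear_funZ.
Qed.

(** Flatness over a field: contractions separate tensors and commute with [g]. *)
Lemma tmap_inj V W U (g : W -> U) : linear g -> injective g ->
  injective (tmap (@idfun V) g).
Proof.
move=> lg injg t u tu; apply: contract_sep => f; apply: injg.
by rewrite -!contract_tmap // tu.
Qed.

Lemma tmap_comp V W U V' W' U' (f : V -> W) (g : W -> U) (f' : V' -> W')
    (g' : W' -> U') t : linear f -> linear g -> linear f' -> linear g' ->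
  tmap g g' (tmap f f' t) = tmap (g \o f) (g' \o f') t.
Proof.
move=> lf lg lf' lg'; move: t.
apply: (tens_linear_ext (f := fun t => tmap g g' (tmap f f' t))).
- by apply: linear_comp; exact: tmap_linear.
- by apply: tmap_linear; apply: linear_comp.
- by move=> v w; rewrite !tmapE //; apply: linear_comp.
Qed.

Lemma tassoc_tmap V W U U' (g : U -> U') (t : tensor V (tensor W U)) : linear g ->
  tassoc (tmap idfun (tmap idfun g) t) = tmap idfun g (tassoc t).
Proof.
move=> lg; move: t.
apply: (tens_linear_ext (f := fun t => tassoc (tmap idfun (tmap idfun g) t))
  (g := fun t => tmap idfun g (tassoc t))).
- apply: linear_comp; last exact: tassoc_linear.
  by apply: tmap_linear => //; exact: tmap_linear.
- by apply: linear_comp; [exact: tassoc_linear | exact: tmap_linear].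
move=> v t; rewrite tmapE //; last exact: tmap_linear.
move: t; apply: (tens_linear_ext (f := fun t => tassoc (tens v (tmap idfun g t)))
  (g := fun t => tmap idfun g (tassoc (tens v t)))).
- apply: (linear_comp (f := tmap idfun g) (g := fun s => tassoc (tens v s))).
    exact: tmap_linear.
  by apply: linear_comp; [exact: tens_linearr | exact: tassoc_linear].
- apply: (linear_comp (f := fun t => tassoc (tens v t))); last exact: tmap_linear.
  by apply: linear_comp; [exact: tens_linearr | exact: tassoc_linear].
- by move=> w u; rewrite tmapE // !tassocE tmapE.
Qed.

End TensorTheory.

(** * Comodules as modules over the dual algebra *)

Section Subspaces.
Variables (K : fieldType) (V : lmodType K).

Record subsp := Subsp { ss_set : set V; ss_subspace : subspace ss_set }.

Variable W : subsp.

Definition ss_pred : {pred V} := fun x => `[< ss_set W x >].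

Lemma ss_predP x : reflect (ss_set W x) (x \in ss_pred).
Proof. exact: asboolP. Qed.

Lemma ss_closed : submod_closed ss_pred.
Proof.
split=> [|a u v /ss_predP Wu /ss_predP Wv]; apply/ss_predP.
  exact: (ss_subspace W).1.
exact: (ss_subspace W).2.
Qed.

HB.instance Definition _ := GRing.isSubmodClosed.Build K V ss_pred ss_closed.

Record ss_type := SSType { ss_val : V; ss_valP : ss_val \in ss_pred }.
HB.instance Definition _ := [isSub for ss_val].
HB.instance Definition _ := [Choice of ss_type by <:].
HB.instance Definition _ := [SubChoice_isSubLmodule of ss_type by <:].

Lemma ss_val_linear : linear ss_val.
Proof. by []. Qed.

End Subspaces.

Section Action.
Variables (K : fieldType) (A : coalgebra K).
Implicit Types (M N : lcomodule A) (f g : {scalar A}).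

Definition act M (m : M) f : M := contract f (coact M m).

Lemma act_linear M f : linear (fun m : M => act m f).
Proof. by move=> a u v; rewrite /act !linearP /= (contract_linear f). Qed.

Lemma act_counit M (m : M) : act m (counit A) = m.
Proof. exact: coact_counit. Qed.

Lemma mul_bilinear (V W : lmodType K) (f : {scalar V}) (g : {scalar W}) :
  bilinear_map (fun (x : V) (y : W) => f x * g y : K^o).
Proof.
split=> [y a u v|x a u v]; rewrite linearP /=.
  by rewrite mulrDl -mulrA.
by rewrite mulrDr mulrCA.
Qed.

Lemma conv_scalar f g : scalar (conv f g).
Proof.
move=> a u v; rewrite /conv linearP /=.
exact: (tlift_linear (mul_bilinear f g)).
Qed.

Definition convs f g : {scalar A} := scalar_of (conv_scalar f g).

Lemma act_act M (m : M) f g : act (act m f) g = act m (convs f g).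
Proof.
(* The tensor product of [f] and [g] as a functional; applied to the two sides of coassociativity it
   gives the two sides of the claim. *)
pose fg : {scalar (tensor A A)} := scalar_of (tlift_linear (mul_bilinear f g) : scalar _).
have E1 (s : tensor A (tensor A M)) : contract fg (tassoc s) = contract g (contract f s).
  move: s; apply: (tens_linear_ext (f := fun s => contract fg (tassoc s))
    (g := fun s => contract g (contract f s))).
  - by apply: linear_comp; [exact: tassoc_linear | exact: contract_linear].
  - by apply: linear_comp; exact: contract_linear.
  move=> x t; rewrite contractE (linear_funZ (contract_linear _)); move: t.
  apply: (tens_linear_ext (f := fun t => contract fg (tassoc (tens x t)))
    (g := fun t => f x *: contract g t)).
  - apply: (linear_comp (f := fun t => tens x t)
      (g := fun s => contract fg (tassoc s))); first exact: tens_linearr.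
    by apply: linear_comp; [exact: tassoc_linear | exact: contract_linear].
  - move=> a u v; rewrite contract_linear scalerDr !scalerA.
    by rewrite [f x * a]mulrC.
  - move=> y z; rewrite tassocE !contractE scalerA; congr (_ *: _).
    by rewrite /= tlift_tens //; exact: mul_bilinear.
have E2 (t : tensor A M) : contract fg (tmap (comul A) idfun t) = contract (convs f g) t.
  move: t; apply: (tens_linear_ext (f := fun t => contract fg (tmap (comul A) idfun t))).
  - apply: linear_comp; last exact: contract_linear.
    by apply: tmap_linear => //; exact: linearP.
  - exact: contract_linear.
  - by move=> x y; rewrite tmapE //; [rewrite !contractE | exact: linearP].
rewrite -[RHS]/(contract (convs f g) (coact M m)) -E2 -coact_assoc E1.
by rewrite contract_tmap //; exact: linearP.
Qed.

Lemma colinearP M N (f : M -> N) : colinear f <->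
  linear f /\ forall m p, f (act m p) = act (f m) p.
Proof.
split=> -[lf h]; split=> // m.
  by move=> p; rewrite /act h contract_tmap.
by apply: contract_sep => p; rewrite contract_tmap // -[LHS]/(act _ _) -h.
Qed.

(** Write the coaction of [m] with independent first factors: the dual functionals turn the second
    factors into values of [act m], which lie in [P] when [P] is stable. *)
Lemma subcomoduleP M (P : set M) : subcomodule P <->
  subspace P /\ forall m p, P m -> P (act m p).
Proof.
split=> -[sP h]; split=> // m.
  move=> p /h[s [Ps cm]]; rewrite /act cm (linear_fun_sum _ _ _ (contract_linear _)).
  rewrite big_seq_cond; apply: subspace_sum => // q; rewrite andbT => /Ps Pq.
  by rewrite contractE; exact: subspaceZ.
move=> Pm; have [n [c [b [ic E]]]] := tens_indep (coact M m).
have [f fc] := dual_family ic.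
exists [seq (c i, b i) | i <- enum 'I_n]; split.
  move=> _ /mapP[i _ ->] /=.
  by rewrite -(contract_dual b fc i) -E; exact: h.
by rewrite big_map big_enum.
Qed.

Lemma colinear_comp M N (L : lcomodule A) (f : M -> N) (g : N -> L) :
  colinear f -> colinear g -> colinear (g \o f).
Proof.
move=> /colinearP[lf hf] /colinearP[lg hg]; apply/colinearP; split.
  exact: linear_comp.
by move=> m p; rewrite /= hf hg.
Qed.

Lemma colinear_id M : colinear (@idfun M).
Proof. by apply/colinearP. Qed.

Lemma colinear0 M N : colinear (fun _ : M => 0 : N).
Proof.
apply/colinearP; split=> [a u v|m p]; first by rewrite scaler0 addr0.
by rewrite (linear_fun0 (act_linear _)).
Qed.

Lemma colinearD M N (f g : M -> N) :
  colinear f -> colinear g -> colinear (fun m => f m + g m).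
Proof.
move=> /colinearP[lf hf] /colinearP[lg hg]; apply/colinearP; split.
  by move=> a u v; rewrite lf lg scalerDr addrACA.
by move=> m p; rewrite hf hg (linear_funD (act_linear _)).
Qed.

Lemma colinearZ M N k (f : M -> N) : colinear f -> colinear (fun m => k *: f m).
Proof.
move=> /colinearP[lf hf]; apply/colinearP; split.
  by move=> a u v; rewrite lf scalerDr !scalerA mulrC.
by move=> m p; rewrite hf (linear_funZ (act_linear _)).
Qed.

Lemma colinearB M N (f g : M -> N) :
  colinear f -> colinear g -> colinear (fun m => f m - g m).
Proof.
move=> cf /(colinearZ (-1)) cg.
have -> : (fun m => f m - g m) = fun m => f m + -1 *: g m.
  by apply/funext => m; rewrite scaleN1r.
exact: colinearD.
Qed.

Lemma colinear_sum M N (T : Type) (s : seq T) (F : T -> M -> N) :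
  (forall t, colinear (F t)) -> colinear (fun m => \sum_(t <- s) F t m).
Proof.
move=> cF; elim: s => [|t s ih].
  under eq_fun do rewrite big_nil; exact: colinear0.
by under eq_fun do rewrite big_cons; exact: colinearD.
Qed.

Lemma hom_subspace M N : subspace (@Defs.hom K A M N).
Proof.
split; first exact: colinear0.
by move=> a f g cf cg; apply: colinearD => //; exact: colinearZ.
Qed.

Lemma range_subcomodule M N (f : M -> N) : colinear f -> subcomodule (range f).
Proof.
move=> /colinearP[lf hf]; apply/subcomoduleP; split.
  by apply: image_subspace => //; split.
by move=> _ p [m _ <-]; exists (act m p).
Qed.

Lemma image_subcomodule M N (f : M -> N) P :
  colinear f -> subcomodule P -> subcomodule (f @` P).
Proof.
move=> /colinearP[lf hf] /subcomoduleP[sP hP]; apply/subcomoduleP; split.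
  exact: image_subspace.
by move=> _ p [m Pm <-]; exists (act m p) => //; exact: hP.
Qed.

Lemma kernel_subcomodule M N (f : M -> N) :
  colinear f -> subcomodule [set x | f x = 0].
Proof.
move=> /colinearP[lf hf]; apply/subcomoduleP; split.
  split=> [|a u v /= fu fv]; first exact: linear_fun0.
  by rewrite lf fu fv scaler0 addr0.
by move=> m p /= fm; rewrite hf fm (linear_fun0 (act_linear _)).
Qed.

Lemma subcomoduleI M (P Q : set M) :
  subcomodule P -> subcomodule Q -> subcomodule (P `&` Q).
Proof.
move=> /subcomoduleP[[P0 PD] hP] /subcomoduleP[[Q0 QD] hQ].
apply/subcomoduleP; split; first split=> //.
  by move=> a u v [Pu Qu] [Pv Qv]; split; [exact: PD | exact: QD].
by move=> m p [Pm Qm]; split; [exact: hP | exact: hQ].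
Qed.

Lemma zero_subcomodule M : subcomodule [set 0 : M].
Proof.
apply/subcomoduleP; split; first split=> // [a u v -> ->].
  by rewrite scaler0 addr0.
by move=> m p ->; exact: (linear_fun0 (act_linear _)).
Qed.

(** * A subcomodule as a comodule in its own right *)

Section Restriction.
Variables (M : lcomodule A) (P : set M) (sP : subcomodule P).

Let W := Subsp sP.1.
Let v : ss_type W -> M := @ss_val K M W.

Lemma ss_val_inj : injective (@ss_val K M W).
Proof. exact: val_inj. Qed.

Let ex (x : ss_type W) : exists t : tensor A (ss_type W),
  tmap idfun v t = coact M (v x).
Proof.
have Px : P (v x) by exact/(ss_predP W)/ss_valP.
have [n [c [b [ic E]]]] := tens_indep (coact M (v x)).
have [f fc] := dual_family ic.
have Pb i : b i \in ss_pred W.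
  apply/ss_predP; rewrite -(contract_dual b fc i) -E.
  by apply: ((subcomoduleP _).1 sP).2.
exists (\sum_i tens (c i) (SSType (Pb i))).
rewrite (linear_fun_sum _ _ _ (tmap_linear _ _)) // E.
by apply: eq_bigr => i _; rewrite tmapE.
Qed.

(** The coaction of [M] lifts along the inclusion, and by [tmap_inj] the lift is unique; hence it
    may be chosen freely, and linearity and coassociativity are checked after applying the
    inclusion. *)
Definition sub_coact (x : ss_type W) : tensor A (ss_type W) := sval (cid (ex x)).

Lemma sub_coactE x : tmap idfun v (sub_coact x) = coact M (v x).
Proof. by rewrite /sub_coact; case: cid. Qed.

Lemma sub_coact_linear : linear sub_coact.
Proof.
move=> a x y; apply: (tmap_inj (ss_val_linear (W := W)) ss_val_inj).
rewrite sub_coactE (tmap_linear _ (ss_val_linear (W := W))) // !sub_coactE.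
by rewrite /v ss_val_linear linearP.
Qed.

HB.instance Definition _ :=
  GRing.isLinear.Build K (ss_type W) (tensor A (ss_type W)) *:%R sub_coact
    sub_coact_linear.

Lemma sub_coact_assoc x : tassoc (tmap idfun sub_coact (sub_coact x)) =
  tmap (comul A) idfun (sub_coact x).
Proof.
have lv : linear v by [].
have lD : linear (comul A) by exact: linearP.
have lc : linear (coact M) by exact: linearP.
apply: (tmap_inj lv ss_val_inj).
rewrite -tassoc_tmap // tmap_comp //; last exact: tmap_linear.
rewrite [RHS]tmap_comp //.
have -> : tmap idfun v \o sub_coact = coact M \o v.
  by apply/funext => y; exact: sub_coactE.
have -> : tmap (idfun \o idfun) (coact M \o v) (sub_coact x) =
    tmap idfun (coact M) (tmap idfun v (sub_coact x)) by rewrite tmap_comp.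
have -> : tmap (idfun \o comul A) (v \o idfun) (sub_coact x) =
    tmap (comul A) idfun (tmap idfun v (sub_coact x)) by rewrite tmap_comp.
by rewrite sub_coactE coact_assoc.
exact: sub_coact_linear.
Qed.

Lemma sub_coact_counit x : tlift (fun c y => counit A c *: y) (sub_coact x) = x.
Proof.
apply: ss_val_inj; rewrite -[tlift _ _]/(contract (counit A) (sub_coact x)).
have lv : linear v by [].
rewrite -[LHS]/(v _) -(contract_tmap _ _ lv) sub_coactE; exact: act_counit.
Qed.

Definition subcomod : lcomodule A :=
  @LComodule K A (ss_type W) sub_coact sub_coact_assoc sub_coact_counit.

End Restriction.

Lemma subcomod_exists M (P : set M) : subcomodule P ->
  exists (S : lcomodule A) (v : S -> M), [/\ colinear v, injective v & range v = P].
Proof.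
move=> sP; exists (subcomod sP), (@ss_val _ _ _); split.
- by split=> // m; rewrite -sub_coactE.
- exact: ss_val_inj.
- rewrite eqEsubset; split=> [_ [x _ <-]|x Px].
    exact/(ss_predP (Subsp sP.1))/ss_valP.
  have Wx : x \in ss_pred (Subsp sP.1) by apply/ss_predP.
  by exists (SSType Wx).
Qed.

Lemma corestrict M N (L : lcomodule A) (v : L -> N) (f : M -> N) :
  colinear v -> injective v -> colinear f -> range f `<=` range v ->
  exists2 g : M -> L, colinear g & forall m, v (g m) = f m.
Proof.
move=> /colinearP[lv hv] injv /colinearP[lf hf] fv.
have /choice[g gE] : forall m, exists x, v x = f m.
  by move=> m; have [|x _ <-] := fv (f m); [exists m | exists x].
exists g => //; apply/colinearP; split=> [a x y|m p]; apply: injv.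
  by rewrite lv !gE lf.
by rewrite hv !gE hf.
Qed.

(** Any set-theoretic section of [p] defines the factorization, since [f] does not see the choice.
    This takes the place of quotient comodules. *)
Lemma factor_surj M N (L : lcomodule A) (p : M -> N) (f : M -> L) :
  colinear p -> colinear f -> (forall y, exists x, p x = y) ->
  (forall x, p x = 0 -> f x = 0) ->
  exists2 g : N -> L, colinear g & forall x, g (p x) = f x.
Proof.
move=> /colinearP[lp hp] /colinearP[lf hf] /choice[s sE] kf.
have gE x : f (s (p x)) = f x.
  apply/eqP; rewrite -subr_eq0 -linear_funB //; apply/eqP/kf.
  by rewrite linear_funB // sE subrr.
exists (f \o s) => //; apply/colinearP; split=> [a x y|y q] /=.
  by rewrite -{1}[x]sE -{1}[y]sE -lp gE lf.
by rewrite -{1}[y]sE -hp gE hf.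
Qed.

(** Injectivity along a map [d] that need not be injective: [h] factors through the image of [d],
    which embeds in [N]. *)
Lemma injective_extend (E M N : lcomodule A) (d : M -> N) (h : M -> E) :
  injective_comodule E -> colinear d -> colinear h ->
  (forall x, d x = 0 -> h x = 0) ->
  exists2 k : N -> E, colinear k & forall x, k (d x) = h x.
Proof.
move=> iE cd ch kh.
have [S [v [cv injv rv]]] := subcomod_exists (range_subcomodule cd).
have [|p cp pE] := corestrict cv injv cd; first by rewrite rv.
have [||g cg gE] := factor_surj cp ch.
- by move=> y; have : range v (v y) by []; rewrite rv => -[x _ xy];
    exists x; apply: injv; rewrite pE.
- by move=> x px; apply: kh; rewrite -pE px (linear_fun0 cv.1).
have [k [ck kE]] := iE S N v g cv injv cg.
by exists k => // x; rewrite -pE kE gE.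
Qed.

Lemma zero_comodule_exists : exists Z : lcomodule A, forall x : Z, x = 0.
Proof.
have [Z [v [cv injv rv]]] := subcomod_exists (zero_subcomodule (regular A)).
exists Z => x; apply: injv; rewrite (linear_fun0 cv.1).
by have : range v (v x) by []; rewrite rv.
Qed.

(** Local finiteness of comodules. The second factors [b] of the coaction of [m] are values of
    [act m], so [act_act] makes their span stable, and the counit puts [m] in it. *)
Lemma finite_subcomodule M (m : M) : exists n (b : 'I_n -> M),
  subcomodule (in_span b) /\ in_span b m.
Proof.
have [n [c [b [ic E]]]] := tens_indep (coact M m).
have [f fc] := dual_family ic; exists n, b.
have actm p : in_span b (act m p).
  exists (fun i => p (c i)).
  rewrite /act E (linear_fun_sum _ _ _ (contract_linear _)).
  by apply: eq_bigr => i _; rewrite contractE.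
split; last by rewrite -(act_counit m).
apply/subcomoduleP; split; first exact: span_subspace.
move=> _ p [a ->]; rewrite (linear_fun_sum _ _ _ (act_linear _)).
apply: subspace_sum; first exact: span_subspace.
move=> i _; rewrite (linear_funZ (act_linear _)).
apply: subspaceZ; first exact: span_subspace.
by rewrite -(contract_dual b fc i) -E -/(act m _) act_act.
Qed.

End Action.

(** * Finite biproducts *)

Section PairComodule.
Variables (K : fieldType) (A : coalgebra K) (M N : lcomodule A).

Let X : lmodType K := (M * N)%type.
Let inl0 (m : M) : X := (m, 0).
Let inr0 (n : N) : X := (0, n).

Let inl0_linear : linear inl0.
Proof. by move=> a u v; congr (_, _); rewrite /= scaler0 addr0. Qed.

Let inr0_linear : linear inr0.
Proof. by move=> a u v; congr (_, _); rewrite /= scaler0 addr0. Qed.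

Definition pair_coact (x : X) : tensor A X :=
  tmap idfun inl0 (coact M x.1) + tmap idfun inr0 (coact N x.2).

Lemma pair_coact_linear : linear pair_coact.
Proof.
move=> a u v; rewrite /pair_coact !linearP /=.
rewrite (tmap_linear _ inl0_linear) // (tmap_linear _ inr0_linear) //.
by rewrite scalerDr addrACA.
Qed.

HB.instance Definition _ :=
  GRing.isLinear.Build K X (tensor A X) *:%R pair_coact pair_coact_linear.

(** Coassociativity is additive, so it is enough to have it on the images of the two inclusions,
    where it is inherited from the factor [L]. *)
Let pair_coact_in (L : lcomodule A) (i : L -> X) :
  linear i -> (forall y, pair_coact (i y) = tmap idfun i (coact L y)) ->
  forall y, tassoc (tmap idfun pair_coact (tmap idfun i (coact L y))) =
    tmap (comul A) idfun (tmap idfun i (coact L y)).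
Proof.
move=> li iE y.
have lD : linear (comul A) by exact: linearP.
have lc : linear (coact L) by exact: linearP.
rewrite tmap_comp //; last exact: pair_coact_linear.
have -> : pair_coact \o i = tmap idfun i \o coact L by apply/funext => z; exact: iE.
have -> : tmap (idfun \o idfun) (tmap idfun i \o coact L) (coact L y) =
    tmap idfun (tmap idfun i) (tmap idfun (coact L) (coact L y)).
  by rewrite [RHS]tmap_comp //; exact: tmap_linear.
by rewrite tassoc_tmap // coact_assoc !tmap_comp.
Qed.

Let pair_coact_inl y : pair_coact (inl0 y) = tmap idfun inl0 (coact M y).
Proof.
rewrite /pair_coact /= linear0 (linear_fun0 (tmap_linear _ inr0_linear)) ?addr0 //.
Qed.

Let pair_coact_inr y : pair_coact (inr0 y) = tmap idfun inr0 (coact N y).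
Proof.
rewrite /pair_coact /= linear0 (linear_fun0 (tmap_linear _ inl0_linear)) ?add0r //.
Qed.

Lemma pair_coact_assoc x : tassoc (tmap idfun pair_coact (pair_coact x)) =
  tmap (comul A) idfun (pair_coact x).
Proof.
have lD : linear (comul A) by exact: linearP.
have lid (V : lmodType K) : linear (@idfun V) by [].
rewrite {2 3}/pair_coact (linear_funD (tmap_linear _ pair_coact_linear)) //.
rewrite (linear_funD (@tassoc_linear _ _ _ _)) (linear_funD (tmap_linear lD (lid X))).
by rewrite !pair_coact_in.
Qed.

Lemma pair_coact_counit x : tlift (fun c y => counit A c *: y) (pair_coact x) = x.
Proof.
rewrite -[LHS]/(contract (counit A) (pair_coact x)).
rewrite /pair_coact (linear_funD (contract_linear _)).
rewrite (contract_tmap _ _ inl0_linear) (contract_tmap _ _ inr0_linear).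
rewrite -!/(act _ _) !act_counit /inl0 /inr0; case: x => m n.
by congr (_, _); rewrite /= ?addr0 ?add0r.
Qed.

Definition pair_comod : lcomodule A :=
  @LComodule K A X pair_coact pair_coact_assoc pair_coact_counit.

Lemma pair_act (x : pair_comod) p : act x p = (act x.1 p, act x.2 p).
Proof.
rewrite /act /= /pair_coact (linear_funD (contract_linear _)).
rewrite (contract_tmap _ _ inl0_linear) (contract_tmap _ _ inr0_linear).
by congr (_, _); rewrite /= ?addr0 ?add0r.
Qed.

Lemma pair_inl_colinear : colinear (fun m => (m, 0) : pair_comod).
Proof.
apply/colinearP; split=> [|m p]; first exact: inl0_linear.
by rewrite pair_act /= (linear_fun0 (act_linear _)).
Qed.

Lemma pair_inr_colinear : colinear (fun n => (0, n) : pair_comod).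
Proof.
apply/colinearP; split=> [|m p]; first exact: inr0_linear.
by rewrite pair_act /= (linear_fun0 (act_linear _)).
Qed.

Lemma pair_fst_colinear : colinear (fun x : pair_comod => x.1).
Proof. by apply/colinearP; split=> [//|x p]; rewrite pair_act. Qed.

Lemma pair_snd_colinear : colinear (fun x : pair_comod => x.2).
Proof. by apply/colinearP; split=> [//|x p]; rewrite pair_act. Qed.

End PairComodule.

Section Biproduct.
Variables (K : fieldType) (A : coalgebra K) (J : choiceType).
Variable F : J -> lcomodule A.

(** The maps are indexed by all of [J], so that dependent families carry no membership proofs; the
    last two clauses force them to be 0 outside [s]. *)
Definition biproduct (s : seq J) (X : lcomodule A) (iota : forall j, F j -> X)
    (pi : forall j, X -> F j) : Prop :=
  [/\ forall j, colinear (iota j), forall j, colinear (pi j),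
      forall j y, j \in s -> pi j (iota j y) = y,
      forall i j y, i != j -> pi i (iota j y) = 0 &
      forall x, x = \sum_(j <- s) iota j (pi j x)].

Lemma biproduct_exists s : uniq s -> exists X iota pi, @biproduct s X iota pi.
Proof.
elim: s => [_|a s ih /= /andP[nas /ih[X [iota [pi [ci cp pi1 pi0 sumE]]]]]].
  have [Z Z0] := zero_comodule_exists A.
  exists Z, (fun j _ => 0), (fun j _ => 0); split=> // [j|j|x].
  - exact: colinear0.
  - exact: colinear0.
  - by rewrite big_nil; exact: Z0.
pose Y := pair_comod (F a) X.
(* At the index [a] the maps must have type [F j] with [j] only provably equal to [a]. They are
   specified by a relation containing the transport, which proof irrelevance removes in [qa]. *)
pose spec j (q : (F j -> Y) * (Y -> F j)) :=
  (exists e : a = j, q = eq_rect a (fun j => ((F j -> Y) * (Y -> F j))%type)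
     ((fun y => (y, 0)), (fun x => x.1)) j e) \/
  (a <> j /\ q = ((fun y => (0, iota j y)), (fun x => pi j x.2))).
have [q qP] : exists q : forall j, (F j -> Y) * (Y -> F j), forall j, spec j (q j).
  apply: choice_dep.
  move=> j; case: (pselect (a = j)) => [e|ne].
    by eexists; left; exists e.
  by eexists; right; split.
have qa : q a = ((fun y => (y, 0)), (fun x => x.1)).
  by case: (qP a) => [[e ->]|[]//]; rewrite (Prop_irrelevance e erefl).
have qn j : a != j -> q j = ((fun y => (0, iota j y)), (fun x => pi j x.2)).
  by move=> /eqP naj; case: (qP j) => [[e]|[_ ->]//]; case: naj.
exists Y, (fun j => (q j).1), (fun j => (q j).2); split.
- move=> j; have [<-|aj] := eqVneq a j.
    by rewrite qa; exact: pair_inl_colinear.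
  rewrite (qn _ aj).
  exact: (colinear_comp (ci j) (@pair_inr_colinear _ _ (F a) X)).
- move=> j; have [<-|aj] := eqVneq a j.
    by rewrite qa; exact: pair_fst_colinear.
  rewrite (qn _ aj).
  exact: (colinear_comp (@pair_snd_colinear _ _ (F a) X) (cp j)).
- move=> j y; have [ja|aj] := eqVneq a j.
    by subst j; rewrite qa.
  rewrite inE eq_sym (negPf aj) => js; rewrite (qn _ aj) /=; exact: pi1.
- move=> i j y; have [ia|ai] := eqVneq a i; have [ja|aj] := eqVneq a j.
  + by subst i j; rewrite eqxx.
  + by subst i; rewrite qa (qn _ aj).
  + by subst j; rewrite qa (qn _ ai) /= (linear_fun0 (cp i).1).
  + by rewrite (qn _ ai) (qn _ aj) /=; exact: pi0.
- case=> u v; rewrite big_cons qa /=.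
  have -> : \sum_(j <- s) (q j).1 ((q j).2 (u, v)) = (0, v).
    rewrite {2}(sumE v).
    rewrite (linear_fun_sum s predT (fun j => iota j (pi j v))
      (@pair_inr_colinear _ _ (F a) X).1).
    apply: eq_big_seq => j js; rewrite qn //.
    by apply: contraNneq nas => ->.
  by congr (_, _); rewrite /= ?addr0 ?add0r.
Qed.

Lemma biproduct_injective s X iota pi : @biproduct s X iota pi ->
  (forall j, injective_comodule (F j)) -> injective_comodule X.
Proof.
move=> [ci cp pi1 pi0 sumE] iF M N i f ci' inji cf.
have [g gP] : exists g : forall j, N -> F j,
    forall j, colinear (g j) /\ forall m, g j (i m) = pi j (f m).
  apply: (@choice_dep J (fun j => N -> F j)
    (fun j g => colinear g /\ forall m, g (i m) = pi j (f m))) => j.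
  apply: (iF j M N i (pi j \o f)) => //; exact: colinear_comp.
exists (fun x => \sum_(j <- s) iota j (g j x)); split.
  by apply: colinear_sum => j; exact: (colinear_comp (gP j).1 (ci j)).
by move=> m; rewrite [RHS]sumE; apply: eq_bigr => j _; rewrite (gP j).2.
Qed.

Lemma biproduct_sum s X iota pi (y : forall j, F j) i : @biproduct s X iota pi ->
  uniq s -> i \in s -> pi i (\sum_(j <- s) iota j (y j)) = y i.
Proof.
move=> [ci cp pi1 pi0 sumE] us si.
rewrite (linear_fun_sum _ _ _ (cp i).1) (bigD1_seq i) //= pi1 // big1 ?addr0 //.
by move=> j; rewrite eq_sym => ij; exact: pi0.
Qed.

Lemma biproduct_decomp s X iota pi : @biproduct s X iota pi -> uniq s ->
  (forall j, j \in s) -> direct_sum_decomp iota [set: X].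
Proof.
move=> bX us sJ; have [ci cp pi1 pi0 sumE] := bX; split=> // [x|s' y us' E j js'].
  by split=> // _; exists s, (fun j => pi j x).
have := congr1 (pi j) E; rewrite (linear_fun0 (cp j).1) => <-.
rewrite (linear_fun_sum _ _ _ (cp j).1) (bigD1_seq j) //= pi1 // big1 ?addr0 //.
by move=> i; rewrite eq_sym => ij; exact: pi0.
Qed.

End Biproduct.

(** * Weights and convolution *)

Section Functionals.
Variable K : fieldType.

Lemma functional1 (V : lmodType K) (x : V) : x <> 0 -> exists f : {scalar V}, f x = 1.
Proof.
move=> x0; have ib : indep (fun _ : 'I_1 => x).
  move=> a; rewrite big_ord_recl big_ord0 addr0 => /eqP.
  rewrite scaler_eq0 => /orP[/eqP a0 i|/eqP //]; first by rewrite ord1.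
by have [f fx] := dual_family ib; exists (f ord0); rewrite (fx ord0 ord0).
Qed.

Lemma scalar_sep (V : lmodType K) (x y : V) :
  (forall f : {scalar V}, f x = f y) -> x = y.
Proof.
move=> h; apply/eqP; rewrite -subr_eq0; apply/eqP.
apply: contrapT => xy0; have [f] := functional1 xy0.
by rewrite linearB h subrr => /esym/eqP; rewrite oner_eq0.
Qed.

Lemma tensZ (V W : lmodType K) (a : K) (v : V) (w : W) :
  tens (a *: v) w = tens v (a *: w).
Proof. by rewrite (linear_funZ (tens_linearl w)) (linear_funZ (tens_linearr v)). Qed.

Lemma tens_cancel (V W : lmodType K) (v v' : V) (w : W) :
  w <> 0 -> tens v w = tens v' w -> v = v'.
Proof.
move=> /functional1[f fw] /(congr1 (fun t => contract f (tswap t))).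
by rewrite !tswapE !contractE fw !scale1r.
Qed.

Variable A : coalgebra K.
Implicit Types (M N : lcomodule A) (p q : {scalar A}) (c : A).

(** For nonzero [x]: the line of [x] is a subcomodule, and its coefficient [h] is group-like by
    [weight_comul] and [weight_counit]. *)
Definition weight M (h : A) (x : M) : Prop := coact M x = tens h x.

Lemma weightP M h (x : M) : weight h x <-> forall p, act x p = p h *: x.
Proof.
split=> [wx p|h']; first by rewrite /act wx contractE.
by apply: contract_sep => p; rewrite contractE -h'.
Qed.

Lemma weight_subspace M h : subspace (@weight M h).
Proof.
split; first by apply/weightP => p; rewrite (linear_fun0 (act_linear _)) scaler0.
move=> a x y /weightP hx /weightP hy; apply/weightP => p.
by rewrite (act_linear p a x y) hx hy scalerDr !scalerA mulrC.
Qed.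

(** Coassociativity at [x] equates [comul A h] and h (x) h after tensoring with [x], which cancels
    because it is nonzero. *)
Lemma weight_comul M h (x : M) : weight h x -> x <> 0 -> comul A h = tens h h.
Proof.
move=> wx x0; apply: (tens_cancel x0).
have lD : linear (comul A) by exact: linearP.
have lc : linear (coact M) by exact: linearP.
have := coact_assoc x; rewrite wx !tmapE // wx tassocE; exact: esym.
Qed.

Lemma weight_counit M h (x : M) : weight h x -> x <> 0 -> counit A h = 1.
Proof.
move=> wx x0; have := act_counit x; rewrite ((weightP _ _).1 wx) => /eqP.
rewrite -{2}[x]scale1r -subr_eq0 -scalerBl scaler_eq0 => /orP[|/eqP //].
by rewrite subr_eq0 => /eqP.
Qed.

Lemma weight_unique M h h' (x : M) : weight h x -> weight h' x -> x <> 0 -> h = h'.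
Proof. by move=> wx wx' x0; apply: (tens_cancel x0); rewrite -wx. Qed.

Lemma weight_colinear M N (f : M -> N) h x :
  colinear f -> weight h x -> weight h (f x).
Proof.
move=> /colinearP[lf hf] /weightP wx; apply/weightP => p.
by rewrite -hf wx (linear_funZ lf).
Qed.

Lemma weight_colinear_inj M N (f : M -> N) h x :
  colinear f -> injective f -> weight h (f x) -> weight h x.
Proof.
move=> /colinearP[lf hf] injf /weightP wx; apply/weightP => p; apply: injf.
by rewrite hf wx (linear_funZ lf).
Qed.

Lemma line_subspace (V : lmodType K) (x : V) : subspace [set k *: x | k in [set: K]].
Proof.
split; first by exists 0 => //; rewrite scale0r.
move=> a _ _ [k _ <-] [l _ <-]; exists (a * k + l) => //.
by rewrite scalerDl scalerA.
Qed.

Lemma weight_line_subcomodule M h (x : M) : weight h x ->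
  subcomodule [set k *: x | k in [set: K]].
Proof.
move=> /weightP wx; apply/subcomoduleP; split; first exact: line_subspace.
move=> _ p [k _ <-]; exists (k * p h) => //.
by rewrite (linear_funZ (act_linear _)) wx scalerA.
Qed.

Lemma convE p q c : q (@act K A (regular A) c p) = conv p q c.
Proof.
rewrite /act /conv /=; move: (comul A c).
apply: (tens_linear_ext (U := K^o) (f := fun t => q (contract p t))
  (g := fun t => tlift (fun x y => p x * q y : K^o) t)).
- by move=> a u v; rewrite (contract_linear p) linearP.
- by apply: tlift_linear; exact: mul_bilinear.
- by move=> x y; rewrite contractE tlift_tens ?linearZ //; exact: mul_bilinear.
Qed.

Lemma counit_act p c : counit A (@act K A (regular A) c p) = p c.
Proof.
rewrite convE /conv -[in RHS](counit_right c); move: (comul A c).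
apply: (tens_linear_ext (U := K^o) (f := fun t => tlift (fun x y => p x * counit A y : K^o) t)
  (g := fun t => p (tlift (fun x y => counit A y *: x) t))).
- by apply: tlift_linear; exact: mul_bilinear.
- move=> a u v; rewrite (tlift_linear (counit_bilinear_right A)) linearP //.
- move=> x y; rewrite !tlift_tens ?linearZ /= 1?mulrC //.
    exact: counit_bilinear_right.
  exact: mul_bilinear.
Qed.

Lemma weight_regular h (y : regular A) : weight h y -> y = counit A y *: h.
Proof.
move=> wy; rewrite -{1}(counit_right y); rewrite [comul A y]wy tlift_tens //.
exact: counit_bilinear_right.
Qed.

(* The left action of A^* on A is the right action for the opposite coalgebra. *)
Definition lactf p c : A := @act K (op_coalgebra A) (regular (op_coalgebra A)) c p.

Lemma lactfE p c : lactf p c = contract p (tswap (comul A c)).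
Proof. by []. Qed.

Lemma convl p q c : p (lactf q c) = conv p q c.
Proof.
rewrite lactfE /conv; move: (comul A c).
apply: (tens_linear_ext (U := K^o) (f := fun t => p (contract q (tswap t)))
  (g := fun t => tlift (fun x y => p x * q y : K^o) t)).
- by move=> a u v; rewrite tswap_linear (contract_linear q) linearP.
- by apply: tlift_linear; exact: mul_bilinear.
- move=> x y; rewrite tswapE contractE tlift_tens ?linearZ //= 1?mulrC //.
  exact: mul_bilinear.
Qed.

Lemma counit_lactf p c : counit A (lactf p c) = p c.
Proof.
rewrite convl /conv -[in RHS](counit_left c); move: (comul A c).
apply: (tens_linear_ext (U := K^o) (f := fun t => tlift (fun x y => counit A x * p y : K^o) t)
  (g := fun t => p (tlift (fun x y => counit A x *: y) t))).
- by apply: tlift_linear; exact: mul_bilinear.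
- move=> a u v; rewrite (tlift_linear (counit_bilinear_left A)) linearP //.
- move=> x y; rewrite !tlift_tens ?linearZ //=.
    exact: counit_bilinear_left.
  exact: mul_bilinear.
Qed.

End Functionals.

Section Convolution.
Variables (K : fieldType) (A : coalgebra K).
Implicit Types (M N : lcomodule A) (p q r : {scalar A}) (c : A).

Lemma conv_op p q c : @conv K (op_coalgebra A) p q c = conv q p c.
Proof. by rewrite -convl; symmetry; exact: (@convE K (op_coalgebra A) p q c). Qed.

(** Both sides are the counit of an iterated action on the regular comodule, where [act_act]
    applies. *)
Lemma convA p q r c : conv (convs p q) r c = conv p (convs q r) c.
Proof.
rewrite -[LHS]/(convs (convs p q) r c) -[RHS]/(convs p (convs q r) c).
by rewrite -[LHS]counit_act -[RHS]counit_act -!act_act.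
Qed.

Lemma lactf_act p q c : lactf p (@act K A (regular A) c q) =
  @act K A (regular A) (lactf p c) q.
Proof.
apply: scalar_sep => r.
by rewrite convE convl -[LHS]/(convs r p _) convE -convA -convl.
Qed.

Lemma lactf_idem p c : conv p p =1 p -> lactf p (lactf p c) = lactf p c.
Proof.
move=> pp; apply: scalar_sep => r.
rewrite convl -[LHS]/(convs r p _) convl convA [RHS]convl.
by rewrite (_ : (convs p p : A -> K) = p) //; apply/funext.
Qed.

Lemma act_idem M (m : M) p : conv p p =1 p -> act (act m p) p = act m p.
Proof.
move=> pp; rewrite act_act /act /contract.
by rewrite (_ : (convs p p : A -> K) = p) //; apply/funext.
Qed.

(* The unique colinear map M -> A whose composite with the counit is phi. *)
Definition cofree_map M (phi : {scalar M}) (m : M) : A :=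
  contract phi (tswap (coact M m)).

Lemma cofree_mapE M (phi : {scalar M}) m p : p (cofree_map phi m) = phi (act m p).
Proof.
rewrite /cofree_map /act; move: (coact M m).
apply: (tens_linear_ext (U := K^o) (f := fun t => p (contract phi (tswap t)))
  (g := fun t => phi (contract p t))).
- by move=> a u v; rewrite tswap_linear (contract_linear phi) linearP.
- by move=> a u v; rewrite (contract_linear p) linearP.
- by move=> x y; rewrite tswapE !contractE !linearZ /= mulrC.
Qed.

Lemma cofree_map_colinear M (phi : {scalar M}) :
  @colinear K A M (regular A) (cofree_map phi).
Proof.
apply/colinearP; split=> [a u v|m p]; apply: scalar_sep => q.
  by rewrite linearP /= !cofree_mapE (act_linear q a u v) linearP.
rewrite convE -[RHS]/(convs p q _) !cofree_mapE act_act //.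
Qed.

End Convolution.

(** * One side of a pointed coalgebra *)

Lemma one_dim_weight (K : fieldType) (A : coalgebra K) (S : lcomodule A) :
  has_dim [set: S] 1 ->
  exists x h, [/\ x <> 0, weight h x & forall w : S, exists k, w = k *: x].
Proof.
move=> /has_dimP[b [_ sb ib]]; pose x := b ord0.
have sx w : exists k, w = k *: x.
  by have [a ->] := sb w I; exists (a ord0); rewrite big_ord_recl big_ord0 addr0.
have x0 : x <> 0.
  move=> x0; have /eqP : (1 : K) = 0; last by rewrite oner_eq0.
  by apply: (ib (fun=> 1) _ ord0); rewrite big1 // => i _; rewrite ord1 -/x x0 scaler0.
have [n [c [m [_ E]]]] := tens_indep (coact S x).
have /choice[k km] : forall i, exists k, m i = k *: x by move=> i; exact: sx.
exists x, (\sum_i k i *: c i); split=> //; rewrite /weight E.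
rewrite (linear_fun_sum _ _ _ (tens_linearl _)).
by apply: eq_bigr => i _; rewrite km tensZ.
Qed.

(* g j is the group-like element whose line is the coefficient space of S j;
   f j embeds the envelope E j into A with image e_j A, and u j is the point of
   the socle of E j sent to g j. *)
Record pointed_side (K : fieldType) (A : coalgebra K) (I : choiceType)
    (S E : I -> lcomodule A) (g : I -> A) (e : I -> {scalar A})
    (f : forall j, E j -> A) (u : forall j, E j) : Prop := PointedSide {
  side_simple : forall M : lcomodule A, simple_comodule M -> has_dim [set: M] 1;
  side_S : forall j, exists v : S j,
    [/\ v <> 0, weight (g j) v & forall w, exists k, w = k *: v];
  side_exhaust : forall (M : lcomodule A) h (x : M),
    weight h x -> x <> 0 -> exists j, h = g j;
  side_inj : injective g;
  side_injective : forall j, injective_comodule (E j);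
  side_u : forall j, weight (g j) (u j);
  side_fu : forall j, f j (u j) = g j;
  side_u0 : forall j, u j <> 0;
  side_essential : forall j, essential [set k *: u j | k in [set: K]];
  side_idem : forall j, conv (e j) (e j) =1 e j;
  side_f : forall j, [/\ @colinear K A (E j) (regular A) (f j), injective (f j) &
    range (f j) = [set lactf (e j) c | c in [set: A]]]
}.

Section Side.
Variables (K : fieldType) (A : coalgebra K) (I : choiceType).
Variables (S E : I -> lcomodule A) (g : I -> A) (e : I -> {scalar A}).
Variables (f : forall j, E j -> A) (u : forall j, E j).
Hypothesis side : pointed_side S g e f u.
Implicit Types M N : lcomodule A.

(** Local finiteness provides nonzero finite-dimensional subcomodules of [Q]. One of least dimension
    is simple, hence a line by pointedness, and its generator is a weight vector. *)
Lemma weight_exists M (Q : set M) : subcomodule Q -> ~ zero_set Q ->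
  exists x p, [/\ Q x, x <> 0 & weight (g p) x].
Proof.
move=> sQ Q0.
pose P n := `[< exists Q' : set M,
  [/\ subcomodule Q', Q' `<=` Q, ~ zero_set Q' & has_dim Q' n] >].
have [x Qx x0] : exists2 x, Q x & x <> 0.
  apply: contrapT => nx; apply: Q0 => x Qx; apply: contrapT => x0.
  by apply: nx; exists x.
have exP : exists n, P n.
  have [n [b [sb bx]]] := finite_subcomodule x; have [m bm] := span_has_dim b.
  have sQb : subcomodule (Q `&` in_span b) by exact: subcomoduleI.
  have [k _ Qk] := has_dim_sub sQb.1 (@subIsetr _ Q _) bm.
  exists k; apply/asboolP; exists (Q `&` in_span b); split=> //.
  by move=> h; apply: x0; exact: h.
case: (ex_minnP exP) => n /asboolP[Q' [sQ' Q'Q Q'0 Q'n]] nmin.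
have [T [v [cv injv rv]]] := subcomod_exists sQ'.
have lv := cv.1.
have sT : simple_comodule T.
  split=> [||R sR _].
  - by apply/subcomoduleP.
  - move=> T0; apply: Q'0 => y; rewrite -rv => -[z _ <-].
    by rewrite (T0 z) // (linear_fun0 lv).
  - have [R0|R0] := pselect (zero_set R); [by left | right].
    have svR := image_subcomodule cv sR.
    have vRQ' : v @` R `<=` Q' by rewrite -rv => _ [y _ <-]; exists y.
    have [m mn vRm] := has_dim_sub svR.1 vRQ' Q'n.
    have nm : (n <= m)%N.
      apply: nmin; apply/asboolP; exists (v @` R); split=> //.
        by move=> y /vRQ'/Q'Q.
      move=> vR0; apply: R0 => y Ry; apply: injv.
      by rewrite (linear_fun0 lv); apply: vR0; exists y.
    have {}nm : m = n by apply/eqP; rewrite eqn_leq mn nm.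
    rewrite nm in vRm; have vRE := has_dim_sub_eq svR.1 vRQ' Q'n vRm.
    rewrite eqEsubset; split=> // y _.
    have : Q' (v y) by rewrite -rv; exists y.
    by rewrite -vRE => -[z Rz /injv <-].
have [y [h [y0 wy _]]] := one_dim_weight (side_simple side sT).
have [p hp] := side_exhaust side wy y0.
exists (v y), p; split.
- by apply: Q'Q; rewrite -rv; exists y.
- by move=> vy; apply: y0; apply: injv; rewrite vy (linear_fun0 lv).
- by rewrite -hp; exact: weight_colinear.
Qed.

(** The line of [x] is a nonzero subcomodule, so it meets the essential line of [u q]; two lines
    that meet are equal and have one weight. *)
Lemma weight_E p q (x : E q) : weight (g p) x -> x <> 0 ->
  p = q /\ exists k, x = k *: u q.
Proof.
move=> wx x0.
have h : ~ zero_set ([set k *: u q | k in [set: K]] `&` [set k *: x | k in [set: K]]).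
  apply: (side_essential side); first exact: weight_line_subcomodule wx.
  by move=> /(_ x) h; apply: x0; apply: h; exists 1; rewrite ?scale1r.
have [y [[k _ yk] [l _ yl]] y0] :
    exists2 y, ([set k *: u q | k in [set: K]] `&` [set k *: x | k in [set: K]]) y & y <> 0.
  apply: contrapT => ny; apply: h => y Qy; apply: contrapT => y0.
  by apply: ny; exists y.
have l0 : l != 0 by apply/eqP => l0; apply: y0; rewrite -yl l0 scale0r.
split; last first.
  by exists (l^-1 * k); rewrite -scalerA yk -yl scalerA mulVf // scale1r.
apply: (side_inj side); apply: (weight_unique (x := y)) => //.
  by rewrite -yl; apply: subspaceZ => //; exact: weight_subspace.
by rewrite -yk; apply: subspaceZ; [exact: weight_subspace | exact: side_u side q].
Qed.

Lemma in_image_f p c : range (@f p) c <-> lactf (e p) c = c.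
Proof.
have [_ _ ->] := side_f side p; split=> [[d _ <-]|<-]; last by exists c.
by apply: lactf_idem; exact: side_idem side p.
Qed.

Lemma weight_g p : @weight K A (regular A) (g p) (g p).
Proof. exact: (weight_comul (side_u side p) (@side_u0 _ _ _ _ _ _ _ _ _ side p)). Qed.

Lemma g_neq0 p : g p <> 0.
Proof.
move=> gp; have := side_u0 side (j := p); apply.
have [cf injf _] := side_f side p; apply: injf.
by rewrite (linear_fun0 cf.1) (side_fu side).
Qed.

Lemma lactf_weight (q : {scalar A}) p : lactf q (g p) = q (g p) *: g p.
Proof. by rewrite lactfE [comul A _]weight_g tswapE contractE. Qed.

(** Idempotency and group-likeness make the value a root of t^2 = t. If it is 1, then [g q] lies in
    the image e_p A of [E p], where [g p] is the only possible weight. *)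
Lemma idem_g p q : e p (g q) = (p == q)%:R.
Proof.
have e01 : e p (g q) = 0 \/ e p (g q) = 1.
  have := side_idem side p (g q); rewrite -convl lactf_weight linearZ /=.
  move/eqP; rewrite -subr_eq0 -{3}[e p _]mulr1 -mulrBr mulf_eq0.
  by rewrite subr_eq0 => /orP[] /eqP; [left | right].
have [cf injf rf] := side_f side p.
have [->|pq] := eqVneq p q.
  have /in_image_f : range (@f q) (g q) by exists (u q) => //; exact: side_fu side q.
  rewrite lactf_weight => E0.
  have /eqP : (e q (g q) - 1) *: g q = 0 by rewrite scalerBl scale1r E0 subrr.
  by rewrite scaler_eq0 subr_eq0 => /orP[/eqP //|/eqP /g_neq0].
case: e01 => // e1; have /in_image_f[y _ fy] : lactf (e p) (g q) = g q.
  by rewrite lactf_weight e1 scale1r.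
have wy : weight (g q) y.
  by apply: (weight_colinear_inj cf injf); rewrite fy; exact: weight_g.
have [|qp _] := weight_E wy; last by rewrite qp eqxx in pq.
by move=> y0; apply: (@g_neq0 q); rewrite -fy y0 (linear_fun0 cf.1).
Qed.

Definition corner M p : set M := [set act m (e p) | m in [set: M]].
Arguments corner : clear implicits.

Lemma cornerP M p (x : M) : corner M p x <-> act x (e p) = x.
Proof.
split=> [[y _ <-]|<-]; last by exists x.
by apply: act_idem; exact: side_idem side p.
Qed.

Lemma corner_subspace M p : subspace (corner M p).
Proof.
split; first by exists 0 => //; exact: (linear_fun0 (act_linear _)).
move=> a _ _ [x _ <-] [y _ <-]; exists (a *: x + y) => //.
exact: (act_linear (e p) a x y).
Qed.

(** The colinear map into [A] attached to [phi] has its values in e_p A exactly because [phi] is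
    invariant under the idempotent; it then lifts along the embedding of [E p]. *)
Lemma hom_of_functional M p (phi : {scalar M}) :
  (forall m, phi (act m (e p)) = phi m) ->
  exists2 G : M -> E p, colinear G & forall m (q : {scalar A}),
    q (f (G m)) = phi (act m q).
Proof.
move=> phie; have [cf injf rf] := side_f side p.
have [|G cG GE] := corestrict cf injf (cofree_map_colinear phi).
  move=> _ [m _ <-]; apply/in_image_f; apply: scalar_sep => q.
  by rewrite convl -[LHS]/(convs q (e p) _) !cofree_mapE -act_act phie.
by exists G => // m q; rewrite GE cofree_mapE.
Qed.

(** A functional dual to [b] becomes invariant under [e p] after composition with m |-> m e_p, and
    its values on [b] are unchanged since [b] lies in the corner. *)
Lemma dual_homs M p n (b : 'I_n -> M) : (forall i, corner M p (b i)) -> indep b ->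
  exists2 G : 'I_n -> M -> E p, forall i, colinear (G i) &
    exists phi : 'I_n -> {scalar M}, (forall i j, phi i (b j) = (i == j)%:R) /\
    forall i m (q : {scalar A}), q (f (G i m)) = phi i (act (act m q) (e p)).
Proof.
move=> cb ib; have [phi phib] := dual_family ib.
have sc i : scalar (fun m => phi i (act m (e p))).
  by move=> a x y; rewrite (act_linear (e p) a x y) linearP.
have h i := @hom_of_functional M p (scalar_of (sc i)).
have /choice[G GP] : forall i, exists G : M -> E p, colinear G /\
    forall m (q : {scalar A}), q (f (G m)) = phi i (act (act m q) (e p)).
  move=> i; have [|G cG GE] := h i; last by exists G.
  by move=> m /=; rewrite act_idem //; exact: side_idem side p.
exists G; first by move=> i; exact: (GP i).1.
by exists phi; split=> // i; exact: (GP i).2.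
Qed.

Lemma dual_homs_indep M p n (b : 'I_n -> M) (G : 'I_n -> M -> E p)
    (phi : 'I_n -> {scalar M}) : (forall i, corner M p (b i)) ->
  (forall i j, phi i (b j) = (i == j)%:R) ->
  (forall i m (q : {scalar A}), q (f (G i m)) = phi i (act (act m q) (e p))) ->
  indep G.
Proof.
move=> cb phib GE a a0 i; have [cf _ _] := side_f side p.
have := congr1 (fun F : M -> E p => counit A (f (F (b i)))) a0.
rewrite /= fct_sumE (linear_fun_sum _ _ _ cf.1) linear_sum (linear_fun0 cf.1) linear0.
rewrite (bigD1 i) //= (linear_funZ cf.1) linearZ /= GE act_counit.
rewrite ((cornerP _ _).1 (cb i)) phib eqxx mulr1 big1 ?addr0 // => j ji.
rewrite (linear_funZ cf.1) linearZ /= GE act_counit ((cornerP _ _).1 (cb i)).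
by rewrite phib (negPf ji) mulr0.
Qed.

(** Independent vectors of M e_p produce equally many independent maps into [E p]. Computability
    enters the proof through this bound. *)
Lemma corner_fin_dim M p : fin_dim (@Defs.hom K A M (E p)) -> fin_dim (corner M p).
Proof.
move=> [n /has_dimP[b [_ sb _]]].
have [|m _ ?] := @bounded_has_dim _ _ (corner M p) n (corner_subspace M p).
  move=> m c cc ic; have [G cG [phi [phic GE]]] := dual_homs cc ic.
  apply: (indep_le (dual_homs_indep cc phic GE) (c := b)) => i.
  by apply: sb; exact: cG.
by exists m.
Qed.

(** A colinear [H] is determined by the functional counit o f o H, which depends only on the image
    in M e_p; its values on the basis are the coordinates of [H] in the dual maps. *)
Lemma hom_dim M p n : has_dim (corner M p) n -> has_dim (@Defs.hom K A M (E p)) n.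
Proof.
move=> /has_dimP[b [cb sb ib]]; apply/has_dimP.
have [G cG [phi [phib GE]]] := dual_homs cb ib.
exists G; split=> [i|H cH|]; first exact: cG.
  have [cf injf rf] := side_f side p.
  exists (fun i => counit A (f (H (b i)))); apply/funext => m; apply: injf.
  have [lH aH] := (colinearP _).1 cH; have [lf af] := (colinearP _).1 cf.
  have fH x : counit A (f (H (act x (e p)))) = counit A (f (H x)).
    rewrite aH af counit_act -counit_lactf.
    by congr (counit A _); apply/in_image_f; exists (H x).
  rewrite fct_sumE (linear_fun_sum _ _ _ lf); apply: scalar_sep => q.
  rewrite -counit_act -af -aH -fH.
  have : corner M p (act (act m q) (e p)) by exists (act m q).
  case/sb => a E0; rewrite linear_sum /= E0.
  rewrite (linear_fun_sum _ _ _ lH) (linear_fun_sum _ _ _ lf) linear_sum /=.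
  apply: eq_bigr => i _; rewrite (linear_funZ lf) linearZ /= GE E0.
  rewrite (linear_funZ lH) (linear_funZ lf) linearZ /= linear_sum (bigD1 i) //=.
  rewrite linearZ /= phib eqxx mulr1 big1 ?addr0 1?[RHS]mulrC // => j ji.
  by rewrite linearZ /= phib eq_sym (negPf ji) mulr0.
exact: dual_homs_indep cb phib GE.
Qed.

End Side.
Arguments corner {K A I} e M p _.

(** * Injective envelopes *)

(** A longest duplicate-free list is exhaustive. This turns a bound on weight vectors into a finite
    list of summands for the envelope. *)
Lemma full_seq (T : eqType) N : (forall s : seq T, uniq s -> (size s <= N)%N) ->
  exists2 s : seq T, uniq s & forall t, t \in s.
Proof.
move=> bd; pose P n := `[< exists2 s : seq T, uniq s & size s = n >].
have P0 : exists n, P n by exists 0%N; apply/asboolP; exists [::].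
have PN n : P n -> (n <= N)%N by move=> /asboolP[s us <-]; exact: bd.
case: (ex_maxnP P0 PN) => n /asboolP[s us sn] nmax; exists s => // t.
apply: contrapT => /negP ts; suff : (n.+1 <= n)%N by rewrite ltnn.
by apply: nmax; apply/asboolP; exists (t :: s); rewrite /= ?ts ?us ?sn.
Qed.

Lemma indep_seq (K : fieldType) (V : lmodType K) (J : eqType) (x : J -> V) (s : seq J) :
  uniq s ->
  (forall a : J -> K, \sum_(t <- s) a t *: x t = 0 -> forall t, t \in s -> a t = 0) ->
  indep (fun i : 'I_(size s) => x (tnth (in_tuple s) i)).
Proof.
move=> us h a a0 i.
pose a' t := if insub (index t s) is Some k then a k else 0.
have a'E k : a' (tnth (in_tuple s) k) = a k.
  rewrite /a' (tnth_nth (tnth (in_tuple s) k)) index_uniq //.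
  by rewrite insubT // => lt; congr (a _); apply: val_inj.
rewrite -a'E; apply: h; last exact: mem_tnth.
rewrite -[s in LHS]/(val (in_tuple s)) big_tuple -[RHS]a0.
by apply: eq_bigr => k _; rewrite a'E.
Qed.

Lemma Tagged_inj (I : eqType) (T : I -> eqType) p : injective (fun k : T p => Tagged T k).
Proof. by move=> k l /eqP; rewrite eq_Tagged => /eqP. Qed.

Lemma sum_tag (I : choiceType) (d : I -> nat) (V : nmodType)
    (s : seq {p : I & 'I_(d p)}) (G : {p : I & 'I_(d p)} -> V) p : uniq s ->
  \sum_(t <- s | tag t == p) G t =
  \sum_(k < d p) if Tagged (fun p => 'I_(d p)) k \in s
    then G (Tagged (fun p => 'I_(d p)) k) else 0.
Proof.
move=> us; rewrite -big_filter.
transitivity (\sum_(t <- [seq Tagged (fun p => 'I_(d p)) i | i <- enum 'I_(d p) &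
    Tagged (fun p => 'I_(d p)) i \in s]) G t); last first.
  by rewrite big_map big_filter big_enum_cond /= big_mkcond.
apply: perm_big; apply: uniq_perm.
- exact: filter_uniq.
- rewrite map_inj_uniq; first by rewrite filter_uniq // enum_uniq.
  exact: Tagged_inj.
move=> [q l]; rewrite mem_filter; apply/andP/mapP => /=.
  move=> [/eqP qp sl]; subst q; exists l => //.
  by rewrite mem_filter sl mem_enum.
move=> [i]; rewrite mem_filter => /andP[si _] E0; split; last by rewrite E0.
by have := congr1 tag E0 => /= ->.
Qed.

Section Envelope.
Variables (K : fieldType) (A : coalgebra K) (I : choiceType).
Variables (S E : I -> lcomodule A) (g : I -> A) (e : I -> {scalar A}).
Variables (f : forall j, E j -> A) (u : forall j, E j).
Hypothesis side : pointed_side S g e f u.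
Implicit Types M : lcomodule A.

(** Socle-finiteness in a form that passes to [M] along any injective colinear map out of [M]. *)
Definition weight_bound M N : Prop := forall n (x : 'I_n -> M),
  (forall i, exists p, weight (g p) (x i)) -> indep x -> (n <= N)%N.

Lemma weight_bound_inj M (L : lcomodule A) (i : M -> L) N : colinear i -> injective i ->
  weight_bound L N -> weight_bound M N.
Proof.
move=> ci injf bL n x wx ix; apply: (bL n (i \o x)); last exact: indep_image ci.1 _ _.
by move=> k; have [p wp] := wx k; exists p; exact: weight_colinear.
Qed.

Lemma weight_socle M p (x : M) : weight (g p) x -> socle M x.
Proof.
move=> wx; have [->|x0] := pselect (x = 0).
  by exists [::]; split=> //; rewrite big_nil.
exists [:: x]; split; last by rewrite big_seq1.
move=> y; rewrite inE => /eqP ->; exists [set k *: x | k in [set: K]].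
split; last by exists 1; rewrite ?scale1r.
split; first exact: weight_line_subcomodule wx.
  by move=> /(_ x) h; apply: x0; apply: h; exists 1; rewrite ?scale1r.
move=> Q sQ QL; have [Q0|Q0] := pselect (zero_set Q); [by left | right].
rewrite eqEsubset; split=> // _ [k _ <-].
have [z Qz z0] : exists2 z, Q z & z <> 0.
  apply: contrapT => nz; apply: Q0 => z Qz; apply: contrapT => z0.
  by apply: nz; exists z.
have [l _ lz] := QL z Qz.
have l0 : l != 0 by apply/eqP => l0; apply: z0; rewrite -lz l0 scale0r.
rewrite (_ : k *: x = (k * l^-1) *: z); first by apply: subspaceZ => //; exact: sQ.1.
by rewrite -lz scalerA divfK.
Qed.

Lemma socle_finite_bound M : socle_finite M -> exists N, weight_bound M N.
Proof.
move=> [N /has_dimP[b [_ sb _]]]; exists N => n x wx ix.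
by apply: (indep_le ix (c := b)) => i; apply: sb; have [p] := wx i; exact: weight_socle.
Qed.

Lemma act_weight M p q (x : M) : weight (g q) x -> act x (e p) = (p == q)%:R *: x.
Proof. by move=> /weightP ->; rewrite (idem_g side). Qed.

Section Weights.
Variables (M : lcomodule A) (d : I -> nat) (b : forall p, 'I_(d p) -> M).
Hypothesis wb : forall p k, weight (g p) (@b p k).
Hypothesis ib : forall p, indep (@b p).

Let J : choiceType := {p : I & 'I_(d p)}.
Let x (t : J) : M := b (tagged t).

(** Acting by [e p] kills every term whose weight is not [g p], so a relation splits into relations
    within single weights. *)
Lemma weight_family_indep (s : seq J) (a : J -> K) : uniq s ->
  \sum_(t <- s) a t *: x t = 0 -> forall t, t \in s -> a t = 0.
Proof.
move=> us a0 [p k] ps.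
pose a' (l : 'I_(d p)) := if Tagged (fun p => 'I_(d p)) l \in s
  then a (Tagged (fun p => 'I_(d p)) l) else 0.
suff /ib/(_ k) : \sum_l a' l *: b l = 0 by rewrite /a' ps.
have := congr1 (fun y => act y (e p)) a0.
rewrite (linear_fun0 (act_linear _)) (linear_fun_sum _ _ _ (act_linear _)) => E0.
rewrite -[RHS]E0 {E0}.
under [RHS]eq_bigr => t _.
  rewrite (linear_funZ (act_linear _)) (act_weight p (wb (tagged t))).
over.
rewrite [RHS](bigID (fun t => tag t == p)) /= [X in _ = _ + X]big1; last first.
  by move=> t /negPf tp; rewrite eq_sym tp scale0r scaler0.
rewrite addr0 sum_tag //; apply: eq_bigr => l _; rewrite /a'.
by case: ifP; rewrite ?scale0r // eqxx scale1r.
Qed.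

(** The maps dual to [b p] take [b p k] to vectors of weight [g p], normalised to [u p]; they vanish
    on vectors of another weight [g q] because [e p] does so on [g q]. *)
Lemma weight_family_homs : exists G : forall t : J, M -> E (tag t),
  forall t, [/\ colinear (G t), G t (x t) = u (tag t) &
    forall t', t' != t -> G t (x t') = 0].
Proof.
apply: (@choice_dep J (fun t => M -> E (tag t)) (fun t H => [/\ colinear H,
  H (x t) = u (tag t) & forall t', t' != t -> H (x t') = 0])) => -[p k].
have cb l : corner e M p (@b p l).
  by apply/(cornerP side); rewrite (act_weight p (wb l)) eqxx scale1r.
have [G cG [phi [phib GE]]] := dual_homs side cb (@ib p).
have [cf injf _] := side_f side p.
have GE' q l : f (G k (@b q l)) = ((p == q)%:R * phi k (@b q l)) *: g q.
  apply: scalar_sep => r; rewrite GE ((weightP _ _).1 (wb l)).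
  rewrite (linear_funZ (act_linear _)) (act_weight p (wb l)) !linearZ /=.
  by rewrite mulrC.
exists (G k); split=> [|/=|]; first exact: cG.
  by apply: injf; rewrite GE' // phib !eqxx mulr1 scale1r (side_fu side).
case=> q l /= lk; apply: injf; rewrite GE' // (linear_fun0 cf.1).
have [pq|pq] := eqVneq p q; last by rewrite mul0r scale0r.
subst q; rewrite /x /= phib; case: eqP => [kl|]; last by rewrite mulr0 scale0r.
by rewrite kl eqxx in lk.
Qed.

End Weights.

(** Take one copy of [E p] for each basis vector of weight [g p]. A nonzero kernel would contain a
    nonzero weight vector, whose coordinates are read off by [G]. Conversely, a weight vector of [X]
    has multiples of the [u p] as components, each the image of a basis vector, so the image of [M]
    is essential. *)
Lemma envelope_exists M N : weight_bound M N ->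
  exists (d : I -> nat) (X : lcomodule A)
    (s : seq {p : I & 'I_(d p)}) iota pi (i : M -> X),
  [/\ [/\ colinear i, injective i & essential (range i)], injective_comodule X,
      @biproduct K A _ (fun t : {p : I & 'I_(d p)} => E (tag t)) s X iota pi,
      uniq s & forall t, t \in s].
Proof.
move=> bM.
have /choice[d dP] : forall p, exists n, has_dim (@weight K A M (g p)) n.
  move=> p; have [||n _ ?] := @bounded_has_dim _ _ (@weight K A M (g p)) N.
  - exact: weight_subspace.
  - by move=> n c wc; apply: bM => k; exists p.
  - by exists n.
have [b bP] : exists b : forall p, 'I_(d p) -> M, forall p,
    [/\ forall k, weight (g p) (b p k), forall v, weight (g p) v -> in_span (b p) v
      & indep (b p)].
  apply: (@choice_dep I (fun p => 'I_(d p) -> M) (fun p c =>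
    [/\ forall k, weight (g p) (c k), forall v, weight (g p) v -> in_span c v
      & indep c])) => p.
  exact/has_dimP.
have wb p k : weight (g p) (b p k) by have [] := bP p.
have ib p : indep (b p) by have [] := bP p.
pose J : choiceType := {p : I & 'I_(d p)}.
pose x (t : J) : M := b (tag t) (tagged t).
have [s us sJ] : exists2 s : seq J, uniq s & forall t, t \in s.
  apply: (@full_seq _ N) => s us; apply: (bM _ (fun i => x (tnth (in_tuple s) i))).
    by move=> i; exists (tag (tnth (in_tuple s) i)); exact: wb.
  by apply: indep_seq => // a; exact: weight_family_indep.
have [G GP] := weight_family_homs wb ib.
have [X [iota [pi bX]]] := @biproduct_exists K A J (fun t => E (tag t)) s us.
have [ci cp pi1 pi0 sumE] := bX.
pose i m := \sum_(t <- s) iota t (G t m).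
have cI : colinear i.
  by apply: colinear_sum => t; apply: colinear_comp (ci t); case: (GP t).
have ix t : i (x t) = iota t (u (tag t)).
  rewrite /i (bigD1_seq t) //= big1 ?addr0; first by case: (GP t) => _ ->.
  move=> t' t't; case: (GP t') => _ _ ->; last by rewrite eq_sym.
  exact: (linear_fun0 (ci t').1).
have pii t m : pi t (i m) = G t m.
  exact: (biproduct_sum (fun t => G t m) bX us (sJ t)).
exists d, X, s, iota, pi, i; split=> //.
- split=> //.
    have kI := kernel_subcomodule cI.
    apply: (linear_inj cI.1) => v iv; apply: contrapT => v0.
    have [|y [p [/= iy y0 wy]]] := weight_exists side kI.
      by move=> h; apply: v0; exact: h.
    have [_ /(_ y wy)[a ya] _] := bP p.
    apply: y0; rewrite ya big1 // => k _.
    pose t : J := Tagged (fun p => 'I_(d p)) k.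
    have := pii t y; rewrite iy (linear_fun0 (cp t).1) ya.
    have [cG Gt Gt'] := GP t.
    rewrite (linear_fun_sum _ _ _ cG.1) (bigD1 k) //= big1 => [|l lk].
      rewrite (linear_funZ cG.1) addr0 -[b p k]/(x t) Gt => /esym/eqP.
      by rewrite scaler_eq0 => /orP[/eqP ->|/eqP/(side_u0 side)//]; rewrite scale0r.
    rewrite (linear_funZ cG.1) -[b p l]/(x (Tagged (fun p => 'I_(d p)) l)) Gt' ?scaler0 //.
    by apply: contraNneq lk => /Tagged_inj ->.
  move=> Q sQ Q0; have [y [p [Qy y0 wy]]] := weight_exists side sQ Q0.
  have /choice[a aP] : forall t : J, exists a, pi t y = a *: u (tag t).
    move=> t; have [->|py0] := pselect (pi t y = 0).
      by exists 0; rewrite scale0r.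
    have wpy : weight (g p) (pi t y) by apply: weight_colinear.
    by have [] := weight_E side wpy py0.
  move=> /(_ y) h; apply: y0; apply: h; split=> //.
  exists (\sum_(t <- s) a t *: x t) => //.
  rewrite (linear_fun_sum _ _ _ cI.1) [RHS]sumE; apply: eq_bigr => t _.
  by rewrite (linear_funZ cI.1) ix aP (linear_funZ (ci t).1).
- by apply: biproduct_injective bX _ => t; exact: side_injective side _.
Qed.

End Envelope.

(** * Minimal resolutions *)

Section Resolutions.
Variables (K : fieldType) (A : coalgebra K).
Implicit Types M N X Z : lcomodule A.

Lemma zero_injective Z : (forall x : Z, x = 0) -> injective_comodule Z.
Proof.
move=> Z0 M N i h ci inji ch; exists (fun=> 0); split; first exact: colinear0.
by move=> m; rewrite [RHS]Z0.
Qed.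

Definition zero_resolution M Z (M0 : forall x : M, x = 0) (Z0 : forall x : Z, x = 0) :
  inj_resolution M.
Proof.
refine (@InjResolution K A M (fun=> Z) (fun=> 0) (fun _ _ => 0) _ _ _ _ _ _).
- exact: colinear0.
- by move=> m; exact: colinear0.
- by move=> m; exact: zero_injective.
- by move=> x y _; rewrite [x]M0 [y]M0.
- by rewrite eqEsubset; split=> // x _; exists 0 => //; rewrite [x]Z0.
- by move=> m; rewrite eqEsubset; split=> // x _; exists 0 => //; rewrite [x]Z0.
Defined.

Section Cons.
Variables (M M' X : lcomodule A) (i : M -> X) (q : X -> M').
Hypotheses (ci : colinear i) (inji : injective i) (cq : colinear q).
Hypotheses (surjq : forall y, exists x, q x = y).
Hypotheses (exq : range i = [set x | q x = 0]) (iX : injective_comodule X).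
Variable R : inj_resolution M'.

Definition cons_term m : lcomodule A := if m is k.+1 then R k else X.

Definition cons_diff m : cons_term m -> cons_term m.+1 :=
  match m with
  | 0 => fun x => raug R (q x)
  | k.+1 => @rdiff K A M' R k
  end.

Definition cons_resolution : inj_resolution M.
Proof.
refine (@InjResolution K A M cons_term i cons_diff ci _ _ inji _ _).
- case=> [|m]; last exact: rdiff_colinear.
  exact: (colinear_comp cq (raug_colinear R)).
- by case=> [|m]; [exact: iX | exact: rterm_injective].
- rewrite exq eqEsubset; split=> x /= qx.
    by rewrite qx (linear_fun0 (raug_colinear R).1).
  by apply: (raug_inj (i := R)); rewrite qx (linear_fun0 (raug_colinear R).1).
- case=> [|m]; last exact: rdiff_exact.
  rewrite -[RHS]raug_exact eqEsubset; split=> _ [x _ <-]; first by exists (q x).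
  by have [y <-] := surjq x; exists y.
Defined.

Lemma cons_minimal : essential (range i) -> minimal_resolution R ->
  minimal_resolution cons_resolution.
Proof.
move=> ei [e0 eR]; split=> //; case=> [|m]; last exact: eR.
rewrite (_ : range _ = range (raug R)) // eqEsubset; split=> _ [x _ <-].
  by exists (q x).
by have [y <-] := surjq x; exists y.
Qed.

Lemma cons_finite : finite_resolution R -> finite_resolution cons_resolution.
Proof. by move=> [n nR]; exists n.+1; case=> // m; rewrite ltnS => /nR. Qed.

End Cons.

Definition tail_resolution N (R : inj_resolution N) N' (v : N' -> R 1) :
  colinear v -> injective v -> range v = range (@rdiff _ _ _ R 0) ->
  inj_resolution N'.
Proof.
move=> cv injv rv.
refine (@InjResolution K A N' (fun m => R m.+1) v (fun m => @rdiff _ _ _ R m.+1)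
  cv _ _ injv _ _).
- by move=> m; exact: rdiff_colinear.
- by move=> m; exact: rterm_injective.
- by rewrite rv; exact: rdiff_exact.
- by move=> m; exact: rdiff_exact.
Defined.

Lemma rdiff_raug N (R : inj_resolution N) x : rdiff (raug R x) = 0.
Proof. by have : range (raug R) (raug R x) by []; rewrite raug_exact. Qed.

Lemma rdiffK N (R : inj_resolution N) m (x : R m) : rdiff (rdiff x) = 0.
Proof.
by have : range (@rdiff _ _ _ R m) (rdiff x) by []; rewrite rdiff_exact.
Qed.

Lemma rdiff_ker N (R : inj_resolution N) m (x : R m.+1) :
  rdiff x = 0 -> exists y : R m, x = rdiff y.
Proof.
move=> dx; have : range (@rdiff _ _ _ R m) x by rewrite rdiff_exact.
by case=> y _ <-; exists y.
Qed.

Lemma raug_ker N (R : inj_resolution N) (x : R 0) :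
  rdiff x = 0 -> exists y, x = raug R y.
Proof.
move=> dx; have : range (raug R) x by rewrite raug_exact.
by case=> y _ <-; exists y.
Qed.

End Resolutions.

Section MinimalResolution.
Variables (K : fieldType) (A : coalgebra K) (I : choiceType).
Variables (S E : I -> lcomodule A) (g : I -> A) (e : I -> {scalar A}).
Variables (f : forall j, E j -> A) (u : forall j, E j).
Hypothesis side : pointed_side S g e f u.
Implicit Types M N X : lcomodule A.

(** More than the direct sum in [resolution_multiplicities]: the list makes the total number of
    summands finite, and the projections serve to count dimensions. *)
Definition finite_decomposition (d : I -> nat) (X : lcomodule A)
    (s : seq {p : I & 'I_(d p)}) : Prop :=
  [/\ uniq s, forall t, t \in s & exists iota pi,
    @biproduct K A _ (fun t : {p : I & 'I_(d p)} => E (tag t)) s X iota pi].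

Definition minimal_decomposition M (R : inj_resolution M) (d : nat -> I -> nat) : Prop :=
  [/\ minimal_resolution R, finite_resolution R &
      forall m, exists s, @finite_decomposition (d m) (R m) s].

Lemma zero_decomposition M : (forall x : M, x = 0) ->
  exists R d, @minimal_decomposition M R d.
Proof.
move=> M0; have [Z Z0] := zero_comodule_exists A.
exists (zero_resolution M0 Z0), (fun _ _ => 0%N); split.
- split=> [|m] Q sQ Q0; case: Q0 => x _; exact: Z0.
- by exists 0%N => m _ x _; exact: Z0.
- move=> m; exists [::]; split=> [//|[p []]//|].
  exists (fun _ _ => 0), (fun _ _ => 0); split=> [t|t|//|//|x].
  + exact: colinear0.
  + exact: colinear0.
  + by rewrite big_nil; exact: Z0.
Qed.

(* M is only required to be a retract of N up to an automorphism: this passes to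
   the cosyzygies, because an endomorphism of the envelope X of M that restricts
   to an automorphism of M is an automorphism. The cosyzygies are realized as the
   images M' and N' of X and R 0 in R 1, so that no quotient is needed. *)
Lemma minimal_resolution_exists n M N (s : M -> N) (r : N -> M) (R : inj_resolution N) :
  colinear s -> colinear r -> injective (r \o s) -> (forall y, exists x, r (s x) = y) ->
  (forall m, (n <= m)%N -> zero_set [set: R m]) ->
  (forall m, socle_finite (R m)) ->
  exists R' d, @minimal_decomposition M R' d.
Proof.
elim: n M N s r R => [|n ih] M N s r R cs cr injrs surjrs Rn sfR.
  apply: zero_decomposition => x; apply: injrs.
  suff z y : raug R y = 0.
    have s0 y : s y = 0.
      by apply: (raug_inj (i := R)); rewrite z (linear_fun0 (raug_colinear R).1).
    by rewrite /= !s0.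
  exact: (Rn 0%N isT (raug R y) Logic.I).
have injs : injective s by move=> x y xy; apply: injrs; rewrite /= xy.
have [B bR0] := socle_finite_bound g (sfR 0%N).
have cas := colinear_comp cs (raug_colinear R).
have bM : weight_bound g M B.
  by apply: weight_bound_inj cas _ bR0; apply: inj_comp injs; exact: raug_inj.
have [d0 [X [s0 [iota [pi [i [[ci inji ei] iX bX us0 fs0]]]]]]] := envelope_exists side bM.
(* [G] and [H] extend [s] and [r] to the terms of degree 0, so [phi] is an endomorphism of [X]
   extending the automorphism r o s of [M]. *)
have [G [cG GE]] : exists G : X -> R 0%N, colinear G /\ forall m, G (i m) = raug R (s m).
  exact: (rterm_injective (i := R) (m := 0) ci inji cas).
have [H [cH HE]] : exists H : R 0%N -> X, colinear H /\ forall m, H (raug R m) = i (r m).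
  apply: (iX N (R 0%N) (raug R) (i \o r)); first exact: raug_colinear.
    exact: raug_inj.
  exact: colinear_comp.
pose phi := H \o G; have cphi : colinear phi by exact: colinear_comp.
have phii m : phi (i m) = i (r (s m)) by rewrite /phi /= GE HE.
have injphi : injective phi.
  apply: (linear_inj cphi.1) => x phx; apply: contrapT => x0.
  apply: (ei _ (kernel_subcomodule cphi)); first by move=> h; apply: x0; exact: h.
  move=> _ [[m _ <-] /=]; rewrite phii => im0.
  have m0 : r (s m) = 0 by apply: inji; rewrite im0 (linear_fun0 ci.1).
  rewrite (_ : m = 0) ?(linear_fun0 ci.1) //; apply: injrs => /=.
  by rewrite m0 (linear_fun0 cs.1) (linear_fun0 cr.1).
(* Injectivity of [X] gives a left inverse [psi] of [phi]. It is injective on the image of [M],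
   because r o s is onto, hence injective by essentiality; so [phi] is bijective. *)
have [psi [cpsi psiE]] := iX X X phi idfun cphi injphi (colinear_id X).
have injpsi : injective psi.
  apply: (linear_inj cpsi.1) => x psx; apply: contrapT => x0.
  apply: (ei _ (kernel_subcomodule cpsi)); first by move=> h; apply: x0; exact: h.
  move=> _ [[m _ <-] /=]; have [m' <-] := surjrs m; rewrite -phii psiE /= => ->.
  exact: (linear_fun0 cphi.1).
have phipsi x : phi (psi x) = x by apply: injpsi; rewrite psiE.
(* The kernel of [dG] is exactly the image of [M]: an element of it is sent by [phi] into that
   image, where r o s is onto. *)
pose dG := (@rdiff _ _ _ R 0) \o G.
have cdG : colinear dG by exact: (colinear_comp cG (rdiff_colinear R 0)).
have kdG x : dG x = 0 -> exists m, x = i m.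
  move=> /raug_ker[y Gy]; have [m rsm] := surjrs (r y).
  by exists m; apply: injphi; rewrite phii rsm /phi /= Gy HE.
have dGi m : dG (i m) = 0 by rewrite /dG /= GE rdiff_raug.
have [M' [vM [cvM injvM rvM]]] := subcomod_exists (range_subcomodule cdG).
have [N' [vN [cvN injvN rvN]]] :=
  subcomod_exists (range_subcomodule (rdiff_colinear R 0)).
have [|pM cpM pME] := corestrict cvM injvM cdG; first by rewrite rvM.
have [|pN cpN pNE] := corestrict cvN injvN (rdiff_colinear R 0); first by rewrite rvN.
have surjpM y : exists x, pM x = y.
  have : range dG (vM y) by rewrite -rvM; exists y.
  by case=> x _ xy; exists x; apply: injvM; rewrite pME.
have surjpN y : exists x, pN x = y.
  have : range (@rdiff _ _ _ R 0) (vN y) by rewrite -rvN; exists y.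
  by case=> x _ xy; exists x; apply: injvN; rewrite pNE.
have [|s' cs' s'E] := corestrict cvN injvN cvM.
  by rewrite rvM rvN => _ [x _ <-]; exists (G x).
have pMi m : pM (i m) = 0 by apply: injvM; rewrite pME dGi (linear_fun0 cvM.1).
have [|r' cr' r'E] := factor_surj cpN (colinear_comp cH cpM) surjpN.
  move=> x pNx; have /raug_ker[y ->] : rdiff x = 0 by rewrite -pNE pNx (linear_fun0 cvN.1).
  by rewrite /= HE pMi.
(* On cosyzygies r' o s' is the map induced by [phi], so it inherits bijectivity, as the induction
   hypothesis requires. *)
have rsE x : r' (s' (pM x)) = pM (phi x).
  rewrite (_ : s' (pM x) = pN (G x)) ?r'E //.
  by apply: injvN; rewrite s'E pME pNE.
have [||||R' [d [mR fR dR]]] := ih M' N' s' r' (tail_resolution cvN injvN rvN) cs' cr'.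
- apply: linear_inj.
    by apply: linear_comp; [exact: cs'.1 | exact: cr'.1].
  move=> y; have [x <-] := surjpM y; rewrite /= rsE => /(congr1 vM).
  rewrite pME (linear_fun0 cvM.1) => /kdG[m pm].
  have [m' rsm] := surjrs m; rewrite (_ : x = i m') //.
  by apply: injphi; rewrite phii rsm.
- move=> y; have [x <-] := surjpM y; exists (pM (psi x)).
  by rewrite rsE phipsi.
- by move=> m nm; exact: Rn.
- by move=> m; exact: sfR.
have exM : range i = [set x | pM x = 0].
  rewrite eqEsubset; split=> [_ [m _ <-]|x /= px]; first exact: pMi.
  have [|m ->] := kdG x; last by exists m.
  by rewrite -pME px (linear_fun0 cvM.1).
exists (cons_resolution ci inji cpM surjpM exM iX R').
exists (fun m => if m is k.+1 then d k else d0); split.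
- exact: cons_minimal.
- exact: cons_finite.
- by case=> [|m]; [exists s0; split=> //; exists iota, pi | exact: dR].
Qed.

End MinimalResolution.

(** * Independence of Ext from the resolution *)

(** [F] and [G] are mutually inverse modulo [B] and [B'], so [F] carries a basis of the first
    quotient to one of the second. *)
Lemma has_dim_mod_transport (K : fieldType) (V V' : lmodType K)
    (Z B : set V) (Z' B' : set V') (F : V -> V') (G : V' -> V) n :
  subspace Z -> subspace B -> subspace B' -> linear F -> linear G ->
  (forall v, Z v -> Z' (F v)) -> (forall v, B v -> B' (F v)) ->
  (forall v, Z' v -> Z (G v)) -> (forall v, B' v -> B (G v)) ->
  (forall v, Z v -> B (G (F v) - v)) -> (forall v, Z' v -> B' (F (G v) - v)) ->
  has_dim_mod Z B n -> has_dim_mod Z' B' n.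
Proof.
move=> sZ sB sB' lF lG FZ FB GZ GB GF FG [b [Zb spb ib]].
have Fsum a : \sum_i a i *: F (b i) = F (\sum_i a i *: b i).
  by rewrite linear_fun_sum //; apply: eq_bigr => i _; rewrite linear_funZ.
exists (F \o b); split=> [i|v Zv|a]; first exact/FZ/Zb.
  have [a Ba] := spb _ (GZ _ Zv); exists a => /=; rewrite Fsum.
  rewrite -(subrKA (F (G v))) -linear_funB //; apply: subspaceD => //; last exact: FB.
  by rewrite -opprB -scaleN1r; apply: subspaceZ => //; exact: FG.
rewrite /= Fsum => /GB Ba; apply: ib.
set w := \sum_i a i *: b i in Ba *.
have Zw : Z w by apply: subspace_sum => // i _; exact: subspaceZ.
by rewrite -(subKr (G (F w)) w); apply: subspaceB => //; exact: GF.
Qed.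

Section Comparison.
Variables (K : fieldType) (A : coalgebra K).
Implicit Types M N : lcomodule A.

Definition chain_map N N' (R : inj_resolution N) (R' : inj_resolution N')
    (h : forall m, R m -> R' m) : Prop :=
  (forall m, colinear (h m)) /\ forall m x, h m.+1 (rdiff x) = rdiff (h m x).

Lemma comparison N (R R' : inj_resolution N) :
  exists2 h : forall m, R m -> R' m, chain_map h &
    forall x, h 0%N (raug R x) = raug R' x.
Proof.
(* Each map is carried with the fact that it preserves cocycles: this is what the extension to the
   next degree needs. *)
pose St m := {h : R m -> R' m | colinear h /\ forall x, rdiff x = 0 -> rdiff (h x) = 0}.
have /cid[h0 [ch0 h0E]] : exists h0 : R 0%N -> R' 0%N,
    colinear h0 /\ forall x, h0 (raug R x) = raug R' x.
  exact: (rterm_injective (i := R') (m := 0) (raug_colinear R) (raug_inj (i := R))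
    (raug_colinear R')).
have h0d x : rdiff x = 0 -> rdiff (h0 x) = 0.
  by move=> /raug_ker[y ->]; rewrite h0E rdiff_raug.
have step m (s : St m) : {s' : St m.+1 | forall x, sval s' (rdiff x) = rdiff (sval s x)}.
  apply: cid; case: s => h [ch hd] /=.
  have [k ck kE] := injective_extend (rterm_injective (i := R') (m := m.+1))
    (rdiff_colinear R m) (colinear_comp ch (rdiff_colinear R' m)) hd.
  have kd x : rdiff x = 0 -> rdiff (k x) = 0.
    by move=> /rdiff_ker[y ->]; rewrite kE /= rdiffK.
  by exists (exist _ k (conj ck kd)).
pose F : forall m, St m :=
  nat_rect St (exist _ h0 (conj ch0 h0d)) (fun m s => sval (step m s)).
exists (fun m => sval (F m)); last by [].
split=> [m|m x]; first exact: (svalP (F m)).1.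
exact: (svalP (step m (F m))).
Qed.

Lemma homotopy N N' (R : inj_resolution N) (R' : inj_resolution N')
    (h : forall m, R m -> R' m) : chain_map h ->
  (forall x, h 0%N (raug R x) = 0) ->
  exists2 sg : forall m, R m.+1 -> R' m, forall m, colinear (sg m) &
    (forall x, h 0%N x = sg 0%N (rdiff x)) /\
    forall m x, h m.+1 x = rdiff (sg m x) + sg m.+1 (rdiff x).
Proof.
move=> [ch hd] h0.
(* The invariant says that h - d s, in the next degree, vanishes on the image of the differential,
   so that it extends along that differential to the next homotopy component. *)
pose St m := {s : R m.+1 -> R' m | colinear s /\
  forall x, rdiff (h m x) = rdiff (s (rdiff x))}.
have /cid2[s0 cs0 s0E] : exists2 s0 : R 1%N -> R' 0%N, colinear s0 &
    forall x, s0 (rdiff x) = h 0%N x.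
  apply: injective_extend; [exact: rterm_injective | exact: rdiff_colinear
    | exact: ch |].
  by move=> x /raug_ker[y ->].
have s0d x : rdiff (h 0%N x) = rdiff (s0 (rdiff x)) by rewrite s0E.
have step m (s : St m) : {s' : St m.+1 |
    forall x, h m.+1 x = rdiff (sval s x) + sval s' (rdiff x)}.
  apply: cid; case: s => s [cs sE] /=.
  have [|k ck kE] := injective_extend (rterm_injective (i := R') (m := m.+1))
    (rdiff_colinear R m.+1)
    (colinearB (ch m.+1) (colinear_comp cs (rdiff_colinear R' m))).
    by move=> x /rdiff_ker[y ->]; rewrite /= hd sE subrr.
  have kd x : rdiff (h m.+1 x) = rdiff (k (rdiff x)).
    by rewrite kE (linear_funB (rdiff_colinear R' _).1) /= rdiffK subr0.
  by exists (exist _ k (conj ck kd)) => x; rewrite /= kE addrC subrK.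
pose F : forall m, St m :=
  nat_rect St (exist _ s0 (conj cs0 s0d)) (fun m s => sval (step m s)).
exists (fun m => sval (F m)); first by move=> m; exact: (svalP (F m)).1.
by split=> [x|m x]; [rewrite -s0E | exact: (svalP (step m (F m)))].
Qed.

Lemma cocycles_subspace M N (R : inj_resolution N) m : subspace (@cocycles K A M N R m).
Proof.
have [ld _] := rdiff_colinear R m.
split; first by split; [exact: colinear0 | move=> x; exact: linear_fun0].
move=> a f g [cf df] [cg dg]; split; first exact: (hom_subspace M (R m)).2.
by move=> x; rewrite /= ld df dg scaler0 addr0.
Qed.

Lemma coboundaries_subspace M N (R : inj_resolution N) m :
  subspace (@coboundaries K A M N R m).
Proof.
case: m => [|m] /=.
  by split=> // a f g -> ->; rewrite scaler0 addr0.
have [ld _] := rdiff_colinear R m.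
split.
  by exists (fun=> 0); [exact: colinear0 | apply/funext => x; rewrite linear_fun0].
move=> a _ _ [f cf ->] [g cg ->]; exists (a *: f + g).
  exact: (hom_subspace M (R m)).2.
by apply/funext => x; rewrite [in RHS]/= ld.
Qed.

Lemma Ext_transport M N (R R' : inj_resolution N) m n :
  has_dim_mod (@cocycles K A M N R m) (@coboundaries K A M N R m) n ->
  has_dim_mod (@cocycles K A M N R' m) (@coboundaries K A M N R' m) n.
Proof.
have [h [ch hd] h0] := comparison R R'; have [k [ck kd] k0] := comparison R' R.
have lin (Q Q' : inj_resolution N) (l : forall m, Q m -> Q' m) :
    (forall m, colinear (l m)) -> linear (fun F : M -> Q m => (fun x => l m (F x))).
  by move=> cl a F G; apply/funext => x; exact: (cl m).1.
have coc (Q Q' : inj_resolution N) (l : forall m, Q m -> Q' m) : chain_map l ->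
    forall F, @cocycles K A M N Q m F -> @cocycles K A M N Q' m (fun x => l m (F x)).
  move=> [cl ld] F [cF dF]; split; first exact: (colinear_comp cF (cl m)).
  by move=> x; rewrite -ld dF (linear_fun0 (cl m.+1).1).
have cob (Q Q' : inj_resolution N) (l : forall m, Q m -> Q' m) : chain_map l ->
    forall F, @coboundaries K A M N Q m F ->
      @coboundaries K A M N Q' m (fun x => l m (F x)).
  move=> [cl ld]; case: m {lin coc} => [|m'] F /=.
    by move=> ->; apply/funext => x; exact: (linear_fun0 (cl 0%N).1).
  move=> [G cG ->]; exists (fun x => l m' (G x)).
    exact: (colinear_comp cG (cl m')).
  by apply/funext => x; rewrite ld.
(* The homotopy belongs to the difference of l' o l and the identity. On a cocycle its term
   containing the differential of [F] is 0, and what is left is a coboundary. *)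
have hom (Q Q' : inj_resolution N) (l : forall m, Q m -> Q' m)
    (l' : forall m, Q' m -> Q m) : chain_map l -> chain_map l' ->
    (forall x, l 0%N (raug Q x) = raug Q' x) ->
    (forall x, l' 0%N (raug Q' x) = raug Q x) ->
    forall F, @cocycles K A M N Q m F ->
      @coboundaries K A M N Q m ((fun x => l' m (l m (F x))) - F).
  move=> [cl ld] [cl' ld'] l0 l'0.
  have [|x|sg csg [sg0 sgS]] := @homotopy N N Q Q (fun m x => l' m (l m x) - x).
  - split=> [m'|m' x].
      apply: colinearB (colinear_id _); exact: (colinear_comp (cl m') (cl' m')).
    by rewrite ld ld' (linear_funB (rdiff_colinear Q _).1).
  - by rewrite l0 l'0 subrr.
  move=> F [cF dF]; case: m F cF dF {lin coc cob} => [|m'] F cF dF /=.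
    apply/funext => x; rewrite -[LHS]/(l' 0%N (l 0%N (F x)) - F x) sg0 dF.
    exact: (linear_fun0 (csg 0%N).1).
  exists (fun x => sg m' (F x)); first exact: (colinear_comp cF (csg m')).
  apply/funext => x; rewrite -[LHS]/(l' m'.+1 (l m'.+1 (F x)) - F x) sgS dF.
  by rewrite (linear_fun0 (csg m'.+1).1) addr0.
apply: (@has_dim_mod_transport _ _ _ _ _ _ _ (fun F x => h m (F x)) (fun F x => k m (F x))).
- exact: cocycles_subspace.
- exact: coboundaries_subspace.
- exact: coboundaries_subspace.
- exact: (lin _ _ h ch).
- exact: (lin _ _ k ck).
- exact: (coc _ _ h (conj ch hd)).
- exact: (cob _ _ h (conj ch hd)).
- exact: (coc _ _ k (conj ck kd)).
- exact: (cob _ _ k (conj ck kd)).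
- exact: (hom _ _ h k (conj ch hd) (conj ck kd) h0 k0).
- exact: (hom _ _ k h (conj ck kd) (conj ch hd) k0 h0).
Qed.

Lemma Ext_resolution M N (R : inj_resolution N) m n : Ext_has_dim m M N n ->
  has_dim_mod (@cocycles K A M N R m) (@coboundaries K A M N R m) n.
Proof. by move=> [R' /Ext_transport]; apply. Qed.

End Comparison.

(** * Multiplicities and Euler characteristics *)

Section Multiplicities.
Variables (K : fieldType) (A : coalgebra K) (I : choiceType).
Variables (S E : I -> lcomodule A) (g : I -> A) (e : I -> {scalar A}).
Variables (f : forall j, E j -> A) (u : forall j, E j).
Hypothesis side : pointed_side S g e f u.
Implicit Types M N X : lcomodule A.

(** The kernel of the differential is the image of the preceding map, essential by minimality. The
    image of [S p] is zero or a line, and a line meeting the kernel lies in it. *)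
Lemma minimal_ker N (R : inj_resolution N) m p (h : S p -> R m) :
  minimal_resolution R -> colinear h -> forall w, rdiff (h w) = 0.
Proof.
move=> [e0 eR] ch w; have [v [v0 wv vS]] := side_S side p.
have [lh _] := ch; have [ld _] := rdiff_colinear R m.
have [k ->] := vS w; rewrite (linear_funZ lh) (linear_funZ ld).
have [->|x0] := pselect (h v = 0); first by rewrite (linear_fun0 ld) scaler0.
have ek : essential [set x : R m | rdiff x = 0].
  case: m {h ch lh ld x0} => [|m]; first by rewrite -raug_exact.
  by rewrite -rdiff_exact; exact: eR.
have [y [dy [l _ ly]] y0] : exists2 y, ([set x : R m | rdiff x = 0] `&`
    [set k *: h v | k in [set: K]]) y & y <> 0.
  apply: contrapT => ny.
  apply: (ek _ (weight_line_subcomodule (weight_colinear ch wv))).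
    by move=> /(_ (h v)) h0; apply: x0; apply: h0; exists 1; rewrite ?scale1r.
  by move=> y Qy; apply: contrapT => y0; apply: ny; exists y.
have l0 : l != 0 by apply/eqP => l0; apply: y0; rewrite -ly l0 scale0r.
have /eqP : l *: rdiff (h v) = 0 by rewrite -(linear_funZ ld) ly.
by rewrite scaler_eq0 (negPf l0) => /eqP ->; rewrite scaler0.
Qed.

(** By [weight_E] the weight [g p] occurs in [E q] only for q = p, and there only along [u p]: each
    copy of [E p] contributes one dimension. *)
Lemma weight_multiplicity (d : I -> nat) X
    (iota : forall t : {p : I & 'I_(d p)}, E (tag t) -> X) p :
  direct_sum_decomp iota [set: X] -> has_dim (@weight K A X (g p)) (d p).
Proof.
move=> [ci spn ind]; pose T (k : 'I_(d p)) := Tagged (fun p => 'I_(d p)) k.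
apply/has_dimP; exists (fun k : 'I_(d p) => iota (T k) (u p)); split=> [k|x wx|a a0].
- exact: (weight_colinear (ci (T k)) (side_u side p)).
- have [s [y [us xE]]] := (spn x).1 Logic.I.
  (* Directness of the sum forces every component of [x] to have the weight of [x]. *)
  have wy t : t \in s -> weight (g p) (y t).
    move=> ts; apply/weightP => q; apply/eqP; rewrite -subr_eq0; apply/eqP.
    apply: (ind s (fun t => act (y t) q - q (g p) *: y t)) => //.
    under eq_bigr => t' _.
      have [lt at'] := (colinearP _).1 (ci t').
      rewrite (linear_funB lt) at' (linear_funZ lt); over.
    rewrite sumrB -scaler_sumr -xE -(linear_fun_sum _ _ _ (act_linear _)) -xE.
    by rewrite ((weightP _ _).1 wx) subrr.
  have /choice[a aP] : forall t, exists a, t \in s -> tag t = p ->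
      y t = a *: u (tag t).
    move=> t; have [y0|y0] := pselect (y t = 0).
      by exists 0 => _ _; rewrite y0 scale0r.
    have [ts|ts] := boolP (t \in s); last by exists 0.
    by have [_ [k yk]] := weight_E side (wy t ts) y0; exists k.
  exists (fun k => if T k \in s then a (T k) else 0).
  rewrite xE (bigID (fun t => tag t == p)) /= [X in _ + X]big_seq_cond.
  rewrite [X in _ + X]big1 => [|t /andP[ts tp]].
    rewrite addr0 sum_tag //; apply: eq_bigr => k _; rewrite -/(T k).
    by case: ifP => ks; rewrite ?scale0r // (aP (T k)) // (linear_funZ (ci _).1).
  have [->|y0] := pselect (y t = 0); first exact: (linear_fun0 (ci t).1).
  by have [pt _] := weight_E side (wy t ts) y0; rewrite pt eqxx in tp.
- pose s := [seq T k | k <- enum 'I_(d p)].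
  have us : uniq s by rewrite map_inj_uniq ?enum_uniq //; exact: Tagged_inj.
  pose y (t : {p : I & 'I_(d p)}) := (\sum_k (T k == t)%:R * a k) *: u (tag t).
  have yT k : y (T k) = a k *: u p.
    rewrite /y (bigD1 k) //= eqxx mul1r big1 ?addr0 // => l lk.
    case: eqP => [/Tagged_inj lk'|]; last by rewrite mul0r.
    by rewrite lk' eqxx in lk.
  move=> k; have ks : T k \in s by apply: map_f; rewrite mem_enum.
  have : y (T k) = 0.
    apply: (ind s y) => //; rewrite big_map big_enum -[RHS]a0.
    by apply: eq_bigr => l _; rewrite yT (linear_funZ (ci _).1).
  by rewrite yT => /eqP; rewrite scaler_eq0 => /orP[/eqP//|/eqP/(side_u0 side)].
Qed.

(** By [minimal_ker] every colinear map from [S p] is a cocycle and every coboundary is 0.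
    Evaluation at a generator identifies these maps with the vectors of weight [g p]. *)
Lemma cocycles_minimal N (R : inj_resolution N) m p n : minimal_resolution R ->
  has_dim (@weight K A (R m) (g p)) n ->
  has_dim_mod (@cocycles K A (S p) N R m) (@coboundaries K A (S p) N R m) n.
Proof.
move=> mR dn; have [v [v0 wv vS]] := side_S side p.
have [psi psiv] := functional1 v0.
have psiE w : w = psi w *: v.
  by have [k ->] := vS w; rewrite linearZ /= psiv mulr1.
have actS (w : S p) q : act w q = q (g p) *: w.
  rewrite [in LHS](psiE w) (linear_funZ (act_linear _)) ((weightP _ _).1 wv).
  by rewrite scalerA mulrC -scalerA -psiE.
have -> : @coboundaries K A (S p) N R m = [set 0].
  rewrite eqEsubset; split; last by move=> _ ->; exact: (coboundaries_subspace _ R m).1.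
  case: m {dn} => [//|m] _ [h ch ->]; apply/funext => w.
  exact: (minimal_ker mR ch).
pose F (x : R m) : S p -> R m := fun w => psi w *: x.
have lF : linear F.
  move=> a x y; apply/funext => w; rewrite /F scalerDr !scalerA.
  by rewrite -[RHS]/(a *: (psi w *: x) + psi w *: y) scalerA [a * _]mulrC.
have -> : @cocycles K A (S p) N R m = F @` (@weight K A (R m) (g p)).
  rewrite eqEsubset; split=> [h [ch dh]|_ [x wx <-]].
    exists (h v); first exact: weight_colinear wv.
    by apply/funext => w; rewrite /F -(linear_funZ ch.1) -psiE.
  have cF : colinear (F x).
    apply/colinearP; split=> [a w w'|w q]; rewrite /F.
      by rewrite linearP /= scalerDl scalerA.
    rewrite actS linearZ (linear_funZ (act_linear _)) ((weightP _ _).1 wx) /=.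
    by rewrite !scalerA mulrC.
  split=> //; exact: minimal_ker mR cF.
apply: has_dim_image => //; last exact: weight_subspace.
move=> x _ /(congr1 (fun h : S p -> R m => h v)).
by rewrite /F psiv scale1r.
Qed.

Lemma minimal_Ext N (R : inj_resolution N) (d : nat -> I -> nat) m p :
  minimal_resolution R ->
  (exists iota : forall t : {p : I & 'I_(d m p)}, E (tag t) -> R m,
    direct_sum_decomp iota [set: R m]) ->
  has_dim_mod (@cocycles K A (S p) N R m) (@coboundaries K A (S p) N R m) (d m p).
Proof.
by move=> mR [iota dR]; apply: cocycles_minimal => //; exact: weight_multiplicity dR.
Qed.

Lemma resolution_multiplicities_Ext N d m p :
  resolution_multiplicities E N d -> Ext_has_dim m (S p) N (d m p).
Proof. by move=> [R [mR _ dR]]; exists R; exact: minimal_Ext. Qed.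

Lemma cocycles_dim_unique N (R : inj_resolution N) m p n n' : minimal_resolution R ->
  has_dim_mod (@cocycles K A (S p) N R m) (@coboundaries K A (S p) N R m) n ->
  has_dim_mod (@cocycles K A (S p) N R m) (@coboundaries K A (S p) N R m) n' -> n = n'.
Proof.
move=> mR; have -> : @coboundaries K A (S p) N R m = [set 0].
  rewrite eqEsubset; split; last by move=> _ ->; exact: (coboundaries_subspace _ R m).1.
  case: m => [//|m] _ [h ch ->]; apply/funext => w.
  exact: (minimal_ker mR ch).
exact: has_dim_unique.
Qed.

Lemma Ext_multiplicity N d m p n :
  resolution_multiplicities E N d -> Ext_has_dim m (S p) N n -> n = d m p.
Proof.
move=> [R [mR _ dR]] /(Ext_resolution R) hn.
exact: (cocycles_dim_unique mR hn (minimal_Ext p mR (dR m))).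
Qed.

Lemma resolution_multiplicities_unique N d d' :
  resolution_multiplicities E N d -> resolution_multiplicities E N d' -> d = d'.
Proof.
move=> rd rd'; apply/funext => m; apply/funext => p.
exact: (Ext_multiplicity rd' (resolution_multiplicities_Ext m p rd)).
Qed.

(** Uniqueness makes the choice in [res_mult] agree with the multiplicities of whatever minimal
    resolution is at hand. *)
Lemma res_mult_eq N d : resolution_multiplicities E N d -> res_mult E N = d.
Proof.
move=> rd; apply: (resolution_multiplicities_unique _ rd).
by apply: (@xgetPex _ (fun _ _ => 0%N) [set d | resolution_multiplicities E N d]); exists d.
Qed.

Lemma minimal_decomposition_mult M (R : inj_resolution M) d :
  minimal_decomposition E R d -> resolution_multiplicities E M d.
Proof.
move=> [mR fR dR]; exists R; split=> // m.
by have [s [us fs [iota [pi bX]]]] := dR m; exists iota; exact: biproduct_decomp bX us fs.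
Qed.

Lemma finite_decomposition_exists M : finite_socle_finite_resolution M ->
  exists (R : inj_resolution M) d, minimal_decomposition E R d.
Proof.
move=> [R [[n Rn] sR]].
apply: (minimal_resolution_exists side (n := n.+1) (s := idfun) (r := idfun) (R := R)) => //.
- exact: colinear_id.
- exact: colinear_id.
- by move=> y; exists y.
Qed.

Lemma corner_biproduct (J : choiceType) (F : J -> lcomodule A) (s : seq J) X iota pi q
    (c : J -> nat) :
  @biproduct K A J F s X iota pi -> uniq s ->
  (forall t, has_dim (corner e (F t) q) (c t)) ->
  has_dim (corner e X q) (\sum_(t <- s) c t).
Proof.
move=> [ci cp pi1 pi0 sumE] us dc.
(* The part of the corner supported on the sublist [r]: it grows one summand at a time, by
   rank-nullity along the projection to the new summand. *)
pose W r := corner e X q `&` [set x | x = \sum_(t <- r) iota t (pi t x)].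
have sW r : subspace (W r).
  have [c0 cD] := corner_subspace e X q.
  split=> [|a x y [cx /= xE] [cy /= yE]].
    split=> //=; rewrite big1 // => t _.
    by rewrite (linear_fun0 (cp t).1) (linear_fun0 (ci t).1).
  split; first exact: cD.
  rewrite /= {1}xE {1}yE scaler_sumr -big_split /=; apply: eq_bigr => t _.
  by rewrite (cp t).1 (ci t).1.
suff h r : uniq r -> {subset r <= s} -> has_dim (W r) (\sum_(t <- r) c t).
  rewrite (_ : corner e X q = W s); first exact: h.
  by rewrite eqEsubset; split=> [x cx|x []//]; split=> //; exact: sumE.
elim: r => [_ _|t r ih /= /andP[tr ur] rs].
  rewrite big_nil; apply/has_dimP; exists (fun=> 0); split=> [[]//|x [_ /=]|a _ []//].
  by rewrite big_nil => ->; exists (fun=> 0); rewrite big_ord0.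
have ts : t \in s by apply: rs; rewrite mem_head.
have {}rs : {subset r <= s} by move=> t' t'r; apply: rs; rewrite inE t'r orbT.
have corner_map M N (h : M -> N) x : colinear h -> corner e M q x -> corner e N q (h x).
  by move=> /colinearP[lh ah] [y _ <-]; exists (h y); rewrite ?ah.
rewrite big_cons addnC; apply: (rank_nullity (f := pi t)) => //; first exact: (cp t).1.
- rewrite (_ : _ `&` _ = W r); first exact: ih.
  rewrite eqEsubset; split=> x.
    move=> [[cx /= xE] /= px]; split=> //=.
    by rewrite [LHS]xE big_cons px (linear_fun0 (ci t).1) add0r.
  move=> [cx /= xE]; have px : pi t x = 0.
    rewrite xE (linear_fun_sum _ _ _ (cp t).1) big_seq big1 // => t' t'r.
    by rewrite pi0 //; apply: contraNneq tr => ->.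
  by split=> //; split=> //=; rewrite big_cons px (linear_fun0 (ci t).1) add0r.
- rewrite (_ : pi t @` _ = corner e (F t) q); first exact: dc.
  rewrite eqEsubset; split=> [_ [x [cx _] <-]|y cy].
    exact: corner_map cx.
  exists (iota t y); last by rewrite pi1.
  split; first exact: corner_map cy.
  rewrite /= big_cons pi1 // big_seq big1 ?addr0 // => t' t'r.
  by rewrite pi0 ?(linear_fun0 (ci t').1) //; apply: contraNneq tr => <-.
Qed.

Lemma corner_S j q : has_dim (corner e (S j) q) (j == q).
Proof.
have [v [v0 wv vS]] := side_S side j.
have actv : act v (e q) = (q == j)%:R *: v by exact: (act_weight side).
apply/has_dimP; exists (fun=> v); split=> [|w [w' _ <-]|a].
- case: eqP => [jq [k _]|_ []//].
  by exists v => //; rewrite actv -jq eqxx scale1r.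
- have [k ->] := vS w'; rewrite (linear_funZ (act_linear _)) actv eq_sym.
  case: eqP => _; last by exists (fun=> 0); rewrite big_ord0 scale0r scaler0.
  by exists (fun=> k); rewrite big_ord_recl big_ord0 addr0 scale1r.
- move: a; case: (j == q) => a /=; last by move=> _ [].
  rewrite big_ord_recl big_ord0 addr0 => /eqP; rewrite scaler_eq0.
  by move=> /orP[/eqP a0 i|/eqP//]; rewrite ord1.
Qed.

(* R e_q is an exact complex, since e_q is idempotent and acts functorially. *)
Lemma euler_corner N (R : inj_resolution N) n q (w : nat -> nat) z : 
  has_dim (corner e N q) z ->
  (forall m, has_dim (corner e (R m) q) (w m)) ->
  (forall m, (n <= m)%N -> zero_set [set: R m]) ->
  \sum_(m < n) (-1) ^+ m * (w m)%:Z = z%:Z.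
Proof.
move=> dz dw Rn.
pose Z m := corner e (R m) q `&` [set x | rdiff x = 0].
have sc m := corner_subspace e (R m) q.
have sZ m : subspace (Z m) by apply: kernel_subspace => //; exact: (rdiff_colinear R m).1.
have /choice[zeta dZ] : forall m, exists k, has_dim (Z m) k.
  move=> m; have [k _ Zk] := has_dim_sub (sZ m) (@subIsetl _ _ _) (dw m).
  by exists k.
have cP M x := @cornerP _ _ _ _ _ _ _ _ _ side M q x.
(* Rank-nullity: the image on one corner is the kernel in the next, because a preimage [y] may be
   replaced by y e_q. *)
have wE m : w m = (zeta m + zeta m.+1)%N.
  apply: (has_dim_unique (dw m)).
  apply: (rank_nullity (f := @rdiff _ _ _ R m)) => //; first exact: (rdiff_colinear R m).1.
  have [_ ad] := (colinearP _).1 (rdiff_colinear R m).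
  rewrite (_ : _ @` _ = Z m.+1) // eqEsubset; split=> [_ [x cx <-]|x [cx /= dx]].
    by split; [apply/cP; rewrite -ad ((cP _ _).1 cx) | exact: rdiffK].
  have [y xy] := rdiff_ker dx; exists (act y (e q)); first by exists y.
  by rewrite ad -xy; exact/cP.
have z0 : zeta 0%N = z.
  apply: (has_dim_unique (dZ 0%N)); rewrite (_ : Z 0%N = raug R @` corner e N q).
    apply: has_dim_image => //; first exact: (raug_colinear R).1.
      move=> x _ rx; apply: (raug_inj (i := R)).
      by rewrite rx (linear_fun0 (raug_colinear R).1).
    exact: corner_subspace.
  have [_ ar] := (colinearP _).1 (raug_colinear R).
  rewrite eqEsubset; split=> [x [cx /= dx]|_ [x cx <-]]; last first.
    by split; [apply/cP; rewrite -ar ((cP _ _).1 cx) | exact: rdiff_raug].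
  have [y xy] := raug_ker dx; exists (act y (e q)); first by exists y.
  by rewrite ar -xy; exact/cP.
have zn : zeta n = 0%N.
  apply: (has_dim_unique (dZ n)); apply/has_dimP; exists (fun=> 0).
  split=> [[]//|x _|a _ []//]; exists (fun=> 0); rewrite big_ord0.
  exact: (Rn n (leqnn n) x Logic.I).
(* The alternating sum telescopes, and its last term vanishes at [n] since [zeta n] is 0. *)
have tel k : \sum_(m < k) (-1) ^+ m * (w m)%:Z = z%:Z - (-1) ^+ k * (zeta k)%:Z.
  elim: k => [|k ihk]; first by rewrite big_ord0 z0 expr0 mul1r subrr.
  rewrite big_ord_recr /= ihk wE PoszD mulrDr exprS mulN1r mulNr opprK addrA.
  by rewrite subrK.
by rewrite tel zn mulr0 subr0.
Qed.

Lemma euler_multiplicities j d (R : inj_resolution (S j)) (c : I -> I -> nat) :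
  (forall p q, has_dim (corner e (E p) q) (c p q)) ->
  minimal_decomposition E R d ->
  exists (n : nat) (P : seq I), [/\ uniq P,
    forall m p, d m p != 0%N -> (m < n)%N && (p \in P) &
    forall q, \sum_(p <- P) (\sum_(m < n) (-1) ^+ m * (d m p)%:Z) * (c p q)%:Z =
      (j == q)%:R].
Proof.
move=> dc [mR [n Rn] dR].
have [s sP] : exists s : forall m, seq {p : I & 'I_(d m p)}, forall m,
    @finite_decomposition K A I E (d m) (R m) (s m).
  exact: (@choice_dep nat (fun m => seq {p : I & 'I_(d m p)})
    (fun m => @finite_decomposition K A I E (d m) (R m))).
(* All indices occurring in the resolution. The bound in [finite_resolution] is strict, so the terms
   of degree at most [n] remain, [n.+1] in number. *)
pose P := undup (flatten [seq [seq tag t | t <- s m] | m <- iota 0 n.+1]).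
have dnP m p : d m p != 0%N -> (m < n.+1)%N && (p \in P).
  rewrite -lt0n => dp; pose t := Tagged (fun p => 'I_(d m p)) (Ordinal dp).
  have mn : (m < n.+1)%N.
    rewrite ltnNge; apply/negP => nm.
    have [_ fs [io [pi [_ cp pi1 _ _]]]] := sP m.
    apply: (side_u0 side (j := p)); rewrite -(pi1 t (u p) (fs t)).
    by rewrite (Rn m nm (io t (u p)) Logic.I) (linear_fun0 (cp t).1).
  rewrite mn mem_undup; apply/flattenP; exists [seq tag t | t <- s m].
    by apply/mapP; exists m => //; rewrite mem_iota.
  by apply/mapP; exists t => //; have [_ fs _] := sP m.
exists n.+1, P; split=> [|//|q]; first exact: undup_uniq.
have dw m : has_dim (corner e (R m) q) (\sum_(p <- P) d m p * c p q)%N.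
  have [us fs [io [pi bX]]] := sP m.
  suff -> : (\sum_(p <- P) d m p * c p q = \sum_(t <- s m) c (tag t) q)%N.
    exact: corner_biproduct bX us (fun t => dc (tag t) q).
  transitivity (\sum_(p <- P) \sum_(t <- s m | tag t == p) c (tag t) q)%N.
    apply: eq_bigr => p _; rewrite (@sum_tag _ _ nat) //.
    under eq_bigr do rewrite fs.
    by rewrite /= big_const_ord mulnC; exact/esym/iter_addn_0.
  under eq_bigr do rewrite big_mkcond.
  rewrite exchange_big /=; apply: eq_big_seq => t ts.
  rewrite (bigD1_seq (tag t)) ?undup_uniq //=; last first.
    have dt : d m (tag t) != 0%N by rewrite -lt0n; exact: leq_ltn_trans (ltn_ord (tagged t)).
    by have /andP[] := dnP m (tag t) dt.
  by rewrite eqxx big1 ?addn0 // => p; rewrite eq_sym => /negPf ->.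
under eq_bigr do rewrite big_distrl /=.
rewrite exchange_big /=.
rewrite natz -(@euler_corner _ R n.+1 q _ _ (corner_S j q) dw Rn).
apply: eq_bigr => m _; rewrite -natz natr_sum mulr_sumr.
by apply: eq_bigr => p _; rewrite natrM !natz mulrA.
Qed.

End Multiplicities.

(** * The two sides *)

Section OneDimensional.
Variables (K : fieldType) (A : coalgebra K).

Lemma one_dim_simple (T : lcomodule A) (x : T) :
  x <> 0 -> (forall w, exists k, w = k *: x) -> simple_comodule T.
Proof.
move=> x0 sx; split=> [||Q sQ _].
- by apply/subcomoduleP.
- by move=> /(_ x Logic.I).
- have [Q0|Q0] := pselect (zero_set Q); [by left | right].
  rewrite eqEsubset; split=> // w _; have [k ->] := sx w.
  have [z Qz z0] : exists2 z, Q z & z <> 0.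
    apply: contrapT => nz; apply: Q0 => z Qz; apply: contrapT => z0.
    by apply: nz; exists z.
  have [l lz] := sx z.
  have l0 : l != 0 by apply/eqP => l0; apply: z0; rewrite lz l0 scale0r.
  rewrite (_ : k *: x = (k * l^-1) *: z); first by apply: subspaceZ => //; exact: sQ.1.
  by rewrite lz scalerA divfK.
Qed.

Lemma one_dim_iso (T T' : lcomodule A) (x : T) (x' : T') h :
  x <> 0 -> weight h x -> (forall w, exists k, w = k *: x) ->
  x' <> 0 -> weight h x' -> (forall w, exists k, w = k *: x') -> comod_iso T T'.
Proof.
move=> x0 wx sx x'0 wx' sx'.
have [psi px] := functional1 x0; have [psi' px'] := functional1 x'0.
have E w : w = psi w *: x by have [k ->] := sx w; rewrite linearZ /= px mulr1.
have E' w : w = psi' w *: x' by have [k ->] := sx' w; rewrite linearZ /= px' mulr1.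
exists (fun w => psi w *: x'); split.
  apply/colinearP; split=> [a u v|w p]; first by rewrite linearP /= scalerDl scalerA.
  rewrite (linear_funZ (act_linear _)) ((weightP _ _).1 wx') {1}(E w).
  rewrite (linear_funZ (act_linear _)) ((weightP _ _).1 wx) !linearZ /= px mulr1.
  by rewrite scalerA mulrC.
exists (fun w => psi' w *: x) => w; first by rewrite linearZ /= px' mulr1 -E.
by rewrite linearZ /= px mulr1 -E'.
Qed.

Lemma pointed_side_exists (I : choiceType) (S E : I -> lcomodule A)
    (e : I -> {scalar A}) (g : I -> A) :
  (forall M : lcomodule A, simple_comodule M -> has_dim [set: M] 1) ->
  (forall j, exists v : S j,
    [/\ v <> 0, weight (g j) v & forall w, exists k, w = k *: v]) ->
  (forall (M : lcomodule A) h (x : M), weight h x -> x <> 0 -> exists j, h = g j) ->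
  injective g ->
  (forall j, injective_envelope (S j) (E j)) ->
  (forall j, conv (e j) (e j) =1 e j) ->
  (forall j, exists f : E j -> A, [/\ @colinear K A (E j) (regular A) f, injective f &
    range f = [set lactf (e j) c | c in [set: A]]]) ->
  exists f u, @pointed_side K A I S E g e f u.
Proof.
move=> simp Sj exh injg env idem Ef.
have [f fP] : exists f : forall j, E j -> A, forall j,
    [/\ @colinear K A (E j) (regular A) (f j), injective (f j) &
    range (f j) = [set lactf (e j) c | c in [set: A]]].
  exact: (@choice_dep I (fun j => E j -> A) (fun j f => [/\ @colinear K A (E j) (regular A) f,
    injective f & range f = [set lactf (e j) c | c in [set: A]]])).
have [u uP] : exists u : forall j, E j, forall j, [/\ weight (g j) (u j), f j (u j) = g j,
    u j <> 0 & essential [set k *: u j | k in [set: K]]].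
  apply: (@choice_dep I E (fun j u => [/\ weight (g j) u, f j u = g j,
    u <> 0 & essential [set k *: u | k in [set: K]]])) => j.
  have [v [v0 wv vS]] := Sj j; have [_ [i [ci inji ei]]] := env j.
  have [cf injf _] := fP j.
  have wi := weight_colinear ci wv; have iv0 : i v <> 0.
    by move=> iv; apply: v0; apply: inji; rewrite iv (linear_fun0 ci.1).
  (* In [A] a vector of weight [g j] is its counit times [g j]; dividing by this scalar [l]
     normalises [u j] so that it is sent to [g j]. *)
  have fE := weight_regular (weight_colinear cf wi).
  set l := counit A _ in fE.
  have l0 : l != 0.
    apply/eqP => l0; apply: iv0; apply: injf.
    by rewrite fE l0 scale0r (linear_fun0 cf.1).
  exists (l^-1 *: i v); split.
  - by apply: subspaceZ => //; exact: weight_subspace.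
  - by rewrite (linear_funZ cf.1) fE scalerA mulVf // scale1r.
  - by move=> /eqP; rewrite scaler_eq0 invr_eq0 (negPf l0) => /eqP.
  rewrite (_ : [set _ | _ in _] = range i) // eqEsubset.
  split=> [_ [k _ <-]|_ [w _ <-]].
    by exists ((k * l^-1) *: v) => //; rewrite (linear_funZ ci.1) scalerA.
  have [k ->] := vS w; exists (k * l) => //.
  by rewrite scalerA mulfK // (linear_funZ ci.1).
exists f, u; split=> //.
- by move=> j; have [] := env j.
- by move=> j; have [] := uP j.
- by move=> j; have [] := uP j.
- by move=> j; have [] := uP j.
- by move=> j; have [] := uP j.
Qed.

(** Every nonzero subcomodule contains [u j], so two of them never intersect in 0. *)
Lemma indecomposable_E (I : choiceType) (S E : I -> lcomodule A) g e f u j :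
  @pointed_side K A I S E g e f u -> indecomposable (E j).
Proof.
move=> side; have u0 := side_u0 side (j := j); split.
  by move=> /(_ (u j) Logic.I).
move=> P Q sP sQ PQ _; apply: contrapT => /not_orP[P0 Q0].
have mem (R : set (E j)) : subcomodule R -> ~ zero_set R -> R (u j).
  move=> sR R0; apply: contrapT => nR.
  apply: (side_essential side sR R0) => _ [[k _ <-] Rk].
  have [->|k0] := eqVneq k 0; first by rewrite /= scale0r.
  case: nR; rewrite -[u j]scale1r -(mulVf k0) -scalerA.
  by apply: subspaceZ => //; exact: sR.1.
by apply: u0; apply: PQ; split; exact: mem.
Qed.

End OneDimensional.

Section TwoSides.
Variables (K : fieldType) (C : coalgebra K) (I : choiceType) (D : injective_data C I).
Hypothesis hpointed : pointed C.

Lemma tswapK (V W : lmodType K) (t : tensor V W) : tswap (tswap t) = t.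
Proof.
move: t; apply: (tens_linear_ext (f := fun t => tswap (tswap t)) (g := id)) => //.
  by apply: linear_comp; exact: tswap_linear.
by move=> v w; rewrite !tswapE.
Qed.

Lemma idem_conv j : conv (idem D j) (idem D j) =1 idem D j.
Proof. by have [] := idem_primitive D j. Qed.

Lemma sides_exist : exists g,
  (exists f u, @pointed_side K C I (Sl D) (El D) g (idem D) f u) /\
  (exists f u, @pointed_side K (op_coalgebra C) I (Sr D) (Er D) g (idem D) f u).
Proof.
have [g gP] : exists g : I -> C, forall j, exists v : Sl D j,
    [/\ v <> 0, weight (g j) v & forall w, exists k, w = k *: v].
  apply: (@choice_dep I (fun=> C) (fun j h => exists v : Sl D j,
    [/\ v <> 0, weight h v & forall w, exists k, w = k *: v])) => j.
  have := hpointed.1 _ (Sl_simple D j).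
  by move=> /one_dim_weight[x [h [x0 wx sx]]]; exists h, x.
(* The line of a weight vector is simple, hence isomorphic to some [Sl D j], and colinear maps
   preserve weights. *)
have exh (M : lcomodule C) h (x : M) : weight h x -> x <> 0 -> exists j, h = g j.
  move=> wx x0.
  have [T [v [cv injv rv]]] := subcomod_exists (weight_line_subcomodule wx).
  have [y _ vy] : range v x by rewrite rv; exists 1; rewrite ?scale1r.
  have wy : weight h y by apply: (weight_colinear_inj cv injv); rewrite vy.
  have y0 : y <> 0 by move=> y0; apply: x0; rewrite -vy y0 (linear_fun0 cv.1).
  have sT : simple_comodule T.
    apply: (one_dim_simple y0) => w.
    have : range v (v w) by [].
    rewrite rv => -[k _ kx]; exists k; apply: injv.
    by rewrite (linear_funZ cv.1) vy kx.
  have [j [[phi [cphi bphi]] _]] := Sl_repr D sT; exists j.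
  have [w [w0 ww sw]] := gP j.
  have [k kE] := sw (phi y).
  have p0 : phi y <> 0.
    by move=> p0; apply: y0; apply: (bij_inj bphi); rewrite p0 (linear_fun0 cphi.1).
  apply: (weight_unique (weight_colinear cphi wy) _ p0).
  by rewrite kE; apply: subspaceZ => //; exact: weight_subspace.
(* Lines of equal weight are isomorphic, and [Sl_repr] allows one index per isomorphism class. *)
have injg : injective g.
  move=> j k jk; have [j' [_ uj']] := Sl_repr D (Sl_simple D k).
  have [v [v0 wv sv]] := gP j; have [w [w0 ww sw]] := gP k.
  transitivity j'; [apply/esym/uj' | apply: uj'].
  - by apply: (one_dim_iso w0 ww sw v0 _ sv); rewrite -jk.
  - exact: (one_dim_iso w0 ww sw w0 ww sw).
exists g; split; apply: pointed_side_exists => //.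
- exact: hpointed.1.
- exact: El_envelope.
- exact: idem_conv.
- by move=> j; have [f fP] := El_idem D j; exists f.
- exact: hpointed.2.
(* The generator [w] of the dual is the functional with value 1 at [v]. Comparing the two coactions
   at [w] and [v] shows that its weight is [g j]. *)
- move=> j; have [v [v0 wv sv]] := gP j; have [b [bE bC]] := Sr_dual D j.
  have [psi psiv] := functional1 v0.
  have psiE m : m = psi m *: v by have [k ->] := sv m; rewrite linearZ /= psiv mulr1.
  have [w [wE _]] := bE psi.
  have sw y : y = b y v *: w.
    have sc : scalar (fun m => b y m) by move=> a m m'; exact: linearPr.
    have [z [_ zu]] := bE (scalar_of sc).
    transitivity z; [by apply/esym/zu | apply: zu => m /=].
    rewrite linearZl_LR /= wE [in RHS](psiE m) linearZr_LR /=.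
    by rewrite /GRing.scale /= mulrC.
  exists w; split.
  + move=> w0; have := wE v; rewrite psiv w0 linear0l => /esym/eqP.
    by rewrite oner_eq0.
  + have [n [c [y [_ cE]]]] := tens_indep (coact (Sr D j) w).
    pose h : op_coalgebra C := \sum_i (b (y i) v : K) *: c i.
    have cw : weight h w.
      rewrite /weight cE (linear_fun_sum _ _ _ (tens_linearl _)); apply: eq_bigr => i _.
      by rewrite {1}(sw (y i)) tensZ.
    suff <- : h = g j by []; have := bC w v.
    have bl1 : bilinear_map (fun (c : C) (y : Sr D j) => b y v *: c).
      split=> [z a c1 c2|c1 a z z']; first by rewrite /= scalerDr !scalerA mulrC.
      by rewrite /= linearPl scalerDl [in RHS]scalerA.
    have bl2 : bilinear_map (fun (c : C) (y : Sl D j) => b w y *: c).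
      split=> [z a c1 c2|c1 a z z']; first by rewrite /= scalerDr !scalerA mulrC.
      by rewrite /= linearPr scalerDl [in RHS]scalerA.
    rewrite wv (tlift_tens _ _ bl2) wE psiv scale1r => <-.
    rewrite cE (linear_fun_sum _ _ _ (tlift_linear bl1)).
    by apply: eq_bigr => i _; rewrite (tlift_tens _ _ bl1).
  + by move=> y; exists (b y v).
(* A weight of a right comodule is group-like, hence is its own weight in the left comodule [C],
   where the left classification applies. *)
- move=> M h x wx x0; have := weight_comul wx x0.
  move=> /(congr1 (fun t => tswap t)); rewrite /= /op_comul tswapK tswapE => hh.
  apply: (exh (regular C) h h hh) => h0; have := weight_counit wx x0.
  by rewrite h0 linear0 => /esym/eqP; rewrite oner_eq0.
- exact: Er_envelope.
- by move=> j c; rewrite conv_op; exact: idem_conv.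
- move=> j; have [f [cf injf rf]] := Er_idem D j; exists f; split=> //.
  rewrite rf; congr (_ @` _); apply/funext => c.
  by rewrite lactfE /= /op_comul tswapK.
Qed.

End TwoSides.

(** * Cartan matrices *)

Section SideMatrix.
Variables (K : fieldType) (A : coalgebra K) (I : choiceType).
Variables (S E : I -> lcomodule A) (g : I -> A) (e : I -> {scalar A}).
Variables (f : forall j, E j -> A) (u : forall j, E j).
Hypothesis side : pointed_side S g e f u.
Variable c : I -> I -> nat.
Hypothesis dc : forall p q, has_dim (corner e (E p) q) (c p q).
Hypothesis fin : forall j, finite_socle_finite_resolution (S j).

Lemma res_mult_spec j : resolution_multiplicities E (S j) (res_mult E (S j)).
Proof.
have [R [d mR]] := finite_decomposition_exists side (fin j).
have rd := minimal_decomposition_mult mR.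
by rewrite (res_mult_eq side rd).
Qed.

(** On the left side this is [cartan_left]; on the right side it is the transpose of
    [cartan_right]. *)
Definition euler_mx j p : int :=
  \sum_(m \in [set: nat]) (-1) ^+ m * (res_mult E (S j) m p)%:Z.

Lemma euler_mx_spec j : exists P : seq I,
  [/\ uniq P, forall p, euler_mx j p != 0 -> p \in P &
    forall q, \sum_(p <- P) euler_mx j p * (c p q)%:Z = (j == q)%:R].
Proof.
have [R [d mR]] := finite_decomposition_exists side (fin j).
have [n [P [uP dP dE]]] := euler_multiplicities side dc mR.
have rE := res_mult_eq side (minimal_decomposition_mult mR).
have EE p : euler_mx j p = \sum_(m < n) (-1) ^+ m * (d m p)%:Z.
  rewrite /euler_mx rE (@fsbigE _ _ _ _ _ (iota 0 n)) ?iota_uniq //.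
    rewrite -[in LHS](subn0 n) -/(index_iota 0 n) big_mkord.
    by apply: eq_bigl => m; rewrite in_setT.
  move=> m _; rewrite mem_iota add0n /= => mn.
  have -> : d m p = 0%N by apply/eqP; apply: contraNT mn => /dP/andP[].
  by rewrite mulr0.
exists P; split=> // [p|q]; last by under eq_bigr do rewrite EE.
apply: contraNT => pP; rewrite EE big1 // => m _.
have -> : d m p = 0%N by apply/eqP; apply: contraNT pP => /dP/andP[].
by rewrite mulr0.
Qed.

Lemma euler_mx_row_finite : row_finite euler_mx.
Proof.
move=> j; have [P [_ hP _]] := euler_mx_spec j.
by apply: (sub_finite_set _ (finite_seq P)) => p /= /hP.
Qed.

Lemma euler_mx_inverse : left_inverse_mx euler_mx (fun p q => (c p q)%:Z).
Proof.
move=> j q; have [P [uP hP sP]] := euler_mx_spec j; split.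
  apply: (sub_finite_set _ (finite_seq P)) => p /=.
  by rewrite mulf_eq0 negb_or => /andP[/hP].
rewrite (@fsbigE _ _ _ _ _ P) //.
  by rewrite -[RHS]sP; apply: eq_bigl => p; rewrite in_setT.
move=> p _ pP; suff -> : euler_mx j p = 0 by rewrite mul0r.
by apply/eqP; apply: contraNT pP => /hP.
Qed.

(** Stated as an equivalence because the Ext symmetry in [sharp_Euler] is an equivalence between
    dimension relations. *)
Lemma res_mult_Ext j m p n :
  Ext_has_dim m (S p) (S j) n <-> n = res_mult E (S j) m p.
Proof.
split=> [|->]; first exact: Ext_multiplicity side _ _ _ _ _ (res_mult_spec j).
exact: (resolution_multiplicities_Ext side _ _ (res_mult_spec j)).
Qed.

End SideMatrix.

(** * The Cartan matrix seen from the left and from the right *)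

Section CartanMatrices.
Variables (K : fieldType) (C : coalgebra K) (I : choiceType) (D : injective_data C I).
Variables (g : I -> C) (f : forall j, El D j -> C) (u : forall j, El D j).
Hypothesis side : pointed_side (Sl D) g (idem D) f u.
Variables (f' : forall j, Er D j -> C) (u' : forall j, Er D j).
Hypothesis side' : @pointed_side K (op_coalgebra C) I (Sr D) (Er D) g (idem D) f' u'.
Variable c : I -> I -> nat.
Hypothesis dc : forall p q, has_dim (corner (idem D) (El D p) q) (c p q).

Let Z i j : set C :=
  [set lact (idem D i) (@ract K C (regular C) x (idem D j)) | x in [set: C]].

Lemma cartan_has_dim i j : has_dim (Z i j) (c i j).
Proof.
have [cf injf rf] := side_f side i; have [lf af] := (colinearP _).1 cf.
have -> : Z i j = @f i @` corner (idem D) (El D i) j.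
  rewrite eqEsubset; split=> [_ [x _ <-]|_ [_ [x _ <-] <-]].
    have : range (@f i) (lactf (idem D i) x) by rewrite rf; exists x.
    case=> y _ fy; exists (act y (idem D j)); first by exists y.
    by rewrite af fy -lactf_act.
  have : range (@f i) (f x) by exists x.
  by rewrite rf => -[y _ fy]; exists y => //; rewrite af -fy -lactf_act.
apply: has_dim_image => //; last exact: corner_subspace.
by move=> x _ fx; apply: injf; rewrite fx (linear_fun0 lf).
Qed.

Lemma cartanE i j : cartan D i j = (c i j)%:Z.
Proof. by rewrite /cartan (dimK_eq (cartan_has_dim i j)). Qed.

(** The embedding of [Er D j] has image C e_j, and the right action for the opposite coalgebra is
    the left one, so this corner is again e_i C e_j. The dimensions on the right therefore form the
    transpose of [c]. *)
Lemma corner_Er i j :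
  has_dim (@corner K (op_coalgebra C) I (idem D) (Er D j) i) (c i j).
Proof.
have [cf injf _] := side_f side' j; have [lf af] := (colinearP _).1 cf.
apply: (has_dim_image_inv (f := @f' j)) => //.
- by move=> x _ fx; apply: injf; rewrite fx (linear_fun0 lf).
- exact: corner_subspace.
have [h [ch injh rh]] := Er_idem D j.
rewrite (_ : @f' j @` _ = Z i j); first exact: cartan_has_dim.
have rf : range (@f' j) = [set @ract K C (regular C) x (idem D j) | x in [set: C]].
  have [_ _ ->] := side_f side' j; congr (_ @` _); apply/funext => x.
  by rewrite lactfE /= /op_comul tswapK.
rewrite eqEsubset; split=> [_ [_ [x _ <-] <-]|_ [x _ <-]].
  have : range (@f' j) (f' x) by exists x.
  by rewrite rf => -[y _ fy]; exists y => //; rewrite af -fy.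
have : range (@f' j) (@ract K C (regular C) x (idem D j)) by rewrite rf; exists x.
by case=> y _ fy; exists (act y (idem D i)); [exists y | rewrite af fy].
Qed.

Lemma dimvec_El j i : dimvec D (El D j) i = (c j i)%:Z.
Proof. by rewrite /dimvec (dimK_eq (dc j i)). Qed.

Lemma dimvec_Sl j p : dimvec D (Sl D j) p = unit_vec j p.
Proof. by rewrite /dimvec (dimK_eq (corner_S side j p)) /unit_vec -natz. Qed.

Lemma dimvec_r_Er j i : dimvec_r D (Er D j) i = (c i j)%:Z.
Proof. by rewrite /dimvec_r (dimK_eq (hom_dim side' (corner_Er i j))). Qed.

End CartanMatrices.

Lemma fsum_ext (I : choiceType) (F G : I -> int) x : F =1 G ->
  finite_set [set i | G i != 0] /\ \sum_(i \in [set: I]) G i = x ->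
  finite_set [set i | F i != 0] /\ \sum_(i \in [set: I]) F i = x.
Proof. by move=> /funext ->. Qed.

Unset Implicit Arguments.
Set Strict Implicit.
Set Printing Implicit Defensive.

Theorem theorem2p15 (K : fieldType) (C : coalgebra K) (I : choiceType)
    (D : injective_data C I) (hpointed : pointed C) (hcomputable : computable C) :
  [/\ (* (a) *)
      left_sharp_Euler C ->
        [/\ row_finite (cartan_left D),
            left_inverse_mx (cartan_left D) (cartan D) &
            forall j : I,
              [/\ vec_mul_is (dimvec_r D (Er D j)) (transpose (cartan_left D))
                    (dimvec D (Sl D j)),
                  forall p : I, dimvec D (Sl D j) p = unit_vec j p &
                  forall i : I, dimvec_r D (Er D j) i = cartan D i j]],
      (* (b) *)
      right_sharp_Euler C ->
        [/\ column_finite (cartan_right D),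
            right_inverse_mx (cartan_right D) (cartan D) &
            forall j : I,
              vec_mul_is (dimvec D (El D j)) (cartan_right D) (dimvec D (Sl D j)) /\
              forall p : I, dimvec D (Sl D j) p = unit_vec j p] &
      (* (c) *)
      sharp_Euler C ->
        [/\ forall i j : I, cartan_left D i j = cartan_right D i j,
            row_finite (cartan_left D),
            column_finite (cartan_left D),
            left_inverse_mx (cartan_left D) (cartan D) &
            right_inverse_mx (cartan_left D) (cartan D)]].
Proof.
have [g [[f [u side]] [f' [u' side']]]] := sides_exist D hpointed.
(* The envelopes are injective and indecomposable, so computability makes the maps between them, and
   with these the corners, finite-dimensional. *)
have [c dc] : exists c : I -> I -> nat, forall p q,
    has_dim (corner (idem D) (El D p) q) (c p q).
  have fd p q : exists n, has_dim (corner (idem D) (El D p) q) n.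
    apply: (corner_fin_dim side); apply: hcomputable.
    - exact: side_injective side p.
    - exact: indecomposable_E side.
    - exact: side_injective side q.
    - exact: indecomposable_E side.
  have /choice[c cP] : forall pq : I * I, exists n,
      has_dim (corner (idem D) (El D pq.1) pq.2) n by move=> pq; exact: fd.
  by exists (fun p q => c (p, q)) => p q; exact: (cP (p, q)).
have cE := cartanE side dc.
have lS (j : I) : simple_comodule (Sl D j) := Sl_simple D j.
have rS (j : I) : simple_comodule (Sr D j).
  by have [w [w0 _ sw]] := side_S side' j; exact: one_dim_simple w0 sw.
have Sd := dimvec_Sl side.
have Erd := dimvec_r_Er side side' dc.
have Eld := dimvec_El dc.
have dc' := corner_Er side side' dc.
have a : left_sharp_Euler C ->
    row_finite (cartan_left D) /\ left_inverse_mx (cartan_left D) (cartan D).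
  move=> [_ fin]; have finS j := fin _ (lS j); split.
    exact: (euler_mx_row_finite side dc finS).
  have := euler_mx_inverse side dc finS.
  by congr left_inverse_mx; apply/funext => p; apply/funext => q; rewrite cE.
have b : right_sharp_Euler C ->
    column_finite (cartan_right D) /\ right_inverse_mx (cartan_right D) (cartan D).
  move=> [_ fin]; have finS j := fin _ (rS j).
  (* The right-hand table is the transpose of [c]: a left inverse of it, transposed back, is a right
     inverse of the Cartan matrix. *)
  have dcT p q := dc' q p; split.
    exact: (euler_mx_row_finite side' dcT finS).
  move=> i p; rewrite /unit_vec eq_sym.
  apply: fsum_ext (euler_mx_inverse side' dcT finS p i) => k.
  by rewrite cE mulrC.
split=> [h|h|h].
- have [rf li] := a h; split=> // j; split=> [p||i]; [|exact: Sd|by rewrite Erd cE].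
  rewrite Sd /unit_vec eq_sym; apply: fsum_ext (li p j) => i.
  by rewrite Erd cE mulrC.
- have [cf ri] := b h; split=> // j; split; last exact: Sd.
  move=> p; rewrite Sd; apply: fsum_ext (ri j p) => i.
  by rewrite Eld cE.
- have [hl hr hE] := h; have [rf li] := a hl; have [cf ri] := b hr.
  have finl j := hl.2 _ (lS j); have finr j := hr.2 _ (rS j).
  have LR : cartan_left D = cartan_right D.
    apply/funext => i; apply/funext => j; rewrite /cartan_left /cartan_right.
    apply: eq_fsbigr => m _; congr (_ * Posz _).
    (* The left multiplicity is the dimension of Ext^m(S(j), S(i)), the right one that of
       Ext^m(DS(i), DS(j)); duality reverses the arguments, which matches the two index
       conventions. *)
    apply/(res_mult_Ext side' finr)/(hE (Sl D j) (Sl D i) (Sr D j) (Sr D i)) => //.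
    - exact: Sr_dual.
    - exact: Sr_dual.
    - exact/(res_mult_Ext side finl).
  by split=> //; rewrite LR.
Qed.
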